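(* Let $p\ge 1$ and $d\ge 1$ with $p>d/2$. Suppose that the balance law $\partial_t u+\sum_{m=1}^d\partial_m f_m(u)=s$ on $[0,T]\times\Omega$ has an entropy pair, that it possesses a smooth solution $u\in C^{p+1}([0,T]\times\Omega;\mathcal A)$ with associated compact convex set $K\subset\mathcal A$ as described in the context, that the source $s$ is continuous and bounded, that the two-point fluxes $f^{\mathrm{num}}_m$ are entropy-conservative of class $C^{p+1}$, and that $(M,Q_1,\dots,Q_d)$ is a family (indexed by $h$) of diagonal-norm periodic SBP operators of order $p$ satisfying the structural remainder bound. Suppose further that the initial data satisfy $u^h_i(0)\in K$ for all $i$ and $E_h(0)^{1/2}\le C_0h^p$ with a constant $C_0\ge0$ independent of $h$ and $N$. Then there is $h_0>0$, depending on $T$ and the data, such that for every member of the family with $0<h<h_0$ the semidiscretization $$m_i\frac{\mathrm d}{\mathrm dt}u^h_i(t)+\sum_{m=1}^d 2\sum_{j=1}^N (Q_m)_{ij}\,f^{\mathrm{num}}_m\bigl(u^h_i(t),u^h_j(t)\bigr)=m_i\,s(t,x_i),\qquad i\in\{1,\dots,N\},$$ has a unique solution on $[0,T]$, all states $u^h_i(t)$ remain in $K$, and $$\|\vec u^{\,h}(t)-\vec u(t)\|_M\le C_T\,h^p,\qquad t\in[0,T],$$ where $\|\vec a\|_M^2=\sum_i m_i|a_i|^2$, $\vec u(t)=(u(t,x_i))_{i=1}^N$, and $C_T$ is independent of $h$; in the presence of a source, $C_T$ additionally depends on $\|s\|_{L^\infty}$ and $C_w$. In particular, the numerical solution converges to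 the smooth solution at the order of accuracy $p$ of the SBP operators.
   Context: **Continuous problem.** $\Omega=(\mathbb R/L\mathbb Z)^d$ with $L>0$, $d\ge1$; $T>0$; $\partial_m$ is the partial derivative in direction $m\in\{1,\dots,d\}$. $\mathcal A\subseteq\mathbb R^n$ is open and convex, $f_m\in C^1(\mathcal A;\mathbb R^n)$ are the fluxes, $s:[0,T]\times\Omega\to\mathbb R^n$ the source. *Entropy pair:* a strictly convex $U\in C^2(\mathcal A;\mathbb R)$ and $F_m\in C^1(\mathcal A;\mathbb R)$ with $F_m'(a)^T=U'(a)^Tf_m'(a)$ for all $a\in\mathcal A$ and all $m$. Put $w(a)=U'(a)$ (entropy variables) and $\psi_m(a)=w(a)^Tf_m(a)-F_m(a)$ (entropy potentials). *Smooth solution and $K$:* $u\in C^{p+1}([0,T]\times\Omega;\mathcal A)$ solves the balance law classically; $K\subset\mathcal A$ is compact and convex, contains a neighborhood of the range $\{u(t,x)\}$, and $c_U\,\mathrm I\le U''(a)\le C_U\,\mathrm I$ for $a\in K$ with constants $0<c_U\le C_U<\infty$. If $s\not\equiv0$, additionally $U\in C^3(K)$ and $C_w=\sup_K|U'''|$; if $s\equiv0$, $C_w=0$. **Discretization.** A family of discretizations is indexed by a nominal mesh size $h>0$; all constants below are independent of $h$ and $N$. Each member has nodes $x_1,\dots,x_N\in\Omega$ (arbitrary layout, duplicated coordinates allowed). A function $g$ on $\Omega$ gives the grid function $\vec g=(g(x_i))_i$; operators act componentwise on vector-valued grid functions. *Diagonal-norm periodic SBP operators of order $p\ge1$:* matrices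 $M,Q_1,\dots,Q_d\in\mathbb R^{N\times N}$, $D_m=M^{-1}Q_m$, with (i) $M=\mathrm{diag}(m_1,\dots,m_N)$, $c_Mh^d\le m_i\le C_Mh^d$, $c_N\le Nh^d\le C_N$, with $0<c_M\le C_M$, $0<c_N\le C_N$; (ii) $Q_m+Q_m^T=0$; (iii) $Q_m\vec1=\vec0$, $\vec 1=(1,\dots,1)^T$; (iv) there is $C_D>0$ such that for all $g\in C^{p+1}(\Omega)$, all $m$ and $i$: $|(D_m\vec g)_i-(\partial_mg)(x_i)|\le C_Dh^p\|g\|_{C^{p+1}(\Omega)}$, where $\|g\|_{C^{p+1}(\Omega)}$ is the largest sup norm of all partial derivatives of order at most $p+1$. *Entropy-conservative fluxes:* $f^{\mathrm{num}}_m\in C^{p+1}(\mathcal A\times\mathcal A;\mathbb R^n)$ with $f^{\mathrm{num}}_m(a,b)=f^{\mathrm{num}}_m(b,a)$, $f^{\mathrm{num}}_m(a,a)=f_m(a)$ and $(w(b)-w(a))^Tf^{\mathrm{num}}_m(a,b)=\psi_m(b)-\psi_m(a)$ for all $a,b\in\mathcal A$. **Errors.** $u_i(t)=u(t,x_i)$, $w_i=w(u_i)$, $e_i=u^h_i-u_i$, and the discrete relative entropy is $$E_h=\sum_{i=1}^Nm_i\bigl(U(u^h_i)-U(u_i)-w_i^T(u^h_i-u_i)\bigr).$$ For states $u^h_i\in K$ the flux Taylor remainders $r^m_{ij}$ are defined by $$f^{\mathrm{num}}_m(u^h_i,u^h_j)=f^{\mathrm{num}}_m(u_i,u_j)+\partial_af^{\mathrm{num}}_m(u_i,u_j)e_i+\partial_bf^{\mathrm{num}}_m(u_i,u_j)e_j+r^m_{ij},$$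 with $\partial_a,\partial_b$ the derivatives with respect to the first and second argument. *Structural remainder bound:* there is $C_R\ge0$, independent of $h$ and $N$, such that for all $t\in[0,T]$, whenever $u^h_i\in K$ for all $i$, $$\Bigl|\sum_{m=1}^d\sum_{i,j=1}^N(w_i-w_j)^T(Q_m)_{ij}\,r^m_{ij}\Bigr|\le C_RE_h.$$ *)

(* Defs.v *)
From HB Require Import structures.
From mathcomp Require Import all_boot all_order all_algebra.
From mathcomp Require Import all_classical all_reals all_analysis.

Set Implicit Arguments.
Unset Strict Implicit.
Unset Printing Implicit Defensive.

Import Order.TTheory GRing.Theory Num.Theory.
Import numFieldNormedType.Exports.

Local Open Scope classical_set_scope.
Local Open Scope ring_scope.

(* The norm of ['rV[R]_n] is the sup norm; it only serves for the topology and
   for boundedness. Euclidean norms are written with [dot]. *)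
Definition dot (R : realType) (n : nat) (a b : 'rV[R]_n) : R := (a *m b^T) 0 0.

(* [f] is of class C^k on [D]: on the interior of [D] it is k times
   continuously differentiable, and all derivatives of order at most k extend
   continuously to [D]. It is only used for sets contained in the closure of
   their interior, where these extensions are unique. For an open set this is
   the usual notion. *)
Fixpoint Ck (R : realType) (V W : normedModType R) (k : nat) (D : set V)
    (f : V -> W) : Prop :=
  {within D, continuous f} /\
  if k is k'.+1 then
    (forall x, D° x -> differentiable f x) /\
    (forall v, exists2 g : V -> W,
       Ck k' D g & forall x, D° x -> 'D_v f x = g x)
  else True.

(* One-sided at the end points when [D] is a segment. *)
Definition has_deriv_in (R : realType) (W : normedModType R) (D : set R)
    (c : R -> W) (t : R) (l : W) : Prop :=
  (fun y : R => (y - t)^-1 *: (c y - c t)) @ within D t^' --> l.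

Definition e_ (R : realType) (n : nat) (k : 'I_n) : 'rV[R]_n := delta_mx 0 k.

Definition grad (R : realType) (n : nat) (U : 'rV[R]_n -> R) (a : 'rV[R]_n) :
  'rV[R]_n := \row_k 'D_(e_ R k) U a.

Definition hess (R : realType) (n : nat) (U : 'rV[R]_n -> R) (a : 'rV[R]_n) :
  'M[R]_n := \matrix_(k, l) 'D_(e_ R k) (fun b => 'D_(e_ R l) U b) a.

Definition strictly_convex_on (R : realType) (n : nat) (A : set 'rV[R]_n)
    (U : 'rV[R]_n -> R) : Prop :=
  forall (a b : 'rV[R]_n) (l : R), A a -> A b -> a != b -> 0 < l < 1 ->
    U (l *: a + (1 - l) *: b) < l * U a + (1 - l) * U b.

(* Functions on the torus (R/LZ)^d are functions on R^d that are L-periodic in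
   each coordinate; points of the torus are given by representatives in R^d. *)
Definition torus_periodic (R : realType) (d : nat) (L : R) (W : zmodType)
    (g : 'rV[R]_d -> W) : Prop := forall m : 'I_d, periodic g (L *: e_ R m).

Definition slab (R : realType) (d : nat) (T : R) : set (R * 'rV[R]_d) :=
  `[0, T] `*` setT.

Definition iter_partial (R : realType) (d : nat) (s : seq 'I_d)
    (g : 'rV[R]_d -> R) : 'rV[R]_d -> R :=
  foldr (fun m g' x => 'D_(e_ R m) g' x) g s.

Definition Ck_norm (R : realType) (d k : nat) (g : 'rV[R]_d -> R) : R :=
  sup [set r | exists2 s : seq 'I_d,
         (size s <= k)%N & exists x, r = `|iter_partial s g x| ].

Section Continuous.
Context (R : realType) (d n : nat).
Implicit Types (A K : set 'rV[R]_n) (U : 'rV[R]_n -> R).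
Implicit Types (f : 'I_d -> 'rV[R]_n -> 'rV[R]_n) (F : 'I_d -> 'rV[R]_n -> R).
Implicit Types (u s : R -> 'rV[R]_d -> 'rV[R]_n).

(* [('J (f m) a) k l] is the derivative in direction k of the l-th component,
   i.e. the library Jacobian is the transpose of f_m'(a). *)
Definition entropy_pair A f U F : Prop :=
  [/\ strictly_convex_on A U, Ck 2 A U,
      forall m, Ck 1 A (F m)
    & forall m a, A a -> grad (F m) a = grad U a *m ('J (f m) a)^T].

Definition potential f U F (m : 'I_d) (a : 'rV[R]_n) : R :=
  dot (grad U a) (f m a) - F m a.

Definition balance_law_solution (T : R) f s u : Prop :=
  forall (t : R) x, t \in `[0, T] ->
    exists2 ut : 'rV[R]_n,
      has_deriv_in `[0, T] (fun t' => u t' x) t ut &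
      ut + \sum_(m < d) 'D_(e_ R m) (fun y => f m (u t y)) x = s t x.

Definition smooth_solution (L T : R) (p : nat) A f s u : Prop :=
  [/\ forall t : R, t \in `[0, T] -> torus_periodic L (u t),
      forall (t : R) x, t \in `[0, T] -> A (u t x),
      Ck p.+1 (@slab R d T) (fun tx => u tx.1 tx.2)
    & balance_law_solution T f s u].

Definition admissible_states (T : R) A U s u K : Prop :=
  [/\ compact K, convex_set K, K `<=` A,
      set_nbhs [set u tx.1 tx.2 | tx in @slab R d T] K
    & (exists cU CU : R,
        [/\ 0 < cU, cU <= CU & forall a, K a -> forall v : 'rV[R]_n,
           cU * dot v v <= dot (v *m hess U a) v <= CU * dot v v]) /\
      ((exists tx : R * 'rV[R]_d, @slab R d T tx /\ s tx.1 tx.2 != 0) ->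
        Ck 3 K U)].

Definition bounded_continuous_source (L T : R) s : Prop :=
  [/\ forall t : R, t \in `[0, T] -> torus_periodic L (s t),
      {within @slab R d T, continuous (fun tx => s tx.1 tx.2)}
    & [bounded s tx.1 tx.2 | tx in @slab R d T]].

Definition entropy_conservative (p : nat) A f U F
    (fnum : 'I_d -> 'rV[R]_n -> 'rV[R]_n -> 'rV[R]_n) : Prop :=
  forall m,
  [/\ Ck p.+1 (A `*` A) (fun ab => fnum m ab.1 ab.2),
      forall a b, A a -> A b -> fnum m a b = fnum m b a,
      forall a, A a -> fnum m a a = f m a
    & forall a b, A a -> A b ->
        dot (grad U b - grad U a) (fnum m a b) =
        potential f U F m b - potential f U F m a].

End Continuous.

Record discretization (R : realType) (d : nat) := Discretization {
  nnodes : nat;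
  node : 'I_nnodes -> 'rV[R]_d;
  mass : 'rV[R]_nnodes;
  sbpQ : 'I_d -> 'M[R]_nnodes
}.

Section Discrete.
Context (R : realType) (d : nat).
Implicit Types (D : discretization R d).

Definition massM D : 'M[R]_(nnodes D) := diag_mx (mass D).

Definition sbpD D (m : 'I_d) : 'M[R]_(nnodes D) := invmx (massM D) *m sbpQ D m.

Definition grid D (g : 'rV[R]_d -> R) : 'cV[R]_(nnodes D) := \col_i g (node i).

(* The family has one member [Dh h] for each mesh size [h] in [H]. *)
Definition sbp_family (L : R) (p : nat) (H : set R)
    (Dh : R -> discretization R d) : Prop :=
  exists cM CM cN CN CD : R,
  [/\ 0 < cM <= CM, 0 < cN <= CN, 0 < CD & forall h, H h ->
  [/\ forall i, cM * h ^+ d <= mass (Dh h) 0 i <= CM * h ^+ d,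
      cN <= (nnodes (Dh h))%:R * h ^+ d <= CN,
      forall m, sbpQ (Dh h) m + (sbpQ (Dh h) m)^T = 0,
      forall m, sbpQ (Dh h) m *m (const_mx 1 : 'cV[R]_(nnodes (Dh h))) = 0
    & forall g : 'rV[R]_d -> R, torus_periodic L g -> Ck p.+1 setT g ->
        forall m i,
        `|(sbpD (Dh h) m *m grid (Dh h) g) i 0 - 'D_(e_ R m) g (node i)|
          <= CD * h ^+ p * Ck_norm p.+1 g]].

Context (n : nat).
Implicit Types (U : 'rV[R]_n -> R) (ut : 'rV[R]_d -> 'rV[R]_n).
Implicit Types (fnum : 'I_d -> 'rV[R]_n -> 'rV[R]_n -> 'rV[R]_n).

Definition normM D (a : 'I_(nnodes D) -> 'rV[R]_n) : R :=
  Num.sqrt (\sum_i mass D 0 i * dot (a i) (a i)).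

Definition rel_entropy D U ut (v : 'I_(nnodes D) -> 'rV[R]_n) : R :=
  \sum_i mass D 0 i *
    (U (v i) - U (ut (node i)) -
     dot (grad U (ut (node i))) (v i - ut (node i))).

Definition taylor_remainder fnum (m : 'I_d) (ai aj vi vj : 'rV[R]_n) :
  'rV[R]_n :=
  fnum m vi vj - fnum m ai aj
  - 'd (fun a => fnum m a aj) ai (vi - ai)
  - 'd (fun b => fnum m ai b) aj (vj - aj).

Definition structural_remainder_bound (T : R) U fnum (K : set 'rV[R]_n)
    (u : R -> 'rV[R]_d -> 'rV[R]_n) (H : set R)
    (Dh : R -> discretization R d) : Prop :=
  exists2 CR : R, 0 <= CR &
  forall h, H h -> forall t : R, t \in `[0, T] ->
  forall v : 'I_(nnodes (Dh h)) -> 'rV[R]_n, (forall i, K (v i)) ->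
    let a i := u t (@node _ _ (Dh h) i) in
    `|\sum_(m < d) \sum_i \sum_j
        dot (grad U (a i) - grad U (a j))
            (sbpQ (Dh h) m i j *:
             taylor_remainder fnum m (a i) (a j) (v i) (v j))|
      <= CR * rel_entropy U (u t) v.

(* The states take values in [A], the domain of the fluxes. *)
Definition semidiscrete_solution (T : R) (A : set 'rV[R]_n) fnum
    (s : R -> 'rV[R]_d -> 'rV[R]_n) D (v0 : 'I_(nnodes D) -> 'rV[R]_n)
    (v : R -> 'I_(nnodes D) -> 'rV[R]_n) : Prop :=
  [/\ forall i, v 0 i = v0 i,
      forall (t : R) i, t \in `[0, T] -> A (v t i)
    & forall (t : R) i, t \in `[0, T] ->
        exists2 dv : 'rV[R]_n,
          has_deriv_in `[0, T] (fun t' => v t' i) t dv &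
          mass D 0 i *: dv
          + \sum_(m < d) 2 *: \sum_j sbpQ D m i j *: fnum m (v t i) (v t j)
          = mass D 0 i *: s t (node i)].

End Discrete.

(* Main.v *)
(* The relative entropy method. Along the semidiscretization the discrete entropy
   is conserved up to the source, by skew-symmetry of Q and the entropy
   conservation of the fluxes. Expanding the fluxes around u in the remaining
   terms, the part linear in the error e is, by the conservation condition
   differentiated in one argument, the truncation error tested against
   U''(u) e; the quadratic part is the structural remainder. Hence
   E' <= C (E + h^(2p)) as long as the states stay in K, and Gronwall gives
   E <= C h^(2p). Because the masses are of order h^d and 2p > d, this bound
   forces the errors to be uniformly small for small h, so that the states never
   reach the boundary of a fixed tube around u contained in K. Existence and
   uniqueness follow from the same equation with the states projected to the
   tube, whose right-hand side is globally Lipschitz. *)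

Require Import Defs.
From HB Require Import structures.
From mathcomp Require Import all_boot all_order all_algebra.
From mathcomp Require Import all_classical all_reals all_analysis.
From mathcomp Require Import ring lra.

Set Implicit Arguments.
Unset Strict Implicit.
Unset Printing Implicit Defensive.

Import Order.TTheory GRing.Theory Num.Theory.
Import numFieldNormedType.Exports.

Local Open Scope classical_set_scope.
Local Open Scope ring_scope.

(** * Inner products and directional derivatives *)

(** The obstacle is uniformity. SBP accuracy concerns one scalar function at a time, with an error
    proportional to its [C^(p+1)] norm. At the node [x_i] and time [t] it is applied to
    [y -> fnum m (u t x_i) (u t y)] with the first argument frozen: by symmetry and consistency,
    twice its derivative at [x_i] is the derivative of [f m (u t y)]. These functions change with
    the node, the time and [h], so their norms are bounded at once over all times and all frozen
    states in [K], by compactness of [[0, T]] times a period cell and of [K].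

    The source enters both the scheme and the balance law. Symmetry of [U''] moves the Hessian from
    [u_t] to the error [e], and the source terms then merge into [s] tested against
    [w(u^h) - w(u) - U''(u) e]. This is quadratic in [e] once [U] has bounded third derivatives,
    hence harmless in Gronwall's inequality.

    Derivatives on the space-time slab are given only at interior times, with continuous extensions.
    Rates are therefore computed for [0 < t < T] and the end points are reached by continuity. *)

Section DotProduct.
Context (R : realType) (n : nat).
Implicit Types a b c : 'rV[R]_n.

Lemma dotE a b : dot a b = \sum_k a 0 k * b 0 k.
Proof. by rewrite /dot mxE; apply: eq_bigr => k _; rewrite mxE. Qed.

Lemma dotC a b : dot a b = dot b a.
Proof. by rewrite !dotE; apply: eq_bigr => k _; rewrite mulrC. Qed.

Lemma dotDl a b c : dot (a + b) c = dot a c + dot b c.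
Proof. by rewrite /dot mulmxDl mxE. Qed.

Lemma dotDr a b c : dot a (b + c) = dot a b + dot a c.
Proof. by rewrite dotC dotDl !(dotC _ a). Qed.

Lemma dotNl a b : dot (- a) b = - dot a b.
Proof. by rewrite /dot mulNmx mxE. Qed.

Lemma dotNr a b : dot a (- b) = - dot a b.
Proof. by rewrite dotC dotNl dotC. Qed.

Lemma dotBl a b c : dot (a - b) c = dot a c - dot b c.
Proof. by rewrite dotDl dotNl. Qed.

Lemma dotBr a b c : dot a (b - c) = dot a b - dot a c.
Proof. by rewrite dotDr dotNr. Qed.

Lemma dotZl k a b : dot (k *: a) b = k * dot a b.
Proof. by rewrite /dot -scalemxAl mxE. Qed.

Lemma dotZr k a b : dot a (k *: b) = k * dot a b.
Proof. by rewrite dotC dotZl dotC. Qed.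

Lemma dot0l a : dot 0 a = 0.
Proof. by rewrite /dot mul0mx mxE. Qed.

Lemma dot0r a : dot a 0 = 0.
Proof. by rewrite dotC dot0l. Qed.

Lemma dot_sumr (I : Type) (r : seq I) (P : pred I) a (F : I -> 'rV[R]_n) :
  dot a (\sum_(i <- r | P i) F i) = \sum_(i <- r | P i) dot a (F i).
Proof. by apply: (big_morph (dot a)); [exact: dotDr | exact: dot0r]. Qed.

Lemma dot_ge0 a : 0 <= dot a a.
Proof. by rewrite dotE sumr_ge0// => k _; rewrite -expr2 sqr_ge0. Qed.

Lemma sqr_coord_le_dot a k : (a 0 k) ^+ 2 <= dot a a.
Proof.
rewrite dotE (bigD1 k)//= expr2 lerDl sumr_ge0// => l _.
by rewrite -expr2 sqr_ge0.
Qed.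

Lemma norm_coord_le (m : nat) (a : 'M[R]_(m, n)) i k : `|a i k| <= `|a|.
Proof.
by rewrite [leRHS]/Num.Def.normr/= mx_normrE; exact: (le_bigmax _ _ (i, k)).
Qed.

Lemma mx_norm_le (m : nat) (a : 'M[R]_(m, n)) (e : R) :
  0 <= e -> (forall i k, `|a i k| <= e) -> `|a| <= e.
Proof.
by move=> e0 ae; rewrite [leLHS]/Num.Def.normr/= mx_normrE bigmax_le.
Qed.

Lemma rV_norm_le a (e : R) : 0 <= e -> (forall k, `|a 0 k| <= e) -> `|a| <= e.
Proof. by move=> e0 ae; apply: mx_norm_le => // i k; rewrite ord1. Qed.

Lemma rV_sum_basis a : a = \sum_k a 0 k *: e_ R k.
Proof. exact: row_sum_delta. Qed.

End DotProduct.

Section DirectionalDerivatives.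
Context (R : realType).

Lemma is_derive_comp_curve (V W : normedModType R) (g : V -> W) (c : R -> V)
    (t : R) (dc : V) :
  differentiable g (c t) -> is_derive t (1 : R) c dc ->
  is_derive t (1 : R) (fun x => g (c x)) ('D_dc g (c t)).
Proof.
move=> dg [dct cE].
have dc' : differentiable c t by apply/derivable1_diffP.
have dgc : differentiable (g \o c) t by exact: differentiable_comp.
split; first exact: diff_derivable.
rewrite -[LHS]/('D_1 (g \o c) t) deriveE// diff_comp//= -deriveE//.
by rewrite -deriveE// cE.
Qed.

Lemma derive_comp (V W X : normedModType R) (f : V -> W) (g : W -> X) a v :
  differentiable f a -> differentiable g (f a) ->
  'D_v (fun x => g (f x)) a = 'D_('D_v f a) g (f a).
Proof.
move=> df dg; have dgf : differentiable (g \o f) a by exact: differentiable_comp.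
by rewrite -[LHS]/('D_v (g \o f) a) !deriveE// diff_comp.
Qed.

Lemma derive_linearD (V W : normedModType R) (f : V -> W) a u v :
  differentiable f a -> 'D_(u + v) f a = 'D_u f a + 'D_v f a.
Proof. by move=> df; rewrite !deriveE// linearD. Qed.

Lemma derive_linearZ (V W : normedModType R) (f : V -> W) a (k : R) v :
  differentiable f a -> 'D_(k *: v) f a = k *: 'D_v f a.
Proof. by move=> df; rewrite !deriveE// linearZ. Qed.

Lemma derive_rV_sum (n : nat) (W : normedModType R) (f : 'rV[R]_n -> W) a v :
  differentiable f a -> 'D_v f a = \sum_k v 0 k *: 'D_(e_ R k) f a.
Proof.
move=> df; rewrite deriveE// {1}(rV_sum_basis v) linear_sum/=.
by apply: eq_bigr => k _; rewrite linearZ/= deriveE.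
Qed.

Lemma fstD (V W : zmodType) (x y : V * W) : (x + y).1 = x.1 + y.1.
Proof. by []. Qed.

Lemma sndD (V W : zmodType) (x y : V * W) : (x + y).2 = x.2 + y.2.
Proof. by []. Qed.

Lemma fst_sum (V W : zmodType) (I : Type) (r : seq I) (F : I -> V * W) :
  (\sum_(i <- r) F i).1 = \sum_(i <- r) (F i).1.
Proof. exact: (big_morph fst (@fstD V W)). Qed.

Lemma snd_sum (V W : zmodType) (I : Type) (r : seq I) (F : I -> V * W) :
  (\sum_(i <- r) F i).2 = \sum_(i <- r) (F i).2.
Proof. exact: (big_morph snd (@sndD V W)). Qed.

Lemma derive_prod_sum (n m : nat) (W : normedModType R)
    (f : 'rV[R]_n * 'rV[R]_m -> W) a v :
  differentiable f a -> 'D_v f a =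
    \sum_k v.1 0 k *: 'D_(e_ R k, 0) f a + \sum_k v.2 0 k *: 'D_(0, e_ R k) f a.
Proof.
move=> df.
have vE : v = \sum_k v.1 0 k *: (e_ R k, 0) + \sum_k v.2 0 k *: (0, e_ R k).
  apply/eqP; rewrite -pair_eqE /=; apply/andP; split; apply/eqP.
    rewrite [X in _ = X](_ : _ = \sum_k v.1 0 k *: e_ R k); first exact: rV_sum_basis.
    rewrite !fst_sum [X in _ + X]big1 ?addr0// => k _.
    by rewrite /= scaler0.
  rewrite [X in _ = X](_ : _ = \sum_k v.2 0 k *: e_ R k); first exact: rV_sum_basis.
  rewrite /= !snd_sum big1 ?add0r// => k _.
  by rewrite /= scaler0.
rewrite deriveE// {1}vE linearD !linear_sum/=.
by congr (_ + _); apply: eq_bigr => k _; rewrite linearZ/= deriveE.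
Qed.

Lemma is_derive_line (V : normedModType R) (a v : V) (t : R) :
  is_derive t (1 : R) (fun x : R => a + x *: v) v.
Proof.
have dl : is_diff t ( *:%R^~ v : R -> V) ( *:%R^~ v) by exact: is_diff_scalel.
have dd : differentiable ( *:%R^~ v : R -> V) t by exact: ex_diff.
have D : is_derive t (1 : R) ( *:%R^~ v : R -> V) v.
  split; first exact: diff_derivable.
  by rewrite deriveE// diff_val scale1r.
rewrite -[X in is_derive _ _ _ X]add0r.
exact: is_deriveD.
Qed.

Lemma is_derive_coordP (n : nat) (c : R -> 'rV[R]_n) (t : R) (l : 'rV[R]_n) :
  is_derive t (1 : R) c l <->
  forall k, is_derive t (1 : R) (fun x => c x 0 k) (l 0 k).
Proof.
split=> [[dc cl] k|H].
  split; first by have /derivable_mxP := dc; exact.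
  by rewrite -cl derive_mx// mxE.
have dc : derivable c t 1.
  by apply/derivable_mxP => i k; rewrite (ord1 i); have [] := H k.
split=> //; rewrite derive_mx//; apply/rowP => k; rewrite mxE.
by have [_ ->] := H k.
Qed.

Lemma derive_coord (V : normedModType R) (n : nat) (f : V -> 'rV[R]_n) a v k :
  derivable f a v -> 'D_v (fun x => f x 0 k) a = ('D_v f a) 0 k.
Proof. by move=> df; rewrite derive_mx// mxE. Qed.

Lemma differentiable_comp_coord (V : normedModType R) (n : nat)
    (f : V -> 'rV[R]_n) a k :
  differentiable f a -> differentiable (fun x => f x 0 k : R) a.
Proof.
move=> df; apply: (@differentiable_comp R V _ _ f (fun N : 'rV[R]_n => N 0 k)) => //.
exact: differentiable_coord.
Qed.

End DirectionalDerivatives.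

(** * Functions of class C^k *)

Lemma convex_set_segment (R : realType) (n : nat) (A : set 'rV[R]_n) a b
    (t : R) :
  convex_set A -> A a -> A b -> 0 <= t <= 1 -> A (a + t *: (b - a)).
Proof.
move=> cA Aa Ab /andP[t0 t1].
have := cA b a (@Itv01 R t t0 t1) (mem_set Ab) (mem_set Aa).
move=> /set_mem; congr A.
rewrite /conv/= /isConvexSpace.conv/= /conv/=.
by rewrite scalerBr scalerBl scale1r addrCA.
Qed.

(** The sum of the absolute values of the individual constants dominates each of them, so
    monotonicity of [P] in the constant suffices. This merges the bounds for finitely many
    directions or components into one. *)
Lemma fin_bound (R : realType) (I : finType) (P : I -> R -> Prop) :
  (forall i c c', c <= c' -> P i c -> P i c') -> (forall i, exists c, P i c) ->
  exists2 c, 0 <= c & forall i, P i c.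
Proof.
move=> Pmono Pex; have [f fP] := boolp.choice Pex.
exists (\sum_i `|f i|); first exact: sumr_ge0.
move=> i; apply: (Pmono i (f i)) => //.
by rewrite (bigD1 i)//= (le_trans (ler_norm _))// lerDl sumr_ge0.
Qed.

Lemma compact_norm_bound (R : realType) (T : topologicalType)
    (V : normedModType R) (K : set T) (g : T -> V) :
  compact K -> {within K, continuous g} ->
  exists2 c, 0 <= c & forall x, K x -> `|g x| <= c.
Proof.
move=> cK cg; have /compact_bounded := continuous_compact cg cK.
move=> [M [_ HM]]; exists (`|M| + 1); first by rewrite addr_ge0.
by move=> x Kx; apply: (HM (`|M| + 1)); [rewrite ltr_pwDr// ler_norm | exists x].
Qed.

Section ClassCk.
Context (R : realType).
Implicit Types (V W : normedModType R) (k : nat).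

Lemma Ck_continuous_within V W k (D : set V) (f : V -> W) :
  Ck k D f -> {within D, continuous f}.
Proof. by case: k => [|k] []. Qed.

Lemma Ck_le V W k l (D : set V) (f : V -> W) :
  (k <= l)%N -> Ck l D f -> Ck k D f.
Proof.
elim: k l f => [|k IH] [|l]// f kl; first by move=> [].
move=> [cf [df Df]]; split=> //; split=> // v.
by have [g gk gE] := Df v; exists g => //; exact: IH gk.
Qed.

(** Differentiability in [Ck] refers to the interior of [D] only; an open subset of [D] lies in that
    interior, where the extended derivatives are the true ones. *)
Lemma Ck_sub_open V W k (D O : set V) (f : V -> W) :
  open O -> O `<=` D -> Ck k D f -> Ck k O f.
Proof.
move=> oO OD; have ODi : O `<=` D° by move=> x Ox; apply: filterS OD _; exact: open_nbhs_nbhs.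
elim: k f => [|k IH] f [cf Hf].
  by split=> //; exact: continuous_subspaceW cf.
split; first exact: continuous_subspaceW cf.
move: Hf => [df Df]; rewrite (interior_id O).1//; split=> [x /ODi|v]; first exact: df.
by have [g gk gE] := Df v; exists g; [exact: IH | move=> x /ODi; exact: gE].
Qed.

(** Near [x] the first-order remainders of [f] and [g] coincide, so the differential of [f] serves
    [g] as well. *)
Lemma near_eq_differentiable V W (f g : V -> W) (x : V) :
  (\near x, f x = g x) -> differentiable f x -> differentiable g x.
Proof.
move=> fg /diff_locallyP[cdf fE].
have gE : g \o shift x = cst (g x) + 'd f x +o_ (0 : V) id.
  move/eqaddoP : fE => fE; apply/eqaddoP => e e0.
  have fgx : \forall y \near (0 : V), f (y + x) = g (y + x).
    by move: fg; rewrite (near_shift 0 x)/=; apply: filterS => y; rewrite /= subr0.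
  near=> y.
  have fy : f (y + x) = g (y + x) by near: y.
  have -> : (g \o shift x - (cst (g x) + 'd f x)) y =
            (f \o shift x - (cst (f x) + 'd f x)) y.
    rewrite -[LHS]/(g (y + x) - (g x + 'd f x y)).
    by rewrite -[RHS]/(f (y + x) - (f x + 'd f x y)) fy (nbhs_singleton fg).
  by near: y; exact: fE.
apply/diff_locallyP; rewrite (diff_unique cdf gE); split=> //.
Unshelve. all: by end_near. Qed.

Lemma Ck_eq V W k (O : set V) (f g : V -> W) :
  open O -> (forall x, O x -> f x = g x) -> Ck k O f -> Ck k O g.
Proof.
move=> oO; elim: k f g => [|k IH] f g fg.
  by move=> [cf _]; split=> //; apply: subspace_eq_continuous cf => x /set_mem; exact: fg.
move=> [cf [df Df]]; split.
  by apply: subspace_eq_continuous cf => x /set_mem; exact: fg.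
have nfg x : O x -> \forall y \near x, f y = g y.
  by move=> Ox; near do apply: fg; exact: open_nbhs_nbhs.
rewrite (interior_id O).1// in df Df *; split=> [x Ox|v].
  exact: near_eq_differentiable (nfg x Ox) (df x Ox).
have [g' g'k g'E] := Df v; exists g' => // x Ox.
by rewrite -g'E//; apply/esym; apply: near_eq_derive; exact: nfg.
Unshelve. all: by end_near. Qed.

(** On an open set the extension provided by [Ck] is the derivative itself, so that derivatives can
    be iterated without carrying extensions along. *)
Lemma Ck_derive V W k (O : set V) (f : V -> W) v :
  open O -> Ck k.+1 O f -> Ck k O ('D_v f).
Proof.
move=> oO [_ [_ /(_ v)[g gk gE]]]; apply: Ck_eq gk => // x Ox.
by rewrite gE// (interior_id O).1.
Qed.

Lemma Ck_differentiable V W k (O : set V) (f : V -> W) x :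
  open O -> Ck k.+1 O f -> O x -> differentiable f x.
Proof. by move=> oO [_ [df _]] Ox; apply: df; rewrite (interior_id O).1. Qed.

Lemma Ck_interior_derive V W k (D : set V) (f : V -> W) v :
  Ck k.+1 D f -> Ck k D° ('D_v f).
Proof.
move=> fk; apply: Ck_derive; first exact: open_interior.
by apply: Ck_sub_open fk; [exact: open_interior | exact: interior_subset].
Qed.

Lemma Ck_continuous V W k (O : set V) (f : V -> W) x :
  open O -> Ck k O f -> O x -> {for x, continuous f}.
Proof.
move=> oO /Ck_continuous_within; rewrite continuous_open_subspace// => cf Ox.
by apply: cf; rewrite inE.
Qed.

Lemma Ck_coord V (n k : nat) (D : set V) (f : V -> 'rV[R]_n) l :
  Ck k D f -> Ck k D (fun x => f x 0 l : R).
Proof.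
elim: k f => [|k IH] f [cf Hf].
  split=> //; apply: (@within_continuous_comp _ _ _ _ f (fun x => x 0 l)) cf.
  by move=> x _; exact: coord_continuous.
split.
  apply: (@within_continuous_comp _ _ _ _ f (fun x => x 0 l)) cf.
  by move=> x _; exact: coord_continuous.
move: Hf => [df Df]; split=> [x Dx|v].
  by apply: differentiable_comp_coord; exact: df.
have [g gk gE] := Df v; exists (fun x => g x 0 l); first exact: IH.
move=> x Dx; rewrite derive_coord ?gE//.
by apply: diff_derivable; exact: df.
Qed.

Lemma mean_value_segment V (g : V -> R) (a v : V) :
  (forall t : R, 0 <= t <= 1 -> differentiable g (a + t *: v)) ->
  exists2 t : R, 0 < t < 1 & g (a + v) - g a = 'D_v g (a + t *: v).
Proof.
move=> dg; pose c (t : R) := a + t *: v.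
have Dc (t : R) : 0 <= t <= 1 ->
    is_derive t (1 : R) (fun t => g (c t)) ('D_v g (c t)).
  by move=> t01; apply: is_derive_comp_curve; [exact: dg | exact: is_derive_line].
have [||t t01 tE] := @MVT R (fun t => g (c t)) (fun t => 'D_v g (c t)) 0 1 ltr01.
- by move=> t /[!in_itv]/= /andP[t0 t1]; apply: Dc; rewrite !ltW.
- by apply: derivable_within_continuous => t /[!in_itv]/= /Dc[].
exists t; first by rewrite in_itv in t01.
by move: tE; rewrite /c scale1r scale0r addr0 subr0 mulr1.
Qed.

End ClassCk.

Lemma ler_sum_const (R : realType) (n : nat) (g : 'I_n -> R) (c : R) :
  (forall i, g i <= c) -> \sum_i g i <= n%:R * c.
Proof.
move=> gc; have -> : n%:R * c = \sum_(i < n) c by rewrite sumr_const card_ord mulr_natl.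
exact: ler_sum.
Qed.

Lemma open_setX (S T : topologicalType) (A : set S) (B : set T) :
  open A -> open B -> open (A `*` B).
Proof.
move=> oA oB; rewrite openE => -[x y] [/= Ax By]; exists (A, B); last by [].
by split; exact: open_nbhs_nbhs.
Qed.

Section LipschitzOnCompact.
Context (R : realType).

(** Mean value theorem on a segment, which convexity keeps in the product of [K] with itself, where
    the partial derivatives are bounded by compactness. The coordinatewise form is the one in which
    the fluxes meet the Lipschitz condition of [picard_existence]. *)
Lemma C1_lipschitz_prod (n : nat) (A K : set 'rV[R]_n)
    (f : 'rV[R]_n * 'rV[R]_n -> R) :
  open A -> Ck 1 (A `*` A) f -> compact K -> convex_set K -> K `<=` A ->
  exists2 C : R, 0 <= C & forall a b a' b' (e : R), K a -> K b -> K a' -> K b' ->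
    (forall k, `|a 0 k - a' 0 k| <= e) -> (forall k, `|b 0 k - b' 0 k| <= e) ->
    `|f (a, b) - f (a', b')| <= C * e.
Proof.
move=> oA f1 cK vK KA.
have oAA : open (A `*` A) by exact: open_setX.
have KKA : K `*` K `<=` A `*` A by move=> x [] /KA ? /KA ?; split.
have bnd v : exists c, forall x, (K `*` K) x -> `|'D_v f x| <= c.
  have [|c c0 Hc] := @compact_norm_bound R _ _ (K `*` K) ('D_v f) (compact_setX cK cK).
    apply: continuous_subspaceW KKA _.
    exact: Ck_continuous_within (Ck_derive v oAA f1).
  by exists c.
have mono v c c' : c <= c' -> (forall x, (K `*` K) x -> `|'D_v f x| <= c) ->
    (forall x, (K `*` K) x -> `|'D_v f x| <= c').
  by move=> cc' H x /H /le_trans; apply.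
have [C1 C10 HC1] := fin_bound (fun k => mono (e_ R k, 0)) (fun k => bnd (e_ R k, 0)).
have [C2 C20 HC2] := fin_bound (fun k => mono (0, e_ R k)) (fun k => bnd (0, e_ R k)).
exists (n%:R * C1 + n%:R * C2); first by rewrite addr_ge0// mulr_ge0.
move=> a b a' b' e Ka Kb Ka' Kb' Ha Hb.
pose v := (a - a', b - b') : 'rV[R]_n * 'rV[R]_n.
have seg (t : R) : 0 <= t <= 1 -> (K `*` K) ((a', b') + t *: v).
  by move=> t01; split; exact: convex_set_segment.
have [t /seg|t /andP[t0 t1]] := @mean_value_segment R _ f (a', b') v.
  by move=> /KKA; exact: Ck_differentiable oAA f1.
have /seg Kt : 0 <= t <= 1 by rewrite !ltW.
have -> : (a', b') + v = (a, b) by congr (_, _); rewrite /= addrC subrK.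
move=> ->; rewrite derive_prod_sum; last by apply: (Ck_differentiable oAA f1); exact: KKA.
rewrite mulrDl (le_trans (ler_normD _ _))// lerD// (le_trans (ler_norm_sum _ _ _))//.
  rewrite -mulrA; apply: ler_sum_const => k.
  rewrite normrM mulrC ler_pM//; first exact: HC1.
  by rewrite /= !mxE; exact: Ha.
rewrite -mulrA; apply: ler_sum_const => k.
rewrite normrM mulrC ler_pM//; first exact: HC2.
by rewrite /= !mxE; exact: Hb.
Qed.

End LipschitzOnCompact.

(** * Comparison of functions by their derivatives, and Gronwall's inequality *)

Section RealLine.
Context (R : realType).
Implicit Types (a b t : R).

Lemma antiderivative (g : R -> R) a b : continuous g ->
  exists G : R -> R, forall t, a < t < b -> is_derive t (1 : R) G (g t).
Proof.
move=> cg; have gint : lebesgue_measure.-integrable `[a, b] (EFin \o g).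
  apply: continuous_compact_integrable; first exact: segment_compact.
  exact: continuous_subspaceT.
exists (fun x => \int[lebesgue_measure]_(t in `[a, x]) g t)%R => t /andP[at_ tb].
have [] := @continuous_FTC1_closed R g a t b tb gint at_ (cg t).
by rewrite derive1E.
Qed.

(** Monotonicity of [G - F]. It replaces the integration of an inequality: at the end points only
    continuity is asked, and no integrability of the derivatives. *)
Lemma derive_le_le (F G dF dG : R -> R) a b : a <= b ->
  {within `[a, b], continuous F} -> {within `[a, b], continuous G} ->
  (forall t, a < t < b -> is_derive t (1 : R) F (dF t)) ->
  (forall t, a < t < b -> is_derive t (1 : R) G (dG t)) ->
  (forall t, a < t < b -> dF t <= dG t) ->
  F b - F a <= G b - G a.
Proof.
move=> ab cF cG DF DG FG.
have DH t : a < t < b -> is_derive t (1 : R) (G - F) (dG t - dF t).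
  by move=> tab; have ? := DF t tab; have ? := DG t tab; exact: is_deriveB.
have : (G - F) a <= (G - F) b.
  apply: (@ger0_derive1_ndecr R (G - F) a b) => //.
  - by move=> t /[!in_itv]/= /DH[].
  - move=> t /[!in_itv]/= tab; rewrite derive1E; have [_ ->] := DH t tab.
    by rewrite subr_ge0 FG.
  - exact: within_continuousB.
rewrite -![(G - F) _]/(G _ - F _); lra.
Qed.

Lemma derive_norm_le (F G dF dG : R -> R) a b : a <= b ->
  {within `[a, b], continuous F} -> {within `[a, b], continuous G} ->
  (forall t, a < t < b -> is_derive t (1 : R) F (dF t)) ->
  (forall t, a < t < b -> is_derive t (1 : R) G (dG t)) ->
  (forall t, a < t < b -> `|dF t| <= dG t) ->
  `|F b - F a| <= G b - G a.
Proof.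
move=> ab cF cG DF DG FG; rewrite ler_norml; apply/andP; split.
  rewrite lerNl opprB.
  have := @derive_le_le (- F) G (fun t => - dF t) dG a b ab.
  rewrite -![(- F) _]/(- F _) opprK [- F b + _]addrC; apply => //.
  - move=> t; apply: cvgN; exact: cF.
  - by move=> t /DF ?; exact: is_deriveN.
  - by move=> t /FG; rewrite ler_norml => /andP[]; lra.
apply: derive_le_le DF DG _ => // t /FG; exact: le_trans (ler_norm _).
Qed.

Lemma is_derive_expRM (k t : R) :
  is_derive t (1 : R) (fun t => expR (k * t)) (k * expR (k * t)).
Proof.
have D : is_derive t (1 : R) (fun t : R => k * t) k.
  have := @is_deriveZ R R R id k t 1 1 (is_derive_id _ _).
  by rewrite -[k *: 1]/(k * 1) mulr1.
have := @is_derive1_comp R expR (fun t => k * t) t _ _ (is_derive_expR _) D.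
by rewrite mulrC.
Qed.

(** Integrating factor: the derivative of [E t * expR (- c * t)] is at most [k * expR (- c * t)],
    hence at most [k], which is compared with the linear function [k * t]. *)
Lemma gronwall (E dE : R -> R) (c k T : R) : 0 <= T -> 0 <= c -> 0 <= k ->
  {within `[0, T], continuous E} ->
  (forall t, 0 < t < T -> is_derive t (1 : R) E (dE t)) ->
  (forall t, 0 < t < T -> dE t <= c * E t + k) ->
  E T <= (E 0 + k * T) * expR (c * T).
Proof.
move=> T0 c0 k0 cE DE Ek.
have Dexp t := is_derive_expRM (- c) t.
have DF t : 0 < t < T -> is_derive t (1 : R) (E * (fun t => expR (- c * t)))
   (E t * (- c * expR (- c * t)) + expR (- c * t) * dE t).
  by move=> tT; have ? := DE t tT; exact: is_deriveM.
have Dk t : is_derive t (1 : R) (fun t : R => k * t) k.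
  have := @is_deriveZ R R R id k t 1 1 (is_derive_id _ _).
  by rewrite -[k *: 1]/(k * 1) mulr1.
have := @derive_le_le (E * (fun t => expR (- c * t))) (fun t => k * t)
  (fun t => E t * (- c * expR (- c * t)) + expR (- c * t) * dE t) (fun=> k) 0 T T0.
rewrite -![(E * _) _]/(E _ * expR _) !mulr0 expR0 mulr1 subr0.
move=> H; have {H} : E T * expR (- c * T) - E 0 <= k * T.
  apply: H => //.
  - move=> t; apply: cvgM; first exact: cE.
    have : {within `[0, T], continuous (fun t : R => expR (- c * t))}.
      by apply: derivable_within_continuous => x _; have [] := Dexp x.
    exact.
  - by apply: derivable_within_continuous => x _; have [] := Dk x.
  - move=> t tT; have := Ek t tT => Ekt.
    have -> : E t * (- c * expR (- c * t)) + expR (- c * t) * dE t =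
              expR (- c * t) * (dE t - c * E t) by ring.
    apply: le_trans (_ : expR (- c * t) * k <= _).
      by rewrite ler_pM2l ?expR_gt0//; lra.
    rewrite ler_piMl// -expR0 ler_expR mulNr oppr_le0 mulr_ge0//.
    by move: tT => /andP[/ltW].
have -> : - c * T = - (c * T) by ring.
rewrite expRN => H; rewrite -ler_pdivrMr ?expR_gt0//; lra.
Qed.

End RealLine.

(** * Initial value problems *)

Section Clamp.
Context (R : realType).
Implicit Types (lo hi x e : R).

Definition clamp lo hi x : R := Num.max lo (Num.min x hi).

Lemma clamp_itv lo hi x : lo <= hi -> lo <= clamp lo hi x <= hi.
Proof. by move=> lh; rewrite /clamp le_max lexx/= ge_max lh ge_min lexx orbT. Qed.

Lemma clamp_id lo hi x : lo <= x <= hi -> clamp lo hi x = x.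
Proof. by move=> /andP[lx xh]; rewrite /clamp min_l// max_r. Qed.

Lemma max_lipschitz x y x' y' e : `|x - x'| <= e -> `|y - y'| <= e ->
  `|Num.max x y - Num.max x' y'| <= e.
Proof.
rewrite !ler_norml => /andP[? ?] /andP[? ?].
by case: (leP x y) => ?; case: (leP x' y') => ?; apply/andP; split; lra.
Qed.

Lemma min_lipschitz x y x' y' e : `|x - x'| <= e -> `|y - y'| <= e ->
  `|Num.min x y - Num.min x' y'| <= e.
Proof.
rewrite !ler_norml => /andP[? ?] /andP[? ?].
by case: (leP x y) => ?; case: (leP x' y') => ?; apply/andP; split; lra.
Qed.

(** The bounds vary along with the point because the tube around [u] moves in time. *)
Lemma clamp_lipschitz lo hi x lo' hi' x' e :
  `|lo - lo'| <= e -> `|hi - hi'| <= e -> `|x - x'| <= e ->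
  `|clamp lo hi x - clamp lo' hi' x'| <= e.
Proof. by move=> ? ? ?; apply: max_lipschitz => //; exact: min_lipschitz. Qed.

Lemma continuous_clamp (T : topologicalType) (lo hi x : T -> R) :
  continuous lo -> continuous hi -> continuous x ->
  continuous (fun t => clamp (lo t) (hi t) (x t)).
Proof.
move=> clo chi cx t; apply/cvgrPdist_le => e e0; near=> s.
by apply: clamp_lipschitz; near: s; apply/cvgrPdist_le : e e0;
  [exact: clo | exact: chi | exact: cx].
Unshelve. all: by end_near. Qed.

(** Freezing the time at the end points turns continuity on the segment into continuity on the whole
    line, the form in which right-hand sides are integrated. *)
Lemma within_continuous_clamp (V : topologicalType) (T : R) (c : R -> V) :
  0 <= T -> {within `[0, T], continuous c} ->
  continuous (fun t => c (clamp 0 T t)).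
Proof.
move=> T0 cc t.
have cl : continuous (fun t : R => clamp 0 T t).
  by apply: continuous_clamp => [s|s|s]; [exact: cvg_cst | exact: cvg_cst | exact: cvg_id].
have clT s : `[0, T]%classic (clamp 0 T s) by rewrite /= in_itv/= clamp_itv.
have /(subspace_continuousP _ _)/(_ _ (clT t)) cct := cc.
apply: cvg_comp cct => B HB.
have HB' : nbhs (clamp 0 T t) [set x | `[0, T]%classic x -> B x] by exact: HB.
have : nbhs t (clamp 0 T @^-1` [set x | `[0, T]%classic x -> B x]) := cl t _ HB'.
by apply: filterS => s /=; apply; exact: clT.
Qed.

End Clamp.

(** The intervals of radius [r k] around [u k] are nested, since an increment is at most half the
    radius and the radius halves at each step. The supremum of their left ends lies in all of them,
    which gives the limit together with its rate. *)
Lemma geometric_cauchy_limit (R : realType) (u : nat -> R) (C : R) :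
  (forall k, `|u k.+1 - u k| <= C / 2 ^+ k) ->
  exists l, forall k, `|l - u k| <= 2 * C / 2 ^+ k.
Proof.
move=> uC; pose r k := 2 * C / 2 ^+ k.
have rS k : r k.+1 = r k / 2.
  by rewrite /r exprS invfM; field; rewrite expf_neq0.
have Cr k : C / 2 ^+ k = r k / 2 by rewrite /r; field; rewrite expf_neq0.
have lo k : u k - r k <= u k.+1 - r k.+1.
  by have := uC k; rewrite Cr rS ler_norml => /andP[]; lra.
have hi k : u k.+1 + r k.+1 <= u k + r k.
  by have := uC k; rewrite Cr rS ler_norml => /andP[]; lra.
have r0 k : 0 <= r k.
  by have := le_trans (normr_ge0 _) (uC k); rewrite Cr; lra.
have lom k l : (k <= l)%N -> u k - r k <= u l - r l.
  by apply: (@homo_leq _ (fun k => u k - r k) <=%O) => //; exact: le_trans.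
have him k l : (k <= l)%N -> u l + r l <= u k + r k.
  move=> kl; rewrite -lerN2; move: kl.
  apply: (@homo_leq _ (fun k => - (u k + r k)) <=%O) => //; first exact: le_trans.
  by move=> m; rewrite lerN2.
have lohi k l : u k - r k <= u l + r l.
  have [kl|/ltnW lk] := leqP k l.
    by apply: le_trans (lom _ _ kl) _; have := r0 l; lra.
  by apply: le_trans (him _ _ lk); have := r0 k; lra.
pose S := [set u k - r k | k in setT].
have S0 : S !=set0 by exists (u 0%N - r 0%N), 0%N.
have Sub k : ubound S (u k + r k) by move=> _ [l _ <-].
exists (sup S) => k; rewrite ler_norml; apply/andP; split.
  rewrite lerBrDl; apply: sup_upper_bound; last by exists k.
  by split=> //; exists (u 0%N + r 0%N); exact: Sub.
by rewrite lerBlDl; apply: ge_sup => //; exact: Sub.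
Qed.

Section Picard.
Context (R : realType) (I : finType) (T C : R).
Variables (rhs : R -> (I -> R) -> I -> R) (x0 : I -> R).
Hypothesis T0 : 0 <= T.
Hypothesis C0 : 0 < C.
(** Continuity along continuous curves, and a Lipschitz condition read off coordinates, are all that
    the iteration uses; no topology on [I -> R] is involved. *)
Hypothesis rhs_continuous : forall (x : R -> I -> R) i,
  (forall j, continuous (x^~ j)) -> continuous (fun t => rhs t (x t) i).
Hypothesis rhs_lipschitz : forall t x y (e : R) i,
  (forall j, `|x j - y j| <= e) -> `|rhs t x i - rhs t y i| <= C * e.

Let cl := clamp 0 T.
Let clE t : 0 <= t <= T -> cl t = t. Proof. exact: clamp_id. Qed.
Let clT t : 0 <= cl t <= T. Proof. exact: clamp_itv. Qed.

Let cont_clamp (x : R -> I -> R) := forall j, continuous (fun t => x (cl t) j).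

Let is_step (x y : R -> I -> R) :=
  (forall i, y 0 i = x0 i) /\
  forall t i, 0 <= t <= T -> is_derive t (1 : R) (y^~ i) (rhs t (x t) i).

Let step_ex x : cont_clamp x -> exists y, is_step x y.
Proof.
move=> cx.
have /boolp.choice[G HG] i : exists G : R -> R, forall t, 0 <= t <= T ->
    is_derive t (1 : R) G (rhs t (x t) i).
  have crx := @rhs_continuous (fun t => x (cl t)) i cx.
  (* The fundamental theorem gives the derivative at interior points only, so the interval is
     enlarged to reach two-sided derivatives at [0] and [T]. *)
  have [G HG] := @antiderivative R _ (-1) (T + 1) crx.
  exists G => t t0T; rewrite -[x t](congr1 x (clE t0T)); apply: HG.
  by move: t0T => /andP[? ?]; apply/andP; split; lra.
exists (fun t i => x0 i + (G i t - G i 0)); split=> [i|t i tT].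
  by rewrite subrr addr0.
have D := HG i t tT.
rewrite -[rhs _ _ _]add0r.
apply: (@is_deriveD R R R (cst (x0 i)) (G i - cst (G i 0)) t 1 0).
by rewrite -[X in is_derive _ _ _ X]subr0; exact: is_deriveB.
Qed.

Let within_step x y i : is_step x y ->
  {within `[0, T], continuous (y^~ i)}.
Proof.
move=> [_ Dy]; apply: derivable_within_continuous => t /[!in_itv]/= tT.
by have [] := Dy t i tT.
Qed.

Let cont_step x y : is_step x y -> cont_clamp y.
Proof.
by move=> xy i; have /(within_continuous_clamp T0) := within_step (i := i) xy; exact.
Qed.

(** The pointwise limit [x] of the iterates is continuous by uniform convergence. One further step
    [y] from [x] is differentiable and coincides with [x] on [[0, T]], so it is the solution. *)
Lemma picard_existence : exists x : R -> I -> R,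
  (forall i, x 0 i = x0 i) /\
  forall t i, 0 <= t <= T -> is_derive t (1 : R) (x^~ i) (rhs t (x t) i).
Proof.
(* The value of [step] at a curve violating [cont_clamp] is arbitrary and never met, because every
   iterate satisfies it. *)
have /boolp.choice[step stepP] (x : R -> I -> R) :
    exists y, cont_clamp x -> is_step x y.
  have [cx|ncx] := pselect (cont_clamp x); last by exists x.
  by have [y ?] := step_ex cx; exists y.
pose xs k := iter k step (fun _ => x0).
have cxs k : cont_clamp (xs k).
  by elim: k => [i t|k IH]; [exact: cvg_cst | exact: cont_step (stepP _ IH)].
have xsP k : is_step (xs k) (xs k.+1) by apply: stepP; exact: cxs.
have wxs k i : {within `[0, T], continuous ((xs k)^~ i)}.
  case: k => [|k]; last exact: within_step (xsP k).
  by apply: continuous_subspaceT => t; exact: cvg_cst.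
have xs0 k i : xs k 0 i = x0 i by case: k => // k; rewrite (xsP k).1.
have [B B0 HB] : exists2 B, 0 <= B & forall i t, 0 <= t <= T ->
    `|xs 1%N t i - xs 0%N t i| <= B.
  apply: fin_bound => [i c c' cc' H t /H /le_trans|i]; first exact.
  have [c _ Hc] := compact_norm_bound (@segment_compact R 0 T)
    (within_continuousB (wxs 1%N i) (wxs 0%N i)).
  by exists c => t tT; apply: (Hc t); rewrite /= in_itv.
pose w t := expR (2 * C * t).
have w1 t : 0 <= t -> 1 <= w t.
  by move=> t0; rewrite -expR0 ler_expR !mulr_ge0// ltW.
(* The weight absorbs the Lipschitz constant, so that each Picard step gains a
   factor 1/2 on the whole interval. *)
have xsB k : forall t i, 0 <= t <= T ->
    `|xs k.+1 t i - xs k t i| <= B / 2 ^+ k * w t.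
  elim: k => [|k IH] t i /andP[t0 tT].
    rewrite expr0 divr1 (le_trans (HB i t _)) ?t0//.
    by rewrite ler_peMr ?w1.
  have sub : `[0, t]%classic `<=` `[0, T]%classic.
    by apply: subset_itvl; rewrite bnd_simp.
  have := @derive_norm_le R (fun t => xs k.+2 t i - xs k.+1 t i)
    (fun t => B / 2 ^+ k.+1 * w t)
    (fun t => rhs t (xs k.+1 t) i - rhs t (xs k t) i)
    (fun t => B / 2 ^+ k.+1 * (2 * C * w t)) 0 t t0.
  rewrite !xs0 subrr subr0 => H; apply: le_trans (H _ _ _ _ _) _.
  - exact/(continuous_subspaceW sub)/(within_continuousB (wxs _ _) (wxs _ _)).
  - apply: derivable_within_continuous => s _.
    by have [] := @is_deriveZ R R R w (B / 2 ^+ k.+1) s 1 _ (is_derive_expRM _ s).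
  - move=> s /andP[s0 st].
    have sT : 0 <= s <= T by rewrite (ltW s0) (le_trans (ltW st)).
    by have ? := (xsP k).2 s i sT; have ? := (xsP k.+1).2 s i sT; exact: is_deriveB.
  - move=> s _.
    exact: (@is_deriveZ R R R w (B / 2 ^+ k.+1) s 1 _ (is_derive_expRM _ s)).
  - move=> s /andP[s0 st].
    have sT : 0 <= s <= T by rewrite (ltW s0) (le_trans (ltW st)).
    have -> : B / 2 ^+ k.+1 * (2 * C * w s) = C * (B / 2 ^+ k * w s).
      by rewrite exprS; field; rewrite expf_neq0.
    by apply: rhs_lipschitz => j; exact: IH.
  - by rewrite gerBl mulr_ge0 ?divr_ge0 ?exprn_ge0// expR_ge0.
pose D := B * w T.
have xsD k t i : 0 <= t <= T -> `|xs k.+1 t i - xs k t i| <= D / 2 ^+ k.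
  move=> tT; apply: le_trans (xsB k t i tT) _; rewrite /D mulrAC.
  rewrite ler_pM2r ?invr_gt0 ?exprn_gt0// ler_wpM2l// ler_expR.
  by rewrite ler_pM2l ?mulr_gt0//; move: tT => /andP[].
have D0 : 0 <= D by rewrite mulr_ge0// expR_ge0.
have D20 : 0 <= 2 * D by rewrite mulr_ge0.
have /boolp.choice[x xP] (ti : R * I) : exists l : R, 0 <= ti.1 <= T ->
    forall k, `|l - xs k ti.1 ti.2| <= 2 * D / 2 ^+ k.
  have [tT|_] := boolP (0 <= ti.1 <= T); last by exists 0.
  have [|l lP] := @geometric_cauchy_limit R (fun k => xs k ti.1 ti.2) D.
    by move=> k; exact: xsD.
  by exists l.
have small (c e : R) : 0 <= c -> 0 < e -> exists k, c / 2 ^+ k <= e.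
  move=> c0 e0.
  have ce : 0 <= c / e by rewrite divr_ge0// ltW.
  exists (Num.bound (c / e)); rewrite ler_pdivrMr ?exprn_gt0// mulrC -ler_pdivrMr//.
  by rewrite (le_trans (ltW (archi_boundP ce)))// -natrX ler_nat ltnW// ltn_expl.
have cx : cont_clamp (fun t i => x (t, i)).
  move=> i t; apply/cvgrPdist_le => e e0.
  have e3 : 0 < e / 3 by rewrite divr_gt0.
  have [k Hk] := small (2 * D) (e / 3) D20 e3.
  near=> s.
  have := xP (cl t, i) (clT t) k; have := xP (cl s, i) (clT s) k => /=.
  have : `|xs k (cl t) i - xs k (cl s) i| <= e / 3.
    by near: s; apply/cvgrPdist_le : (e / 3) e3; exact: cxs.
  have Hk' z : z <= 2 * D / 2 ^+ k -> z <= e / 3 by move=> /le_trans; exact.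
  move=> + /Hk' + /Hk'; rewrite !ler_norml => /andP[? ?] /andP[? ?] /andP[? ?].
  by apply/andP; split; lra.
have [y xy] := step_ex cx.
(* The iterates tend to [x] by construction, and to [y] by integrating the Lipschitz bound of [rhs]
   between [xs k] and [x]; hence the two limits agree. *)
have yx t i : 0 <= t <= T -> y t i = x (t, i).
  move=> /andP[t0 tT].
  have sub : `[0, t]%classic `<=` `[0, T]%classic.
    by apply: subset_itvl; rewrite bnd_simp.
  have key k : `|xs k.+1 t i - y t i| <= (C * t * (2 * D)) / 2 ^+ k.
    have Dl s : is_derive s (1 : R) (fun s => (C * (2 * D / 2 ^+ k)) * s)
       (C * (2 * D / 2 ^+ k)).
      have := @is_deriveZ R R R id (C * (2 * D / 2 ^+ k)) s 1 1 (is_derive_id _ _).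
      by rewrite -[_ *: 1]/(_ * 1) mulr1.
    have := @derive_norm_le R (fun t => xs k.+1 t i - y t i)
      (fun s => (C * (2 * D / 2 ^+ k)) * s)
      (fun t => rhs t (xs k t) i - rhs t (fun j => x (t, j)) i)
      (fun s => C * (2 * D / 2 ^+ k)) 0 t t0.
    rewrite xs0 xy.1 subrr subr0 mulr0 subr0 => H; apply: le_trans (H _ _ _ _ _) _.
    - exact/(continuous_subspaceW sub)/(within_continuousB (wxs _ _) (within_step xy)).
    - by apply: derivable_within_continuous => s _; have [] := Dl s.
    - move=> s /andP[s0 st].
      have sT : 0 <= s <= T by rewrite (ltW s0) (le_trans (ltW st)).
      by have ? := (xsP k).2 s i sT; have ? := xy.2 s i sT; exact: is_deriveB.
    - move=> s /andP[s0 st].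
      have sT : 0 <= s <= T by rewrite (ltW s0) (le_trans (ltW st)).
      by apply: rhs_lipschitz => j; rewrite distrC; exact: (xP (s, j)).
    - by rewrite le_eqVlt; apply/orP; left; apply/eqP; ring.
  apply/eqP; rewrite -subr_eq0 -normr_le0; apply/ler_addgt0Pl => e e0; rewrite addr0.
  have e2 : 0 < e / 2 by rewrite divr_gt0.
  have c0 : 0 <= C * t * (2 * D) by rewrite mulr_ge0// mulr_ge0// ltW.
  have [k Hk] := small (C * t * (2 * D) + 2 * D) (e / 2) (addr_ge0 c0 D20) e2.
  have := key k; have := xP (t, i) _ k.+1; rewrite /= t0 tT => /(_ isT).
  move: Hk; rewrite mulrDl => Hk.
  have p0 : 0 <= C * t * (2 * D) / 2 ^+ k by rewrite divr_ge0// exprn_ge0.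
  have q0 : 0 <= 2 * D / 2 ^+ k by rewrite divr_ge0 ?exprn_ge0// mulr_ge0.
  have -> : 2 * D / 2 ^+ k.+1 = 2 * D / 2 ^+ k / 2.
    by rewrite exprS; field; rewrite expf_neq0.
  rewrite !ler_norml => /andP[? ?] /andP[? ?].
  by apply/andP; split; lra.
exists y; split=> [i|t i tT]; first exact: xy.1.
have -> : y t = (fun j => x (t, j)) by apply/funext => j; exact: yx.
exact: xy.2.
Unshelve. all: by end_near. Qed.

End Picard.

(** * Continuity method on a segment, and one-sided derivatives *)

Section OneSidedDerivatives.
Context (R : realType).

(** Continuity method on the set [S] of times up to which the weak bound holds. It contains its
    supremum by continuity of the [phi j]. The hypothesis improves the weak bound there to a strict
    one, which persists a little longer for all of the finitely many [j], so the supremum is [T]. *)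
Lemma barrier (J : finType) (phi : J -> R -> R) (T d : R) : 0 <= T ->
  (forall j, {within `[0, T], continuous (phi j)}) ->
  (forall j, phi j 0 <= d) ->
  (forall t, 0 <= t <= T -> (forall s j, 0 <= s <= t -> phi j s <= d) ->
    forall j, phi j t < d) ->
  forall t j, 0 <= t <= T -> phi j t < d.
Proof.
move=> T0 cphi phi0 step.
pose psi j t := phi j (clamp 0 T t).
have cpsi j : continuous (psi j) by exact: within_continuous_clamp.
have psiE j t : 0 <= t <= T -> psi j t = phi j t by move=> tT; rewrite /psi clamp_id.
pose S := [set t | 0 <= t <= T /\ forall s j, 0 <= s <= t -> phi j s <= d].
have S0 : S 0.
  split; first by rewrite lexx T0.
  by move=> s j; rewrite -eq_le => /eqP <-.
have hS : has_sup S by split; [exists 0 | exists T => t [/andP[_]]].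
have s0 : 0 <= sup S by exact: sup_upper_bound.
have sT : sup S <= T by apply: ge_sup; [exists 0 | move=> t [/andP[_]]].
have lt_s s j : 0 <= s < sup S -> phi j s <= d.
  move=> /andP[s0' slt].
  have e0 : 0 < sup S - s by rewrite subr_gt0.
  have [t St tlt] := sup_adherent e0 hS.
  by apply: St.2; rewrite s0' ltW//; move: tlt; lra.
have at_s j : phi j (sup S) <= d.
  rewrite leNgt; apply/negP => dlt.
  have dlt' : d < psi j (sup S) by rewrite psiE ?s0.
  have /nbhs_ballP[e /= e0 He] := cpsi j (sup S) _ (lt_nbhsr dlt').
  have [t St tlt] := sup_adherent e0 hS.
  have tle : t <= sup S by exact: sup_upper_bound.
  have /He : ball (sup S) e t.
    by rewrite /ball/= ger0_norm ?subr_ge0//; move: tlt; lra.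
  rewrite /= psiE; last by case: St.
  by rewrite ltNge St.2// lexx andbT; case: St => /andP[].
have Ss : S (sup S).
  split; first by rewrite s0 sT.
  move=> s j /andP[s0']; rewrite le_eqVlt => /predU1P[->//|slt].
  by apply: lt_s; rewrite s0'.
have sTE : sup S = T.
  apply/eqP; rewrite eq_le sT/= leNgt; apply/negP => sltT.
  have nr : \forall t \near sup S, forall j, psi j t < d.
    suff nrj j : \forall t \near sup S, psi j t < d by exact: filter_forall nrj.
    suff nd : nbhs (psi j (sup S)) [set y | y < d] by exact: (cpsi j (sup S) _ nd).
    by apply: lt_nbhsl; rewrite psiE ?s0//; apply: step; rewrite ?s0 ?sT//; case: Ss.
  have /nbhs_ballP[e /= e0 He] := nr.
  pose t := Num.min T (sup S + e / 2).
  have slt : sup S < t by rewrite /t lt_min sltT/=; lra.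
  suff /(sup_upper_bound hS) : S t by rewrite leNgt slt.
  split; first by rewrite (le_trans s0 (ltW slt)) /t ge_min lexx.
  move=> s j /andP[s0' st].
  have [/(conj s0')/andP/lt_s//|ss] := ltP s (sup S).
  rewrite -psiE; last by rewrite s0' (le_trans st)// /t ge_min lexx.
  apply: ltW; apply: He; rewrite /ball/= distrC ger0_norm ?subr_ge0//.
  by move: st; rewrite /t le_min => /andP[_]; lra.
move=> t j tT; apply: step => // s i /andP[s0' st].
by apply: Ss.2; rewrite s0' sTE (le_trans st)//; case/andP: tT.
Qed.

Context (W : normedModType R).
Implicit Types (D : set R) (c : R -> W) (t : R) (l : W).

Lemma is_derive_quotientP c t l : is_derive t (1 : R) c l <->
  (fun y => (y - t)^-1 *: (c y - c t)) @ t^' --> l.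
Proof.
have E : (fun h : R => h^-1 *: ((c \o shift t) (h *: (1 : R)) - c t)) =
         (fun y => (y - t)^-1 *: (c y - c t)) \o shift t.
  by apply/funext => h /=; rewrite [h *: _]mulr1 addrK.
have shiftE (P : set R) : (\forall y \near t^', P y) <->
    (\forall h \near 0^', P (h + t)).
  have -> : (\forall y \near t^', P y) = (\forall y \near t, y != t -> P y) by [].
  have -> : (\forall h \near 0^', P (h + t)) =
            (\forall h \near 0, h != 0 -> P (h + t)) by [].
  rewrite (near_shift 0 t)/=.
  have htE (h : R) : (h + (t - 0) != t) = (h != 0).
    by rewrite subr0 -subr_eq0 addrK.
  by split; apply: filterS => h /=; rewrite htE subr0.
have cvgE : ((fun y => (y - t)^-1 *: (c y - c t)) @ t^' --> l) <->
    ((fun y => (y - t)^-1 *: (c y - c t)) \o shift t @ 0^' --> l).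
  split=> /cvgrPdist_le H; apply/cvgrPdist_le => e e0.
    exact: (shiftE _).1 (H e e0).
  exact: (shiftE _).2 (H e e0).
split=> [[dc cl]|H].
  by apply/cvgE; rewrite -E -cl; exact: dc.
have /cvgE := H; rewrite -E => {}H.
by split; [apply/cvg_ex; exists l | exact/cvg_lim].
Qed.

Lemma is_derive_has_deriv_in D c t l : is_derive t (1 : R) c l ->
  has_deriv_in D c t l.
Proof. by move=> /is_derive_quotientP; exact: cvg_within_filter. Qed.

Lemma has_deriv_in_is_derive (T : R) c t l : 0 < t < T ->
  has_deriv_in `[0, T] c t l -> is_derive t (1 : R) c l.
Proof.
move=> tT H; apply/is_derive_quotientP; apply: cvg_trans H.
apply: cvg_app => P; rewrite /= => HP.
have : \forall y \near t^', `[0, T]%classic y -> P y by exact: HP.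
have : \forall y \near t^', `[0, T]%classic y.
  apply: nbhs_dnbhs; apply: filterS (near_in_itvoo _); last by rewrite in_itv/=; exact: tT.
  by move=> y /=; rewrite !in_itv/= => /andP[/ltW -> /ltW ->].
by apply: filterS2 => y Dy; exact.
Qed.

(** Near [t] the difference quotients are bounded by [|l| + 1], so [c y - c t] is at most this
    constant times [|y - t|]. *)
Lemma has_deriv_in_continuous D c :
  (forall t, D t -> exists l, has_deriv_in D c t l) -> {within D, continuous c}.
Proof.
move=> Dc; apply/subspace_continuousP => t Dt; have [l] := Dc t Dt.
move=> /cvgrPdist_le/(_ 1 ltr01) H.
apply/cvgrPdist_le => e e0.
have {}H : \forall y \near t, y != t -> D y ->
    `|l - (y - t)^-1 *: (c y - c t)| <= 1 by exact: H.
have l1 : 0 < `|l| + 1 by rewrite ltr_pwDr.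
have : \forall y \near t, `|t - y| <= e / (`|l| + 1).
  apply/nbhs_ballP; exists (e / (`|l| + 1)); first by rewrite /= divr_gt0.
  by move=> y; exact: ltW.
suff : \forall y \near t, `|t - y| <= e / (`|l| + 1) -> D y -> `|c t - c y| <= e.
  by move=> H1 H2; apply: filterS2 H1 H2 => y H1 H2; exact: H1.
apply: filterS H => y H yt Dy.
have [->|ynt] := eqVneq y t; first by rewrite subrr normr0 ltW.
have q : `|(y - t)^-1 *: (c y - c t)| <= `|l| + 1.
  rewrite -[X in `|X|](subKr l) (le_trans (ler_normB _ _))// lerD2l.
  exact: H.
have ny : 0 < `|y - t| by rewrite normr_gt0 subr_eq0.
move: q; rewrite normrZ normfV mulrC ler_pdivrMr// distrC => /le_trans; apply.
by rewrite mulrC -ler_pdivlMr// distrC.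
Qed.

End OneSidedDerivatives.

(** * Taylor bounds and symmetry of second derivatives *)

Section SecondOrder.
Context (R : realType).
Implicit Types (V W : normedModType R).

(** Two comparisons by [derive_le_le]: [g1] dominates the line [g1 0 + c * t], hence [g - g 0]
    dominates the parabola [q]. *)
Lemma taylor2_ge (g g1 g2 : R -> R) (c : R) :
  (forall t : R, 0 <= t <= 1 -> is_derive t (1 : R) g (g1 t)) ->
  (forall t : R, 0 <= t <= 1 -> is_derive t (1 : R) g1 (g2 t)) ->
  (forall t : R, 0 <= t <= 1 -> c <= g2 t) ->
  c / 2 <= g 1 - g 0 - g1 0.
Proof.
move=> D1 D2 cg2.
have lin (k s : R) : is_derive s (1 : R) (fun s : R => k * s) k.
  have := @is_deriveZ R R R id k s 1 1 (is_derive_id _ _).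
  by rewrite -[k *: 1]/(k * 1) mulr1.
have w01 (h dh : R -> R) : (forall t : R, 0 <= t <= 1 -> is_derive t (1 : R) h (dh t)) ->
    forall t : R, 0 <= t <= 1 -> {within `[0, t], continuous h}.
  move=> Dh t /andP[t0 t1]; apply: derivable_within_continuous => s.
  rewrite in_itv/= => /andP[s0 st].
  have sI : 0 <= s <= 1 by rewrite s0 (le_trans st).
  by have [] := Dh s sI.
have g1t (t : R) : 0 <= t <= 1 -> c * t <= g1 t - g1 0.
  move=> /[dup] tI /andP[t0 t1].
  have sub s : 0 < s < t -> 0 <= s <= 1.
    by move=> /andP[/ltW -> /ltW st]; rewrite (le_trans st).
  have := @derive_le_le R (fun s => c * s) g1 (fun=> c) g2 0 t t0.
  rewrite mulr0 subr0; apply.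
  - by apply: (w01 _ (fun=> c)) => // s _; exact: lin.
  - exact: (w01 g1 g2 D2 t tI).
  - by move=> s /sub; exact: D2.
  - by move=> s /sub; exact: cg2.
pose q t : R := g1 0 * t + c / 2 * (t * t).
have Dq s : is_derive s (1 : R) q (g1 0 + c * s).
  have I := @is_derive_id R R s 1.
  have Dss : is_derive s (1 : R) (fun t : R => t * t) (s * 1 + s * 1).
    exact: (@is_deriveM _ _ id id s 1 1 1 I I).
  have := @is_deriveD R R R (fun s => g1 0 * s) (fun t => c / 2 * (t * t)) s 1 _ _
    (lin (g1 0) s) (@is_deriveZ R R R (fun t => t * t) (c / 2) s 1 _ Dss).
  congr (is_derive _ _ _ _).
  by rewrite -[_ *: _]/(c / 2 * (s * 1 + s * 1)); field.
have I1 : (0 : R) <= (1 : R) <= 1 by rewrite ler01/=.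
have := @derive_le_le R q g (fun s => g1 0 + c * s) g1 0 1 ler01.
rewrite /q !mulr0 !mulr1 addr0 subr0 => H.
suff : g1 0 + c / 2 <= g 1 - g 0 by lra.
apply: H.
- by apply: (w01 _ (fun s => g1 0 + c * s)) I1 => s _; exact: Dq.
- exact: (w01 g g1 D1 1 I1).
- by move=> s /andP[/ltW ? /ltW ?]; apply: D1; apply/andP.
- move=> s /andP[/ltW s0 /ltW s1].
  by have := g1t s; rewrite s0 s1 => /(_ isT); lra.
Qed.

Lemma taylor2_norm (g g1 g2 : R -> R) (c : R) :
  (forall t : R, 0 <= t <= 1 -> is_derive t (1 : R) g (g1 t)) ->
  (forall t : R, 0 <= t <= 1 -> is_derive t (1 : R) g1 (g2 t)) ->
  (forall t : R, 0 <= t <= 1 -> `|g2 t| <= c) ->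
  `|g 1 - g 0 - g1 0| <= c / 2.
Proof.
move=> D1 D2 cg2.
have lo : - c / 2 <= g 1 - g 0 - g1 0.
  by apply: taylor2_ge D1 D2 _ => t /cg2; rewrite ler_norml => /andP[].
have hi : - c / 2 <= - g 1 - - g 0 - - g1 0.
  apply: (@taylor2_ge (fun t => - g t) (fun t => - g1 t) (fun t => - g2 t)).
  - by move=> t /D1 ?; exact: is_deriveN.
  - by move=> t /D2 ?; exact: is_deriveN.
  - by move=> t /cg2; rewrite ler_norml => /andP[]; lra.
by rewrite ler_norml; apply/andP; split; lra.
Qed.

Lemma is_derive_segment V (O : set V) (g : V -> R) (a v : V) (t : R) :
  open O -> Ck 1 O g -> O (a + t *: v) ->
  is_derive t (1 : R) (fun t => g (a + t *: v)) ('D_v g (a + t *: v)).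
Proof.
move=> oO g1 Ot; apply: is_derive_comp_curve; last exact: is_derive_line.
exact: Ck_differentiable g1 Ot.
Qed.

Lemma taylor2_segment_ge V (O : set V) (g : V -> R) (a v : V) (c : R) :
  open O -> Ck 2 O g ->
  (forall t : R, 0 <= t <= 1 -> O (a + t *: v)) ->
  (forall t : R, 0 <= t <= 1 -> c <= 'D_v ('D_v g) (a + t *: v)) ->
  c / 2 <= g (a + v) - g a - 'D_v g a.
Proof.
move=> oO g2 seg Hc.
have := @taylor2_ge (fun t => g (a + t *: v)) (fun t => 'D_v g (a + t *: v))
  (fun t => 'D_v ('D_v g) (a + t *: v)) c.
rewrite scale1r scale0r addr0 => H; apply: H; last exact: Hc.
- by move=> t /seg Ot; apply: is_derive_segment oO _ Ot; exact: Ck_le g2.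
- by move=> t /seg Ot; exact: is_derive_segment oO (Ck_derive v oO g2) Ot.
Qed.

Lemma taylor2_segment_norm V (O : set V) (g : V -> R) (a v : V) (c : R) :
  open O -> Ck 2 O g ->
  (forall t : R, 0 <= t <= 1 -> O (a + t *: v)) ->
  (forall t : R, 0 <= t <= 1 -> `|'D_v ('D_v g) (a + t *: v)| <= c) ->
  `|g (a + v) - g a - 'D_v g a| <= c / 2.
Proof.
move=> oO g2 seg Hc.
have := @taylor2_norm (fun t => g (a + t *: v)) (fun t => 'D_v g (a + t *: v))
  (fun t => 'D_v ('D_v g) (a + t *: v)) c.
rewrite scale1r scale0r addr0 => H; apply: H; last exact: Hc.
- by move=> t /seg Ot; apply: is_derive_segment oO _ Ot; exact: Ck_le g2.
- by move=> t /seg Ot; exact: is_derive_segment oO (Ck_derive v oO g2) Ot.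
Qed.

Lemma derive_translate V W (g : V -> W) (c y u : V) :
  'D_u (fun x => g (x + c)) y = 'D_u g (y + c).
Proof. by rewrite /derive /= ; under [in LHS]eq_fun do rewrite -addrA. Qed.

(** The mean value theorem twice: in direction [u] for the increment [G] of [g] along [h *: v], then
    in direction [v] for the derivative of [g] along [u]. *)
Lemma second_difference V (O : set V) (g : V -> R) (x u v : V) (h : R) :
  open O -> Ck 2 O g -> 0 < h ->
  (forall s t : R, 0 <= s <= h -> 0 <= t <= h -> O (x + s *: u + t *: v)) ->
  exists s t : R, [/\ 0 <= s <= h, 0 <= t <= h &
    g (x + h *: u + h *: v) - g (x + h *: u) - (g (x + h *: v) - g x) =
    h ^+ 2 * 'D_v ('D_u g) (x + s *: u + t *: v)].
Proof.
move=> oO g2 h0 HO.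
have hh (t : R) : 0 <= t <= 1 -> 0 <= t * h <= h.
  move=> /andP[t0 t1]; apply/andP; split; first by rewrite mulr_ge0// ltW.
  by rewrite ler_piMl// ltW.
have I0 : 0 <= (0 : R) <= h by rewrite lexx ltW.
have I1 : 0 <= h <= h by rewrite lexx ltW.
pose G y := g (y + h *: v) - g y.
have Dsh y : O (y + h *: v) -> differentiable (fun y => g (y + h *: v)) y.
  move=> Oy; apply: (@differentiable_comp R _ _ _ (fun y => y + h *: v) g).
    exact: differentiableD.
  exact: Ck_differentiable g2 Oy.
have Dg y : O y -> differentiable g y by move=> Oy; exact: Ck_differentiable g2 Oy.
have Ost (t : R) : 0 <= t <= 1 ->
    O (x + t *: (h *: u)) /\ O (x + t *: (h *: u) + h *: v).
  move=> /hh t01; rewrite scalerA; split; last exact: HO.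
  by have := HO (t * h) 0 t01 I0; rewrite scale0r addr0.
have [t /Ost OO|t /andP[/ltW t0 /ltW t1]] := @mean_value_segment R _ G x (h *: u).
  case: OO => Hx Hy; by apply: differentiableB; [exact: Dsh | exact: Dg].
have t01 : 0 <= t <= 1 by rewrite t0.
have [Hx Hy] := Ost t t01.
have -> : 'D_(h *: u) G (x + t *: (h *: u)) =
    h * ('D_u g (x + t *: (h *: u) + h *: v) - 'D_u g (x + t *: (h *: u))).
  have dG : differentiable G (x + t *: (h *: u)).
    by apply: differentiableB; [exact: Dsh | exact: Dg].
  rewrite derive_linearZ// -[LHS]/(h * _); congr (_ * _).
  rewrite -[X in _ = X - _]derive_translate.
  by apply: deriveB; apply: diff_derivable; [exact: Dsh | exact: Dg].
have g1 := Ck_derive u oO g2.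
have Or (r : R) : 0 <= r <= 1 -> O (x + t *: (h *: u) + r *: (h *: v)).
  by move=> /hh r01; rewrite !scalerA; apply: HO => //; exact: hh.
have [r /Or|r /andP[/ltW r0 /ltW r1]] :=
    @mean_value_segment R _ ('D_u g) (x + t *: (h *: u)) (h *: v).
  exact: Ck_differentiable g1.
have r01 : 0 <= r <= 1 by rewrite r0.
move=> ->; rewrite derive_linearZ; last exact: (Ck_differentiable oO g1 (Or r r01)).
rewrite -[h *: 'D_v _ _]/(h * _) => E; exists (t * h), (r * h); split; try exact: hh.
by rewrite -!scalerA expr2 -mulrA -E /G.
Qed.

(** The mean value theorem equates values of [p] and [q] at two different, uncontrolled points of a
    small parallelogram; continuity at [x] turns this into equality at [x]. *)
Lemma eq_of_near_values V (O : set V) (p q : V -> R) (x u v : V) :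
  open O -> O x -> {for x, continuous p} -> {for x, continuous q} ->
  (forall h : R, 0 < h ->
    (forall s t : R, 0 <= s <= h -> 0 <= t <= h -> O (x + s *: u + t *: v)) ->
    exists s t s' t' : R,
      [/\ 0 <= s <= h, 0 <= t <= h, 0 <= s' <= h, 0 <= t' <= h &
          p (x + s *: u + t *: v) = q (x + s' *: u + t' *: v)]) ->
  p x = q x.
Proof.
move=> oO Ox cp cq Hpq.
apply/eqP; rewrite -subr_eq0 -normr_le0; apply/ler_addgt0Pl => e e0; rewrite addr0.
have e2 : 0 < e / 2 by rewrite divr_gt0.
have : \forall y \near x, [/\ O y, `|p x - p y| <= e / 2 & `|q x - q y| <= e / 2].
  have nO : nbhs x O by exact: open_nbhs_nbhs.
  move/cvgrPdist_le : cp => /(_ _ e2) np; move/cvgrPdist_le : cq => /(_ _ e2) nq.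
  by apply: filterS3 nO np nq => y; split.
move=> /nbhs_ballP[r /= r0 Hr].
pose M := `|u| + `|v| + 1.
have M0 : 0 < M by rewrite ltr_pwDr// addr_ge0.
(* With this side length the whole parallelogram lies in the ball of radius [r] around [x]. *)
pose h := r / 2 / M.
have h0 : 0 < h by rewrite !divr_gt0.
have Hb (s t : R) : 0 <= s <= h -> 0 <= t <= h -> ball x r (x + s *: u + t *: v).
  move=> /andP[s0 sh] /andP[t0 th].
  rewrite -ball_normE /ball_/= opprD addrA opprD addrA subrr sub0r -opprD normrN.
  apply: le_lt_trans (ler_normD _ _) _; rewrite !normrZ !ger0_norm//.
  apply: le_lt_trans (_ : h * M < _); last by rewrite /h divfK ?gt_eqF//; lra.
  rewrite /M !mulrDr mulr1 -[leLHS]addr0.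
  by rewrite lerD// ?lerD// ?ler_wpM2r// ltW.
have [|s [t [s' [t' [sh th sh' th' E]]]]] := Hpq h h0.
  by move=> s t sh th; have [] := Hr _ (Hb _ _ sh th).
have [_ H1 _] := Hr _ (Hb _ _ sh th).
have [_ _ H2] := Hr _ (Hb _ _ sh' th').
move: H1 H2; rewrite E !ler_norml => /andP[? ?] /andP[? ?].
by apply/andP; split; lra.
Qed.

(** Schwarz's theorem: the second difference is symmetric in [u] and [v], and divided by [h ^+ 2] it
    is a value of either mixed derivative near [x]. *)
Lemma derive_sym V (O : set V) (g : V -> R) (x u v : V) :
  open O -> Ck 2 O g -> O x -> 'D_v ('D_u g) x = 'D_u ('D_v g) x.
Proof.
move=> oO g2 Ox.
apply: (@eq_of_near_values V O ('D_v ('D_u g)) ('D_u ('D_v g)) x u v oO Ox).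
- exact: Ck_continuous oO (Ck_derive v oO (Ck_derive u oO g2)) Ox.
- exact: Ck_continuous oO (Ck_derive u oO (Ck_derive v oO g2)) Ox.
move=> h h0 HO.
have HO' (s t : R) : 0 <= s <= h -> 0 <= t <= h -> O (x + s *: v + t *: u).
  by move=> sh th; rewrite addrAC; exact: HO.
have [s [t [sh th E1]]] := second_difference oO g2 h0 HO.
have [s' [t' [sh' th' E2]]] := second_difference oO g2 h0 HO'.
have h20 : h ^+ 2 != 0 by rewrite expf_neq0// gt_eqF.
have cancel_h (a b c d P Q : R) : a - b - (c - d) = h ^+ 2 * P ->
    a - c - (b - d) = h ^+ 2 * Q -> P = Q.
  by move=> EP EQ; apply: (mulfI h20); rewrite -EP -EQ; ring.
rewrite (addrAC x (h *: v)) (addrAC x (s' *: v)) in E2.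
by exists s, t, t', s'; split; [| | | | exact: cancel_h E1 E2].
Qed.

End SecondOrder.

(** * Families of functions bounded in C^k *)

Lemma continuous_pair_cst (S T X : topologicalType) (f : S -> T) (a : X) (x : S) :
  {for x, continuous f} -> {for x, continuous (fun y => (a, f y))}.
Proof. by move=> cf; exact: (cvg_pair (cvg_cst a) cf). Qed.

Section UniformSmoothness.
Context (R : realType).
Implicit Types (V W : normedModType R) (Z : Type).

(* The parameter is the time: the SBP accuracy condition is applied to the
   fluxes at each fixed time, so their C^k norms have to be bounded uniformly
   in it. *)
Fixpoint unif_Ck Z V W (k : nat) (P : set Z) (G : Z -> V -> W) : Prop :=
  (exists C, forall z x, P z -> `|G z x| <= C) /\
  (forall z, P z -> continuous (G z)) /\
  if k is k'.+1 then
    (forall z x, P z -> differentiable (G z) x) /\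
    (forall v, unif_Ck k' P (fun z x => 'D_v (G z) x))
  else True.

Lemma unif_Ck_continuous Z V W k (P : set Z) (G : Z -> V -> W) z :
  unif_Ck k P G -> P z -> continuous (G z).
Proof. by case: k => [|k] [_ [cG _]] Pz; exact: cG. Qed.

Lemma unif_Ck_eq Z V W k (P : set Z) (G G' : Z -> V -> W) :
  (forall z, P z -> G z = G' z) -> unif_Ck k P G -> unif_Ck k P G'.
Proof.
elim: k G G' => [|k IH] G G' GG' [[C HC] [cG HG]].
  split; first by exists C => z x Pz; rewrite -GG'//; exact: HC.
  by split=> // z Pz; rewrite -GG'//; exact: cG.
split; first by exists C => z x Pz; rewrite -GG'//; exact: HC.
split; first by move=> z Pz; rewrite -GG'//; exact: cG.
move: HG => [dG DG]; split; first by move=> z x Pz; rewrite -GG'//; exact: dG.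
by move=> v; apply: IH (DG v) => z Pz; rewrite GG'.
Qed.

Lemma unif_Ck_le Z V W k (P : set Z) (G : Z -> V -> W) :
  unif_Ck k.+1 P G -> unif_Ck k P G.
Proof.
elim: k G => [|k IH] G [bG [cG [dG DG]]]; first by [].
by split=> //; split=> //; split=> // v; exact: IH (DG v).
Qed.

Lemma unif_Ck_cst0 Z V W k (P : set Z) : unif_Ck k P (fun (_ : Z) (_ : V) => 0 : W).
Proof.
elim: k => [|k IH].
  split; first by exists 0 => z x _; rewrite normr0.
  by split=> // z _ x; exact: cvg_cst.
split; first by exists 0 => z x _; rewrite normr0.
split; first by move=> z _ x; exact: cvg_cst.
split; first by move=> z x _; exact: differentiable_cst.
by move=> v; apply: unif_Ck_eq IH => z _; apply/funext => x; rewrite derive_cst.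
Qed.

Lemma unif_Ck_reparam Z Z' V W k (P : set Z) (P' : set Z') (phi : Z' -> Z)
    (G : Z -> V -> W) :
  (forall z, P' z -> P (phi z)) -> unif_Ck k P G -> unif_Ck k P' (fun z x => G (phi z) x).
Proof.
move=> PP; elim: k G => [|k IH] G [[C HC] [cG HG]].
  split; first by exists C => z x /PP Pz; exact: HC.
  by split=> // z /PP Pz; exact: cG.
split; first by exists C => z x /PP Pz; exact: HC.
split; first by move=> z /PP Pz; exact: cG.
move: HG => [dG DG]; split; first by move=> z x /PP Pz; exact: dG.
by move=> v; exact: IH (DG v).
Qed.

Lemma unif_CkD Z V W k (P : set Z) (G G' : Z -> V -> W) :
  unif_Ck k P G -> unif_Ck k P G' -> unif_Ck k P (fun z x => G z x + G' z x).
Proof.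
elim: k G G' => [|k IH] G G' [[C HC] [cG HG]] [[C' HC'] [cG' HG']].
  split; last by split=> // z Pz x; apply: cvgD; [exact: cG | exact: cG'].
  by exists (C + C') => z x Pz; rewrite (le_trans (ler_normD _ _))// lerD ?HC ?HC'.
split.
  by exists (C + C') => z x Pz; rewrite (le_trans (ler_normD _ _))// lerD ?HC ?HC'.
split; first by move=> z Pz x; apply: cvgD; [exact: cG | exact: cG'].
move: HG HG' => [dG DG] [dG' DG']; split=> [z x Pz|v].
  by apply: differentiableD; [exact: dG | exact: dG'].
apply: unif_Ck_eq (IH _ _ (DG v) (DG' v)) => z Pz; apply/funext => x.
by apply/esym/(@deriveD R V W (G z) (G' z)); apply: diff_derivable; [exact: dG | exact: dG'].
Qed.

Lemma unif_CkM Z V k (P : set Z) (G G' : Z -> V -> R) :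
  unif_Ck k P G -> unif_Ck k P G' -> unif_Ck k P (fun z x => G z x * G' z x).
Proof.
elim: k G G' => [|k IH] G G' Gk Gk'.
  move: Gk Gk' => [[C HC] [cG HG]] [[C' HC'] [cG' HG']].
  split; last by split=> // z Pz x; apply: cvgM; [exact: cG | exact: cG'].
  by exists (C * C') => z x Pz; rewrite normrM ler_pM// ?HC ?HC'.
have G1 := unif_Ck_le Gk; have G1' := unif_Ck_le Gk'.
move: Gk Gk' => [[C HC] [cG HG]] [[C' HC'] [cG' HG']].
split; first by exists (C * C') => z x Pz; rewrite normrM ler_pM// ?HC ?HC'.
split; first by move=> z Pz x; apply: cvgM; [exact: cG | exact: cG'].
move: HG HG' => [dG DG] [dG' DG']; split=> [z x Pz|v].
  by apply: differentiableM; [exact: dG | exact: dG'].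
apply: unif_Ck_eq (unif_CkD (IH _ _ G1 (DG' v)) (IH _ _ G1' (DG v))) => z Pz.
apply/funext => x.
by apply/esym/(@deriveM R V (G z) (G' z)); apply: diff_derivable; [exact: dG | exact: dG'].
Qed.

Lemma unif_Ck_sum Z V W k (P : set Z) (I : Type) (r : seq I) (G : I -> Z -> V -> W) :
  (forall i, unif_Ck k P (G i)) -> unif_Ck k P (fun z x => \sum_(i <- r) G i z x).
Proof.
move=> Gk; elim: r => [|i r IH].
  apply: unif_Ck_eq (unif_Ck_cst0 V W k P) => z _.
  by apply/funext => x; rewrite big_nil.
apply: unif_Ck_eq (unif_CkD (Gk i) IH) => z _.
by apply/funext => x; rewrite big_cons.
Qed.

Lemma unif_Ck_coord Z V n k (P : set Z) (G : Z -> V -> 'rV[R]_n) l :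
  unif_Ck k P G -> unif_Ck k P (fun z x => G z x 0 l : R).
Proof.
elim: k G => [|k IH] G [[C HC] [cG HG]].
  split; first by exists C => z x Pz; rewrite (le_trans (norm_coord_le _ _ _))// HC.
  split=> // z Pz x; apply: (@continuous_comp _ _ _ (G z) (fun N => N 0 l)).
    exact: cG.
  exact: coord_continuous.
split; first by exists C => z x Pz; rewrite (le_trans (norm_coord_le _ _ _))// HC.
split.
  move=> z Pz x; apply: (@continuous_comp _ _ _ (G z) (fun N => N 0 l)).
    exact: cG.
  exact: coord_continuous.
move: HG => [dG DG]; split=> [z x Pz|v].
  by apply: differentiable_comp_coord; exact: dG.
apply: unif_Ck_eq (IH _ (DG v)) => z Pz; apply/funext => x.
by rewrite derive_coord//; apply: diff_derivable; exact: dG.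
Qed.

Lemma derive_pair_cst V W W' (f : V -> W') (a : W) (x v : V) :
  differentiable f x -> 'D_v (fun y => (a, f y)) x = (0, 'D_v f x).
Proof.
move=> df; have dp : differentiable (fun y => (a, f y)) x.
  by apply: differentiable_pair; first exact: differentiable_cst.
rewrite !deriveE// diff_pair//.
by rewrite -[(fun=> a)]/(cst a) diff_cst.
Qed.

(** Induction through the chain rule. Because the first argument does not depend on [x], a
    derivative of the composition is a sum of products of a component of the derivative of [G] with
    a second-argument partial of [F] composed in the same way. Bounds come from compactness of the
    product of [K] with itself. *)
Lemma unif_Ck_comp Z V n k (P : set Z) (A K : set 'rV[R]_n)
    (F : 'rV[R]_n * 'rV[R]_n -> R) (a : Z -> 'rV[R]_n) (G : Z -> V -> 'rV[R]_n) :
  open A -> compact K -> K `<=` A -> Ck k (A `*` A) F ->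
  (forall z, P z -> K (a z)) -> (forall z x, P z -> K (G z x)) ->
  unif_Ck k P G -> unif_Ck k P (fun z x => F (a z, G z x)).
Proof.
move=> oA cK KA + aK GK.
have oAA : open (A `*` A) by exact: open_setX.
have AAG z x : P z -> (A `*` A) (a z, G z x).
  by move=> Pz; split; apply: KA; [exact: aK | exact: GK].
have KKA : K `*` K `<=` A `*` A by move=> y [/KA ? /KA ?].
have bF l (F' : 'rV[R]_n * 'rV[R]_n -> R) : Ck l (A `*` A) F' ->
    exists C, forall z x, P z -> `|F' (a z, G z x)| <= C.
  move=> Fk; have [C _ HC] := compact_norm_bound (compact_setX cK cK)
    (continuous_subspaceW KKA (Ck_continuous_within Fk)).
  by exists C => z x Pz; apply: HC; split; [exact: aK | exact: GK].
have cF l (F' : 'rV[R]_n * 'rV[R]_n -> R) : Ck l (A `*` A) F' ->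
    forall z, P z -> continuous (G z) -> continuous (fun x => F' (a z, G z x)).
  move=> Fk z Pz cG x.
  apply: (@continuous_comp _ _ _ (fun x => (a z, G z x)) F').
    by apply: continuous_pair_cst; exact: cG.
  exact: Ck_continuous oAA Fk (AAG z x Pz).
elim: k F => [|k IH] F Fk Gk.
  split; first exact: bF Fk.
  by split=> // z Pz; apply: (cF _ _ Fk z Pz); exact: unif_Ck_continuous Gk Pz.
split; first exact: bF Fk.
split; first by move=> z Pz; apply: (cF _ _ Fk z Pz); exact: unif_Ck_continuous Gk Pz.
have G1 := unif_Ck_le Gk; move: Gk => [_ [_ [dG DG]]].
have dp z x : P z -> differentiable (fun y => (a z, G z y)) x.
  by move=> Pz; apply: differentiable_pair; [exact: differentiable_cst | exact: dG].
have dF z x : P z -> differentiable F (a z, G z x).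
  by move=> Pz; exact: Ck_differentiable oAA Fk (AAG z x Pz).
split=> [z x Pz|v].
  by apply: (@differentiable_comp R V _ _ (fun y => (a z, G z y)) F); [exact: dp | exact: dF].
have Dl l : unif_Ck k P (fun z x => 'D_v (G z) x 0 l * 'D_(0, e_ R l) F (a z, G z x)).
  apply: unif_CkM; first exact: unif_Ck_coord (DG v).
  exact: (IH ('D_(0, e_ R l) F) (Ck_derive _ oAA Fk) G1).
apply: unif_Ck_eq (unif_Ck_sum (index_enum _) Dl) => z Pz; apply/funext => x.
rewrite (@derive_comp R V _ _ (fun y => (a z, G z y)) F); [|exact: dp|exact: dF].
rewrite derive_pair_cst; last exact: dG.
rewrite derive_prod_sum; last exact: dF.
rewrite [in RHS]big1 ?add0r; last by move=> l _; rewrite mxE scale0r.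
exact: eq_bigr.
Qed.

Lemma unif_Ck_Ck Z V W k (P : set Z) (G : Z -> V -> W) z :
  unif_Ck k P G -> P z -> Ck k setT (G z).
Proof.
elim: k G => [|k IH] G [_ [cG HG]] Pz.
  by split=> //; apply: continuous_subspaceT; exact: cG.
split; first by apply: continuous_subspaceT; exact: cG.
move: HG => [dG DG]; split=> [x _|v]; first exact: dG.
by exists ('D_v (G z)) => //; exact: IH (DG v) Pz.
Qed.

Lemma unif_Ck_norm Z d k (P : set Z) (G : Z -> 'rV[R]_d -> R) :
  unif_Ck k P G -> exists2 C, 0 <= C & forall z, P z -> Ck_norm k (G z) <= C.
Proof.
move=> Gk; suff [C C0 HC] : exists2 C, 0 <= C & forall z x (s : seq 'I_d),
    P z -> (size s <= k)%N -> `|iter_partial s (G z) x| <= C.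
  exists C => // z Pz; apply: ge_sup => [|_ [s sk [x ->]]]; last exact: HC.
  by exists `|iter_partial [::] (G z) 0|, [::] => //; exists 0.
elim: k G Gk => [|k IH] G [[C HC] [_ HG]].
  exists `|C| => // z x [|//] Pz _ /=.
  by apply: le_trans (HC z x Pz) _; exact: ler_norm.
move: HG => [_ DG].
have [||C' C'0 HC'] := @fin_bound R 'I_d (fun m c => forall z x (s : seq 'I_d),
    P z -> (size s <= k)%N -> `|iter_partial s ('D_(e_ R m) (G z)) x| <= c).
- by move=> m c c' cc' H z x s Pz sk; exact: le_trans (H z x s Pz sk) cc'.
- by move=> m; have [c _ Hc] := IH _ (DG (e_ R m)); exists c.
exists (`|C| + C') => [|z x s Pz]; first by rewrite addr_ge0.
(* The last entry of [s] is the innermost derivative; removing it leaves [iter_partial s] applied to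
   a first derivative of [G z], to which the induction hypothesis applies. *)
case/lastP: s => [|s m] sk.
  by apply: le_trans (HC z x Pz) _; rewrite (le_trans (ler_norm _))// lerDl.
rewrite /iter_partial foldr_rcons -/(iter_partial s _).
by apply: le_trans (HC' m z x s Pz _) _; [rewrite size_rcons in sk | rewrite lerDr].
Qed.

End UniformSmoothness.

(** * Periodic functions and bounds over a period cell *)

Section Periodicity.
Context (R : realType) (d : nat) (L : R).

(** Subtract [floor (y_m / L)] periods in each coordinate. Suprema over the whole space thereby
    become suprema over a compact box. *)
Lemma torus_representative (y : 'rV[R]_d) : 0 < L ->
  exists2 y' : 'rV[R]_d, forall m, 0 <= y' 0 m <= L &
    forall (W : zmodType) (g : 'rV[R]_d -> W), torus_periodic L g -> g y' = g y.
Proof.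
move=> L0; pose z m := Num.floor (y 0 m / L).
pose y' := y + \sum_m (L *: e_ R m) *~ (- z m).
exists y' => [m|W g gL].
  have -> : y' 0 m = y 0 m - (z m)%:~R * L.
    rewrite /y' mxE summxE (bigD1 m)//= big1 ?addr0 => [|l lm].
      by rewrite -scaler_int !mxE !eqxx mulr1 mulrNz mulNr.
    by rewrite -scaler_int !mxE [m == l]eq_sym (negPf lm) andbF !mulr0.
  have := floor_itv (y 0 m / L); rewrite -/(z m) => /andP[zl zr].
  move: zl; rewrite ler_pdivlMr// => zl.
  move: zr; rewrite ltr_pdivrMr// intrD mulrDl mul1r => zr.
  by apply/andP; split; lra.
have gint m x k : g (x + (L *: e_ R m) *~ k) = g x.
  case: k => k; first by rewrite -pmulrn (periodicn (gL m)).
  by rewrite NegzE mulrNz -pmulrn -(periodicn (gL m) k.+1) subrK.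
suff gsum w : (forall x, g (x + w) = g x) -> g (y + w) = g y.
  rewrite /y' gsum//; elim/big_ind : _ => [x|a b Ha Hb x|i _ x].
  - by rewrite addr0.
  - by rewrite addrA Hb Ha.
  - exact: gint.
exact.
Qed.

Lemma torus_periodic_derive (W : normedModType R) (g : 'rV[R]_d -> W) v :
  torus_periodic L g -> torus_periodic L ('D_v g).
Proof.
move=> gL m x; rewrite -derive_translate.
have -> : (fun y => g (y + L *: e_ R m)) = g by apply/funext => y; exact: gL.
by [].
Qed.

Lemma slab_interior (T t : R) (y : 'rV[R]_d) : 0 < t < T -> (@slab R d T)° (t, y).
Proof.
move=> tT; exists (`]0, T[%classic, setT); last first.
  by move=> [s x] [/= sT _]; split=> //=; apply: subset_itv_oo_cc.
split=> /=; last exact: filterT.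
by apply: open_nbhs_nbhs; split; [exact: interval_open | rewrite /= in_itv].
Qed.

(** Bounds come from the continuous extensions to the compact box of times and one period cell,
    whereas these are known to be derivatives only at interior times; hence the parameter set
    [0 < t < T]. Periodicity of an extension at such a time is inherited from the derivative it
    represents. *)
Lemma unif_Ck_slab (W : normedModType R) k (T : R) (g : R * 'rV[R]_d -> W) :
  0 < L -> Ck k (@slab R d T) g ->
  (forall t, 0 < t < T -> torus_periodic L (fun y => g (t, y))) ->
  unif_Ck k [set t | 0 < t < T] (fun t y => g (t, y)).
Proof.
move=> L0.
have cbox : compact (`[0, T]%classic `*` [set y : 'rV[R]_d | forall m, 0 <= y 0 m <= L]).
  apply: compact_setX; first exact: segment_compact.
  have := @rV_compact R d (fun=> `[0, L]%classic) (fun=> @segment_compact R 0 L).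
  congr compact; apply/seteqP; split=> y Hy m; have := Hy m; rewrite /= in_itv/=;
    by rewrite (_ : ord0 = 0).
have sub : `[0, T]%classic `*` [set y : 'rV[R]_d | forall m, 0 <= y 0 m <= L]
    `<=` @slab R d T by move=> [t y] [].
have bg l (g' : R * 'rV[R]_d -> W) : Ck l (@slab R d T) g' ->
    (forall t, 0 < t < T -> torus_periodic L (fun y => g' (t, y))) ->
    exists C, forall t y, 0 < t < T -> `|g' (t, y)| <= C.
  move=> gk gL.
  have [C _ HC] := compact_norm_bound cbox (continuous_subspaceW sub
    (Ck_continuous_within gk)).
  exists C => t y tT; have [y' y'L y'E] := torus_representative y L0.
  rewrite -(y'E _ _ (gL t tT)); apply: HC; split=> //=.
  by move: tT; rewrite in_itv/= => /andP[/ltW -> /ltW ->].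
have cg l (g' : R * 'rV[R]_d -> W) : Ck l (@slab R d T) g' ->
    forall t, 0 < t < T -> continuous (fun y => g' (t, y)).
  move=> gk t tT y; apply: (@continuous_comp _ _ _ (fun y => (t, y)) g').
    by apply: (@continuous_pair_cst _ _ _ id); exact: cvg_id.
  have := Ck_sub_open (@open_interior _ (@slab R d T)) (@interior_subset _ _) gk.
  by move=> /(Ck_continuous (@open_interior _ _)); apply; exact: slab_interior.
elim: k g => [|k IH] g gk gL.
  by split; [exact: bg gk gL | split=> //; exact: cg gk].
split; first exact: bg gk gL.
split; first exact: cg gk.
have dp t y : differentiable (fun y : 'rV[R]_d => (t, y)) y.
  by apply: differentiable_pair; first exact: differentiable_cst.
have dg t y : 0 < t < T -> differentiable g (t, y).
  by move=> tT; apply: gk.2.1; exact: slab_interior.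
split=> [t y tT|v].
  by apply: (@differentiable_comp R _ _ _ (fun y => (t, y)) g); [exact: dp | exact: dg].
have [g' g'k g'E] := gk.2.2 (0, v).
have DgE t y : 0 < t < T -> 'D_v (fun y => g (t, y)) y = g' (t, y).
  move=> tT; rewrite (@derive_comp R _ _ _ (fun y => (t, y)) g); [|exact: dp|exact: dg].
  rewrite (@derive_pair_cst _ _ _ _ id)//.
  by rewrite derive_id g'E//; exact: slab_interior.
apply: (@unif_Ck_eq _ _ _ _ _ _ (fun t y => g' (t, y))).
  by move=> t tT; apply/funext => y; rewrite DgE.
apply: IH g'k _ => t tT.
have -> : (fun y => g' (t, y)) = 'D_v (fun y => g (t, y)).
  by apply/funext => y; rewrite DgE.
by apply: torus_periodic_derive; exact: gL.
Qed.

End Periodicity.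

(** * Entropy variables and two-point fluxes *)

Section JointDerivatives.
Context (R : realType).

Lemma derivable_differentiable (W : normedModType R) (c : R -> W) (t : R) :
  derivable c t 1 -> differentiable c t.
Proof. by move=> dc; apply/derivable1_diffP. Qed.

Context (V W X : normedModType R) (j : V * W -> X) (a : V) (b : W).
Hypothesis dj : differentiable j (a, b).

Lemma differentiable_joint_l : differentiable (fun x => j (x, b)) a.
Proof.
by apply: (@differentiable_comp R _ _ _ (fun x => (x, b)) j).
Qed.

Lemma differentiable_joint_r : differentiable (fun y => j (a, y)) b.
Proof.
by apply: (@differentiable_comp R _ _ _ (fun y => (a, y)) j).
Qed.

Lemma derive_joint_l v : 'D_v (fun x => j (x, b)) a = 'D_(v, 0) j (a, b).
Proof.
have dp : differentiable (fun x : V => (x, b)) a.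
  by apply: differentiable_pair => //; exact: differentiable_cst.
rewrite (@derive_comp R _ _ _ (fun x => (x, b)) j)//.
have -> // : 'D_v (fun x : V => (x, b)) a = (v, 0).
rewrite deriveE// diff_pair// -[(fun=> b)]/(cst b) diff_cst.
by rewrite -deriveE// derive_id.
Qed.

Lemma derive_joint_r v : 'D_v (fun y => j (a, y)) b = 'D_(0, v) j (a, b).
Proof.
have dp : differentiable (fun y : W => (a, y)) b.
  by apply: differentiable_pair => //; exact: differentiable_cst.
rewrite (@derive_comp R _ _ _ (fun y => (a, y)) j)//.
by rewrite (@derive_pair_cst R _ _ _ id)// derive_id.
Qed.

End JointDerivatives.

Lemma derive_diag (R : realType) (V X : normedModType R) (j : V * V -> X) a v :
  differentiable j (a, a) ->
  'D_v (fun x => j (x, x)) a = 'D_(v, 0) j (a, a) + 'D_(0, v) j (a, a).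
Proof.
move=> dj; have dp : differentiable (fun x : V => (x, x)) a by exact: differentiable_pair.
rewrite (@derive_comp R _ _ _ (fun x => (x, x)) j)// -derive_linearD//.
have -> // : 'D_v (fun x : V => (x, x)) a = (v, 0) + (0, v).
rewrite deriveE// diff_pair// -deriveE// derive_id.
by congr (_, _); rewrite /= ?addr0 ?add0r.
Qed.

Section EntropyVariables.
Context (R : realType) (n : nat).
Implicit Types (a b v w : 'rV[R]_n).

Lemma differentiable_rV (V : normedModType R) (g : V -> 'rV[R]_n) x :
  (forall k, differentiable (fun y => g y 0 k : R) x) -> differentiable g x.
Proof.
move=> dg; have -> : g = \sum_(k < n) (fun y => g y 0 k *: e_ R k).
  apply/funext => y; rewrite {1}(rV_sum_basis (g y)).
  by elim/big_rec2 : _ => // k z h _ ->.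
by apply: differentiable_sum => k; exact: differentiableZl.
Qed.

Lemma derive_dot (V : normedModType R) (p q : V -> 'rV[R]_n) x u :
  differentiable p x -> differentiable q x ->
  'D_u (fun y => dot (p y) (q y)) x = dot ('D_u p x) (q x) + dot (p x) ('D_u q x).
Proof.
move=> dp dq.
have dpk k : differentiable (fun y => p y 0 k : R) x by exact: differentiable_comp_coord.
have dqk k : differentiable (fun y => q y 0 k : R) x by exact: differentiable_comp_coord.
have -> : (fun y => dot (p y) (q y)) =
    \sum_(k < n) ((fun y => p y 0 k) * (fun y => q y 0 k)).
  apply/funext => y; rewrite dotE.
  by elim/big_rec2 : _ => // k z h _ ->.
rewrite derive_sum; last first.
  by move=> k; apply: derivableM; apply: diff_derivable.
rewrite !dotE -big_split; apply: eq_bigr => k _.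
rewrite deriveM; [|exact: diff_derivable|exact: diff_derivable].
rewrite !derive_coord; [|exact: diff_derivable|exact: diff_derivable].
rewrite -[X in X + _]/(p x 0 k * _) -[X in _ + X]/(q x 0 k * _).
by rewrite addrC [q x 0 k * _]mulrC.
Qed.

Lemma differentiable_dot (V : normedModType R) (p q : V -> 'rV[R]_n) x :
  differentiable p x -> differentiable q x ->
  differentiable (fun y => dot (p y) (q y)) x.
Proof.
move=> dp dq.
have -> : (fun y => dot (p y) (q y)) =
    \sum_(k < n) ((fun y => p y 0 k) * (fun y => q y 0 k)).
  apply/funext => y; rewrite dotE.
  by elim/big_rec2 : _ => // k z h _ ->.
by apply: differentiable_sum => k; apply: differentiableM; exact: differentiable_comp_coord.
Qed.

Lemma is_derive_dot (p q : R -> 'rV[R]_n) (t : R) dp dq :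
  is_derive t (1 : R) p dp -> is_derive t (1 : R) q dq ->
  is_derive t (1 : R) (fun s => dot (p s) (q s)) (dot dp (q t) + dot (p t) dq).
Proof.
move=> [Dp Ep] [Dq Eq].
have dp' : differentiable p t := derivable_differentiable Dp.
have dq' : differentiable q t := derivable_differentiable Dq.
split; first by apply: diff_derivable; exact: differentiable_dot.
by rewrite derive_dot// Ep Eq.
Qed.

Lemma derive_grad_dot (U : 'rV[R]_n -> R) a v : differentiable U a ->
  'D_v U a = dot (grad U a) v.
Proof.
move=> dU; rewrite derive_rV_sum// dotE; apply: eq_bigr => k _.
by rewrite mxE mulrC.
Qed.

Context (A : set 'rV[R]_n) (U : 'rV[R]_n -> R).
Hypotheses (oA : open A) (U2 : Ck 2 A U).

Lemma differentiable_entropy a : A a -> differentiable U a.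
Proof. exact: Ck_differentiable oA U2. Qed.

Lemma differentiable_grad a : A a -> differentiable (grad U) a.
Proof.
move=> Aa; apply: differentiable_rV => k.
have -> : (fun y => grad U y 0 k) = 'D_(e_ R k) U by apply/funext => y; rewrite mxE.
exact: Ck_differentiable oA (Ck_derive _ oA U2) Aa.
Qed.

Lemma derive_grad a v : A a -> 'D_v (grad U) a = v *m hess U a.
Proof.
move=> Aa; have dg := differentiable_grad Aa; apply/rowP => l.
rewrite -derive_coord; last exact: diff_derivable.
have -> : (fun y => grad U y 0 l) = 'D_(e_ R l) U by apply/funext => y; rewrite mxE.
rewrite derive_rV_sum; last exact: Ck_differentiable oA (Ck_derive _ oA U2) Aa.
by rewrite mxE; apply: eq_bigr => k _; rewrite mxE.
Qed.

Lemma derive2_hess a v : A a -> 'D_v ('D_v U) a = dot (v *m hess U a) v.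
Proof.
move=> Aa; have -> : 'D_v ('D_v U) a = 'D_v (fun x => dot (grad U x) v) a.
  apply: near_eq_derive; near=> x; apply: derive_grad_dot.
  by apply: differentiable_entropy; near: x; exact: open_nbhs_nbhs.
rewrite (@derive_dot _ (grad U) (cst v)); [|exact: differentiable_grad|exact: differentiable_cst].
by rewrite derive_cst dot0r addr0 derive_grad.
Unshelve. all: by end_near. Qed.

(** It later moves the Hessian from the time derivative of [u] onto the error. *)
Lemma hess_sym a v w : A a -> dot (v *m hess U a) w = dot (w *m hess U a) v.
Proof.
move=> Aa; have HT : (hess U a)^T = hess U a.
  by apply/matrixP => k l; rewrite !mxE; exact: derive_sym oA U2 Aa.
by rewrite dotC /dot trmx_mul HT mulmxA.
Qed.

Lemma continuous_grad a : A a -> {for a, continuous (grad U)}.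
Proof. by move=> Aa; apply: differentiable_continuous; exact: differentiable_grad. Qed.

(** Second-order Taylor expansion on the segment from [a] to [b], which convexity keeps in [K]. This
    is the coercivity through which the relative entropy controls the squared error. *)
Lemma entropy_lower_bound (K : set 'rV[R]_n) (c : R) a b :
  convex_set K -> K `<=` A ->
  (forall x, K x -> forall v, c * dot v v <= dot (v *m hess U x) v) ->
  K a -> K b ->
  c / 2 * dot (b - a) (b - a) <= U b - U a - dot (grad U a) (b - a).
Proof.
move=> vK KA Hc Ka Kb.
have seg (t : R) : 0 <= t <= 1 -> K (a + t *: (b - a)) by exact: convex_set_segment.
have := @taylor2_segment_ge R _ A U a (b - a) (c * dot (b - a) (b - a)) oA U2.
rewrite [a + (b - a)]addrC subrK derive_grad_dot; last by apply: differentiable_entropy; exact: KA.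
rewrite mulrAC; apply.
  by move=> t /seg /KA.
move=> t /seg Kt; rewrite derive2_hess; last exact: KA.
exact: Hc.
Qed.

End EntropyVariables.

Section TwoPointFlux.
Context (R : realType) (d n p : nat) (A : set 'rV[R]_n).
Context (f : 'I_d -> 'rV[R]_n -> 'rV[R]_n).
Context (U : 'rV[R]_n -> R) (F : 'I_d -> 'rV[R]_n -> R).
Context (fnum : 'I_d -> 'rV[R]_n -> 'rV[R]_n -> 'rV[R]_n).
Hypotheses (oA : open A) (f1 : forall m, Ck 1 A (f m)).
Hypotheses (UF : entropy_pair A f U F) (ec : entropy_conservative p A f U F fnum).

Let U2 : Ck 2 A U. Proof. by case: UF. Qed.
Let oAA : open (A `*` A). Proof. exact: open_setX. Qed.
Let joint m (ab : 'rV[R]_n * 'rV[R]_n) := fnum m ab.1 ab.2.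

Lemma differentiable_flux2 m a b : A a -> A b -> differentiable (joint m) (a, b).
Proof. by move=> Aa Ab; have [jk _ _ _] := ec m; exact: Ck_differentiable oAA jk _. Qed.

Lemma differentiable_flux_l m a b : A a -> A b -> differentiable (fun x => fnum m x b) a.
Proof. by move=> Aa Ab; exact: (differentiable_joint_l (differentiable_flux2 m Aa Ab)). Qed.

Lemma derive_flux_sym m a b e : A a -> A b ->
  'D_e (fun x => fnum m a x) b = 'D_e (fun x => fnum m x a) b.
Proof.
move=> Aa Ab; have [_ fsym _ _] := ec m.
apply: near_eq_derive; near=> x; apply: fsym => //.
by near: x; exact: open_nbhs_nbhs.
Unshelve. all: by end_near. Qed.

(** In the product rule the term with the derivative of [f m] cancels against the derivative of
    [F m], by the compatibility condition of the entropy pair. *)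
Lemma derive_potential m a v : A a ->
  'D_v (potential f U F m) a = dot (v *m hess U a) (f m a).
Proof.
move=> Aa; have [_ _ F1 FE] := UF.
have dF : differentiable (F m) a by exact: Ck_differentiable oA (F1 m) Aa.
have df : differentiable (f m) a by exact: Ck_differentiable oA (f1 m) Aa.
have dg := differentiable_grad oA U2 Aa.
have -> : potential f U F m = (fun x => dot (grad U x) (f m x)) - F m by [].
rewrite deriveB; [|by apply: diff_derivable; exact: differentiable_dot|exact: diff_derivable].
rewrite derive_dot// (derive_grad oA U2)// derive_grad_dot// FE// deriveEjacobian//.
by rewrite [dot (_ *m _) v]/dot -mulmxA -trmx_mul -/(dot _ _) addrK.
Qed.

(* The entropy conservation condition differentiated in its first argument; it
   turns the linearized flux differences into the test vectors [e *m hess U a]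
   of the relative entropy. *)
Lemma entropy_conservative_diff m a b e : A a -> A b ->
  dot (grad U b - grad U a) ('D_e (fun x => fnum m x b) a) =
  dot (e *m hess U a) (fnum m a b - f m a).
Proof.
move=> Aa Ab; have [_ _ _ fE] := ec m.
have dg := differentiable_grad oA U2 Aa.
have dl := differentiable_flux_l m Aa Ab.
have dgb : differentiable (fun x => grad U b - grad U x) a.
  by apply: differentiableB => //; exact: differentiable_cst.
have := derive_dot e dgb dl.
have -> : 'D_e (fun y => dot (grad U b - grad U y) (fnum m y b)) a =
          'D_e (cst (potential f U F m b) - potential f U F m) a.
  apply: near_eq_derive; near=> x; apply: fE => //.
  by near: x; exact: open_nbhs_nbhs.
have dpot : differentiable (potential f U F m) a.
  have [_ _ F1 _] := UF.
  apply: differentiableB; last exact: Ck_differentiable oA (F1 m) Aa.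
  by apply: differentiable_dot => //; exact: Ck_differentiable oA (f1 m) Aa.
rewrite deriveB; [|exact: derivable_cst|exact: diff_derivable].
rewrite derive_cst sub0r derive_potential//.
have -> : 'D_e (fun x => grad U b - grad U x) a = - (e *m hess U a).
  rewrite -(derive_grad oA U2)//.
  rewrite (@deriveB _ _ _ (cst (grad U b)) (grad U)); [|exact: derivable_cst|exact: diff_derivable].
  by rewrite derive_cst sub0r.
by rewrite dotNl dotBr => E; lra.
Unshelve. all: by end_near. Qed.

(* Symmetry and consistency give d f = 2 d_b fnum on the diagonal. *)
Lemma derive_flux_comp m (c : 'rV[R]_d -> 'rV[R]_n) x v :
  A (c x) -> differentiable c x ->
  'D_v (fun y => f m (c y)) x = 2 *: 'D_v (fun y => fnum m (c x) (c y)) x.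
Proof.
move=> Ac dc; have [_ _ fd _] := ec m.
have df : differentiable (f m) (c x) by exact: Ck_differentiable oA (f1 m) Ac.
have dj := differentiable_flux2 m Ac Ac.
rewrite (@derive_comp R _ _ _ c (f m) x v dc df).
have dr : differentiable (fnum m (c x)) (c x) by exact: (differentiable_joint_r dj).
rewrite (@derive_comp R _ _ _ c (fnum m (c x)) x v dc dr).
have E y : A y -> f m y = joint m (y, y) by move=> Ay; rewrite /joint fd.
have -> : 'D_('D_v c x) (f m) (c x) = 'D_('D_v c x) (fun y => joint m (y, y)) (c x).
  apply: near_eq_derive; near=> y; apply: E.
  by near: y; exact: open_nbhs_nbhs.
rewrite (derive_diag _ dj) -(derive_joint_l dj) -(derive_joint_r dj) /joint /=.
by rewrite -(derive_flux_sym m _ Ac Ac) -mulr2n scaler_nat.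
Unshelve. all: by end_near. Qed.

End TwoPointFlux.

(** * Summation by parts for skew-symmetric matrices with zero row sums *)

Section SkewSums.
Context (R : realType) (n N : nat) (Q : 'M[R]_N).
Hypotheses (Qskew : Q + Q^T = 0) (Q1 : Q *m (const_mx 1 : 'cV[R]_N) = 0).
Implicit Types (w : 'I_N -> 'rV[R]_n) (g : 'I_N -> 'I_N -> 'rV[R]_n).

Lemma skewE i j : Q j i = - Q i j.
Proof.
have := congr1 (fun B : 'M[R]_N => B i j) Qskew; rewrite !mxE => /eqP.
by rewrite addr_eq0 eq_sym eqr_oppLR => /eqP.
Qed.

Lemma row_sum0 i : \sum_j Q i j = 0.
Proof.
have := congr1 (fun B : 'cV[R]_N => B i 0) Q1; rewrite !mxE; apply: etrans.
by apply: eq_bigr => j _; rewrite mxE mulr1.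
Qed.

Lemma skew_sum (h : 'I_N -> 'I_N -> R) :
  \sum_i \sum_j Q i j * h j i = - \sum_i \sum_j Q i j * h i j.
Proof.
rewrite exchange_big -sumrN; apply: eq_bigr => i _; rewrite -sumrN.
by apply: eq_bigr => j _; rewrite skewE mulNr.
Qed.

(** The [h i] part vanishes by zero row sums, and skew-symmetry carries this over to the [h j]
    part. *)
Lemma skew_sum_const (h : 'I_N -> R) : \sum_i \sum_j Q i j * (h j - h i) = 0.
Proof.
have H0 : \sum_i \sum_j Q i j * h i = 0.
  by rewrite big1// => i _; rewrite -mulr_suml row_sum0 mul0r.
have := skew_sum (fun i _ => h i); rewrite H0 oppr0 => H1.
under eq_bigr do under eq_bigr do rewrite mulrBr.
under eq_bigr do rewrite sumrB.
by rewrite sumrB H0 H1 subr0.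
Qed.

(** Summation by parts: the factor 2 of the scheme supplies two copies of the sum, and exchanging
    the indices in one of them changes its sign. *)
Lemma symmetric_flux_sum w g : (forall i j, g i j = g j i) ->
  \sum_i dot (w i) (2 *: \sum_j Q i j *: g i j) =
  \sum_i \sum_j Q i j * dot (w i - w j) (g i j).
Proof.
move=> gsym; pose h i j := dot (w i) (g i j).
have -> : \sum_i dot (w i) (2 *: \sum_j Q i j *: g i j) =
    2 * \sum_i \sum_j Q i j * h i j.
  rewrite mulr_sumr; apply: eq_bigr => i _; rewrite dotZr dot_sumr.
  by congr (_ * _); apply: eq_bigr => j _; rewrite dotZr.
have -> : \sum_i \sum_j Q i j * dot (w i - w j) (g i j) =
    \sum_i \sum_j Q i j * h i j - \sum_i \sum_j Q i j * h j i.
  rewrite -sumrB; apply: eq_bigr => i _; rewrite -sumrB; apply: eq_bigr => j _.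
  by rewrite dotBl mulrBr /h (gsym j i).
by rewrite (skew_sum h) opprK; ring.
Qed.

(** Up to sign, each tested flux is a difference of potentials, so [skew_sum_const] applies. *)
Lemma entropy_conservative_sum w g (psi : 'I_N -> R) :
  (forall i j, dot (w j - w i) (g i j) = psi j - psi i) ->
  \sum_i \sum_j Q i j * dot (w i - w j) (g i j) = 0.
Proof.
move=> gpsi; apply/eqP; rewrite -oppr_eq0 -sumrN; apply/eqP/(etrans _ (skew_sum_const psi)).
apply: eq_bigr => i _; rewrite -sumrN; apply: eq_bigr => j _.
by rewrite -gpsi -[w i - w j]opprB dotNl mulrN opprK.
Qed.

(** Here [l] stands for the linearized flux and [k i] for [U''] applied to the error. The two halves
    of [l i j + l j i] contribute equally by skew-symmetry; in each, the part with [f i] is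
    independent of [j] and is killed by the zero row sums. *)
Lemma linearized_sum w g (l : 'I_N -> 'I_N -> 'rV[R]_n) (k f : 'I_N -> 'rV[R]_n) :
  (forall i j, dot (w j - w i) (l i j) = dot (k i) (g i j - f i)) ->
  \sum_i \sum_j Q i j * dot (w i - w j) (l i j + l j i) =
  - \sum_i dot (k i) (2 *: \sum_j Q i j *: g i j).
Proof.
move=> lE; pose h i j := dot (w i - w j) (l i j).
have -> : \sum_i \sum_j Q i j * dot (w i - w j) (l i j + l j i) =
    \sum_i \sum_j Q i j * h i j - \sum_i \sum_j Q i j * h j i.
  rewrite -sumrB; apply: eq_bigr => i _; rewrite -sumrB; apply: eq_bigr => j _.
  by rewrite dotDr -[X in _ + X]opprK -dotNl opprB mulrBr.
rewrite (skew_sum h) opprK -sumrN -big_split/=; apply: eq_bigr => i _.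
have -> : \sum_j Q i j * h i j = - \sum_j Q i j * dot (k i) (g i j).
  have -> : \sum_j Q i j * h i j = \sum_j (Q i j * dot (k i) (f i) - Q i j * dot (k i) (g i j)).
    apply: eq_bigr => j _.
    by rewrite /h -[w i - w j]opprB dotNl lE dotBr; ring.
  by rewrite sumrB -mulr_suml row_sum0 mul0r sub0r.
rewrite dotZr dot_sumr mulr_natl mulr2n opprD.
by congr (- _ - _); apply: eq_bigr => j _; rewrite dotZr.
Qed.

End SkewSums.

Section DiscreteEntropyBalance.
Context (R : realType) (d n p : nat) (A : set 'rV[R]_n).
Context (f : 'I_d -> 'rV[R]_n -> 'rV[R]_n).
Context (U : 'rV[R]_n -> R) (F : 'I_d -> 'rV[R]_n -> R).
Context (fnum : 'I_d -> 'rV[R]_n -> 'rV[R]_n -> 'rV[R]_n).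
Hypotheses (oA : open A) (f1 : forall m, Ck 1 A (f m)).
Hypotheses (UF : entropy_pair A f U F) (ec : entropy_conservative p A f U F fnum).
Context (N : nat) (Q : 'M[R]_N).
Hypotheses (Qskew : Q + Q^T = 0) (Q1 : Q *m (const_mx 1 : 'cV[R]_N) = 0).
Implicit Types (a v : 'I_N -> 'rV[R]_n).

Lemma discrete_entropy_conservation m v : (forall i, A (v i)) ->
  \sum_i dot (grad U (v i)) (2 *: \sum_j Q i j *: fnum m (v i) (v j)) = 0.
Proof.
move=> Av; have [_ fsym _ fE] := ec m.
rewrite (symmetric_flux_sum Qskew); last by move=> i j; exact: fsym.
apply: (entropy_conservative_sum Qskew Q1 (psi := fun i => potential f U F m (v i))).
by move=> i j; exact: fE.
Qed.

Lemma discrete_flux_expansion m a v :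
  (forall i, A (a i)) -> (forall i, A (v i)) ->
  \sum_i dot (grad U (a i)) (2 *: \sum_j Q i j *: fnum m (v i) (v j)) =
  - \sum_i dot ((v i - a i) *m hess U (a i))
               (2 *: \sum_j Q i j *: fnum m (a i) (a j)) +
  \sum_i \sum_j dot (grad U (a i) - grad U (a j))
    (Q i j *: taylor_remainder fnum m (a i) (a j) (v i) (v j)).
Proof.
move=> Aa Av; have [_ fsym _ fE] := ec m.
rewrite (symmetric_flux_sum Qskew); last by move=> i j; exact: fsym.
pose l i j := 'D_(v i - a i) (fun x => fnum m x (a j)) (a i).
have fexp i j : fnum m (v i) (v j) = fnum m (a i) (a j) + (l i j + l j i) +
    taylor_remainder fnum m (a i) (a j) (v i) (v j).
  have dl := differentiable_flux_l oA ec m (Aa i) (Aa j).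
  have dr : differentiable (fun x => fnum m (a i) x) (a j).
    exact: (differentiable_joint_r (differentiable_flux2 oA ec m (Aa i) (Aa j))).
  have E1 : 'd (fun x => fnum m x (a j)) (a i) (v i - a i) = l i j.
    by rewrite -(deriveE _ dl).
  (* Symmetry of the flux turns the derivative in the second argument into one in the first with the
     nodes exchanged, which produces the shape [l i j + l j i]. *)
  have E2 : 'd (fun x => fnum m (a i) x) (a j) (v j - a j) = l j i.
    rewrite -(deriveE _ dr).
    exact: (derive_flux_sym oA ec m (v j - a j) (Aa i) (Aa j)).
  have -> : taylor_remainder fnum m (a i) (a j) (v i) (v j) =
      fnum m (v i) (v j) - fnum m (a i) (a j) - l i j - l j i.
    exact: (congr2 (fun x y => fnum m (v i) (v j) - fnum m (a i) (a j) - x - y) E1 E2).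
  have zE (V : zmodType) (x y b c : V) : x = y + (b + c) + (x - y - b - c).
    by rewrite -[x - y - b - c]addrA -opprD -[x - y - _]addrA -opprD [RHS]addrC subrK.
  exact: zE.
have -> : \sum_i \sum_j Q i j * dot (grad U (a i) - grad U (a j)) (fnum m (v i) (v j)) =
  \sum_i \sum_j Q i j * dot (grad U (a i) - grad U (a j)) (fnum m (a i) (a j)) +
  \sum_i \sum_j Q i j * dot (grad U (a i) - grad U (a j)) (l i j + l j i) +
  \sum_i \sum_j dot (grad U (a i) - grad U (a j))
    (Q i j *: taylor_remainder fnum m (a i) (a j) (v i) (v j)).
  rewrite -!big_split/=; apply: eq_bigr => i _; rewrite -!big_split/=.
  apply: eq_bigr => j _; rewrite (fexp i j).
  by rewrite dotZr !dotDr !mulrDr.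
rewrite (entropy_conservative_sum Qskew Q1 (psi := fun i => potential f U F m (a i))).
  rewrite add0r; congr (_ + _).
  apply: (@linearized_sum _ _ _ _ Qskew Q1 _ _ _ _ (fun i => f m (a i))).
  by move=> i j; exact: (entropy_conservative_diff oA f1 UF ec m (v i - a i) (Aa i) (Aa j)).
by move=> i j; exact: fE.
Qed.

End DiscreteEntropyBalance.

(** * Consistency *)

Section QuadraticBounds.
Context (R : realType) (n : nat).
Implicit Types (v w : 'rV[R]_n) (B : 'M[R]_n).

Lemma bilinear_bound (c : R) B v w : 0 <= c -> (forall k l, `|B k l| <= c) ->
  `|dot (v *m B) w| <= c * ((\sum_k `|v 0 k|) * \sum_l `|w 0 l|).
Proof.
move=> c0 Bc; rewrite dotE (le_trans (ler_norm_sum _ _ _))//.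
rewrite mulrCA mulr_sumr mulr_sumr ler_sum// => l _.
rewrite normrM mulrA ler_wpM2r//.
rewrite mxE (le_trans (ler_norm_sum _ _ _))// mulr_suml ler_sum// => k _.
by rewrite normrM ler_wpM2l.
Qed.

(** Young's inequality in each coordinate; with [b] equal to [h ^+ p] it separates the error from
    the consistency order. *)
Lemma sum_norm_mul v (b : R) : (\sum_k `|v 0 k|) * b <= n%:R * (dot v v + b ^+ 2).
Proof.
rewrite mulr_suml; apply: ler_sum_const => k.
rewrite (@le_trans _ _ (`|v 0 k| ^+ 2 + b ^+ 2))//.
  have := sqr_ge0 (`|v 0 k| - b); have := sqr_ge0 `|v 0 k|; have := sqr_ge0 b.
  rewrite sqrrB; set x := `|v 0 k| ^+ 2; set y := b ^+ 2; set z := `|v 0 k| * b.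
  by rewrite -mulr_natr => *; lra.
by rewrite lerD2r real_normK ?num_real// sqr_coord_le_dot.
Qed.

Lemma sum_norm_sqr v : (\sum_k `|v 0 k|) ^+ 2 <= (n * n)%:R * dot v v.
Proof.
rewrite expr2 mulr_suml natrM -mulrA; apply: ler_sum_const => k.
rewrite mulr_sumr; apply: ler_sum_const => l.
have := sqr_ge0 (`|v 0 k| - `|v 0 l|).
have := sqr_coord_le_dot v k; have := sqr_coord_le_dot v l.
rewrite sqrrB !real_normK ?num_real// -mulr_natr; lra.
Qed.

End QuadraticBounds.

Lemma mass_sbpD (R : realType) (d : nat) (D : discretization R d) m
    (x : 'cV[R]_(nnodes D)) i :
  (forall i, 0 < mass D 0 i) ->
  mass D 0 i * (sbpD D m *m x) i 0 = \sum_j sbpQ D m i j * x j 0.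
Proof.
move=> m0; have Mu : massM D \in unitmx.
  rewrite unitmxE det_diag unitfE; apply/prodf_neq0 => j _.
  by rewrite gt_eqF.
have : massM D *m (sbpD D m *m x) = sbpQ D m *m x.
  by rewrite /sbpD -mulmxA mulmxA mulmxV// mul1mx.
by move=> /matrixP/(_ i 0); rewrite mul_diag_mx !mxE.
Qed.

(** * Constants independent of the mesh *)

Section Constants.
Context (R : realType) (d n p : nat) (L T : R) (A K : set 'rV[R]_n).
Context (f : 'I_d -> 'rV[R]_n -> 'rV[R]_n) (s u : R -> 'rV[R]_d -> 'rV[R]_n).
Context (U : 'rV[R]_n -> R) (F : 'I_d -> 'rV[R]_n -> R).
Context (fnum : 'I_d -> 'rV[R]_n -> 'rV[R]_n -> 'rV[R]_n).
Hypotheses (L0 : 0 < L) (T0 : 0 < T) (oA : open A).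
Hypotheses (f1 : forall m, Ck 1 A (f m)) (UF : entropy_pair A f U F).
Hypotheses (uS : smooth_solution L T p A f s u).
Hypotheses (adm : admissible_states T A U s u K).
Hypotheses (sB : bounded_continuous_source L T s).
Hypotheses (ec : entropy_conservative p A f U F fnum).

Let U2 : Ck 2 A U. Proof. by case: UF. Qed.
Let cK : compact K. Proof. by case: adm. Qed.
Let vK : convex_set K. Proof. by case: adm. Qed.
Let KA : K `<=` A. Proof. by case: adm. Qed.

Lemma smooth_solution_in t x : 0 <= t <= T -> K (u t x).
Proof.
move=> tT; have [_ _ _ SK _] := adm.
have : nbhs (u t x) K by apply: SK; exists (t, x) => //=; split=> //=; rewrite in_itv.
exact: nbhs_singleton.
Qed.

(** Compactness of the set of values of [u], in its near-covering form, turns the neighborhoods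
    contained in [K] into a single radius. The interior of [K] is recorded because [Ck 3 K] provides
    actual derivatives only there. *)
Lemma tube_radius : exists2 r : R, 0 < r & forall t x (b : 'rV[R]_n), 0 <= t <= T ->
  (forall k, `|b 0 k - u t x 0 k| <= r) -> K° b.
Proof.
have [_ _ _ SK _] := adm; have [uL _ uk _] := uS.
pose box := `[0, T]%classic `*` [set y : 'rV[R]_d | forall m, 0 <= y 0 m <= L].
have cbox : compact box.
  apply: compact_setX; first exact: segment_compact.
  have := @rV_compact R d (fun=> `[0, L]%classic) (fun=> @segment_compact R 0 L).
  congr compact; apply/seteqP; split=> y Hy m; have := Hy m; rewrite /= in_itv/=;
    by rewrite (_ : ord0 = 0).
have sub : box `<=` @slab R d T by move=> [t y] [].
have cS := continuous_compact (continuous_subspaceW sub (Ck_continuous_within uk)) cbox.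
have nb (y : 'rV[R]_n) : [set (fun tx : R * 'rV[R]_d => u tx.1 tx.2) tx | tx in box] y ->
    \forall x' \near y & r \near 0^'+, forall b, `|b - x'| <= r -> K° b.
  move=> [tx /sub txS <-].
  have : nbhs (u tx.1 tx.2) K by apply: SK; exists tx.
  move=> /nbhs_interior/nbhs_ballP[e /= e0 He].
  exists (ball (u tx.1 tx.2) (e / 2), [set r | r < e / 2]); last first.
    move=> [x' r] [/= xe re] b br; apply: He.
    rewrite -ball_normE /ball_/= -(subrKA x') (le_lt_trans (ler_normD _ _))//.
    move: xe; rewrite -ball_normE /ball_/= => xe.
    by rewrite (splitr e) ltrD// distrC (le_lt_trans br).
  split; first by apply: nbhsx_ballx; rewrite divr_gt0.
  by apply: nbhs_right_lt; rewrite divr_gt0.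
have := (compact_near_coveringP _).1 cS R 0^'+ _ _ nb.
move=> /(_ _) near_r; have : \forall r \near 0^'+, 0 < r :> R by exact: nbhs_right_gt.
move=> near0; have [r [Hr r0]] := @filter_ex _ 0^'+ _ _ (filterI near_r near0).
exists r => // t x b tT bu.
have [y yL yE] := torus_representative x L0.
have tI : t \in `[0, T] by rewrite in_itv.
apply: (Hr (u t x)); last by apply: rV_norm_le => [|k]; [exact: ltW | rewrite !mxE].
by exists (t, y); [split=> //=; rewrite in_itv | rewrite /= yE//; exact: uL].
Qed.

Lemma hess_bound : exists2 c : R, 0 <= c & forall b, K b -> forall k l, `|hess U b k l| <= c.
Proof.
have [||c c0 Hc] := @fin_bound R ('I_n * 'I_n)%type
    (fun kl c => forall b, K b -> `|hess U b kl.1 kl.2| <= c).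
- by move=> kl c c' cc' H b /H /le_trans; apply.
- move=> [k l] /=.
  have Ukl := Ck_derive (e_ R k) oA (Ck_derive (e_ R l) oA U2).
  have [c _ Hc] := compact_norm_bound cK (continuous_subspaceW KA (Ck_continuous_within Ukl)).
  by exists c => b /Hc; rewrite mxE.
by exists c => // b Kb k l; exact: Hc (k, l) b Kb.
Qed.

Lemma third_derivative_bound : Ck 3 K U ->
  exists2 c : R, 0 <= c & forall b, K° b -> forall l i j, `|hess ('D_(e_ R l) U) b i j| <= c.
Proof.
move=> U3.
(* The invariant is that [g] extends to [K] the function [g'] known on the interior; it passes to
   derivatives, and after three of them compactness of [K] bounds the extension. *)
have ext k (g g' : 'rV[R]_n -> R) v : Ck k.+1 K g -> (forall b, K° b -> g' b = g b) ->
    exists2 h, Ck k K h & forall b, K° b -> 'D_v g' b = h b.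
  move=> [_ [_ /(_ v)[h hk hE]]] gg'; exists h => // b Kb; rewrite -hE//.
  apply: near_eq_derive; near=> y; apply: gg'; near: y.
  by apply: open_nbhs_nbhs; split=> //; exact: open_interior.
have [||c c0 Hc] := @fin_bound R ('I_n * ('I_n * 'I_n))%type
    (fun k c => forall b, K° b -> `|hess ('D_(e_ R k.1) U) b k.2.1 k.2.2| <= c).
- by move=> k c c' cc' H b /H /le_trans; apply.
- move=> [l [i j]] /=.
  have [g1 g1k g1E] := ext _ _ _ (e_ R l) U3 (fun=> fun=> erefl).
  have [g2 g2k g2E] := ext _ _ _ (e_ R j) g1k g1E.
  have [g3 g3k g3E] := ext _ _ _ (e_ R i) g2k g2E.
  have [c _ Hc] := compact_norm_bound cK (Ck_continuous_within g3k).
  exists c => b Kb; rewrite mxE -[X in `|X|]/('D_(e_ R i) ('D_(e_ R j) ('D_(e_ R l) U)) b).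
  by rewrite g3E//; apply: Hc; exact: interior_subset.
by exists c => // b Kb l i j; exact: Hc (l, (i, j)) b Kb.
Unshelve. all: by end_near. Qed.

Lemma source_bound : exists2 c : R, 0 <= c & forall t x, 0 <= t <= T ->
  forall k, `|s t x 0 k| <= c.
Proof.
have [_ _ [M [_ HM]]] := sB; exists (`|M| + 1); first by rewrite addr_ge0.
move=> t x tT k; apply: le_trans (norm_coord_le _ _ _) _.
apply: (HM (`|M| + 1) _ (t, x)); first by rewrite ltr_pwDr// ler_norm.
by split=> //=; rewrite in_itv.
Qed.

(* The quadratic Taylor bound on the entropy variables is only needed, and only
   available, when the source does not vanish identically. *)
Lemma source_taylor_bound (r : R) : 0 < r ->
  (forall t x (b : 'rV[R]_n), 0 <= t <= T -> (forall k, `|b 0 k - u t x 0 k| <= r) -> K° b) ->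
  exists2 c : R, 0 <= c & forall t x (b : 'rV[R]_n), 0 <= t <= T ->
    (forall k, `|b 0 k - u t x 0 k| <= r) ->
    `|dot (grad U b - grad U (u t x) - (b - u t x) *m hess U (u t x)) (s t x)|
      <= c * dot (b - u t x) (b - u t x).
Proof.
move=> r0 tube.
have [s0|/contrapT snz] := pselect (~ exists tx : R * 'rV[R]_d,
    @slab R d T tx /\ s tx.1 tx.2 != 0).
  exists 0 => // t x b tT _; rewrite [s t x](_ : _ = 0) ?dot0r ?normr0 ?mul0r//.
  apply/eqP/negPn/negP => sn; apply: s0; exists (t, x).
  by split=> //; rewrite /slab /=; split=> //=; rewrite in_itv.
have [_ _ _ _ [_ /(_ snz) U3]] := adm.
have [c c0 Hc] := third_derivative_bound U3.
have [cs cs0 Hs] := source_bound.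
pose q := c * (n * n)%:R / 2.
have q0 : 0 <= q by rewrite divr_ge0// mulr_ge0.
exists (n%:R * (q * cs)); first by rewrite !mulr_ge0.
move=> t x b tT bu; set a := u t x in bu *; set e := b - a.
have Ka : K a by exact: smooth_solution_in.
(* The segment stays in the tube around [u t x], hence in the interior of [K], where the third
   derivatives are bounded. *)
have seg (th : R) : 0 <= th <= 1 -> K° (a + th *: e).
  move=> /andP[th0 th1]; apply: (tube t x) => // k.
  rewrite !mxE addrAC subrr add0r normrM ger0_norm//.
  by rewrite (le_trans _ (bu k))// ler_piMl.
rewrite dotE (le_trans (ler_norm_sum _ _ _))// -mulrA.
apply: ler_sum_const => l; rewrite normrM -mulrA (mulrC cs) mulrA ler_pM//; last exact: Hs.
have gl2 : Ck 2 K° ('D_(e_ R l) U) by exact: Ck_interior_derive U3.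
have := @taylor2_segment_norm R _ K° ('D_(e_ R l) U) a e
  (c * ((n * n)%:R * dot e e)) (@open_interior _ _) gl2 seg.
have -> : a + e = b by rewrite /e addrC subrK.
have -> : 'D_e ('D_(e_ R l) U) a = (e *m hess U a) 0 l.
  have dl : differentiable ('D_(e_ R l) U) a.
    exact: Ck_differentiable oA (Ck_derive _ oA U2) (KA Ka).
  rewrite derive_rV_sum//.
  by rewrite [RHS]mxE; apply: eq_bigr => k _; rewrite [hess U a k l]mxE.
move=> H; have {H} : `|'D_(e_ R l) U b - 'D_(e_ R l) U a - (e *m hess U a) 0 l| <=
    c * ((n * n)%:R * dot e e) / 2.
  apply: H => th /seg Kth.
  rewrite (derive2_hess (@open_interior _ _) gl2)//.
  apply: le_trans (bilinear_bound _ _ c0 (Hc _ Kth l)) _.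
  by rewrite ler_wpM2l// -expr2 sum_norm_sqr.
have -> : (grad U b - grad U a - e *m hess U a) 0 l =
    'D_(e_ R l) U b - 'D_(e_ R l) U a - (e *m hess U a) 0 l by rewrite !mxE.
by move=> /le_trans; apply; rewrite /q le_eqVlt; apply/orP; left; apply/eqP; ring.
Qed.

(** The parameter is a pair of a time and a frozen first state in [K], so a single bound serves
    every node at every interior time. *)
Lemma flux_along_solution_smooth m k :
  unif_Ck p.+1 [set z : R * 'rV[R]_n | 0 < z.1 < T /\ K z.2]
    (fun z y => fnum m z.2 (u z.1 y) 0 k).
Proof.
have [uL _ uk _] := uS; have [fk _ _ _] := ec m.
have oAA : open (A `*` A) by exact: open_setX.
have uU := unif_Ck_slab L0 uk.
have {}uU : unif_Ck p.+1 [set t | 0 < t < T] (fun t y => u t y).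
  apply: uU => t /andP[/ltW t0 /ltW tT]; apply: uL; rewrite in_itv/=.
  by rewrite t0.
have uZ := unif_Ck_reparam (P' := [set z : R * 'rV[R]_n | 0 < z.1 < T /\ K z.2])
  (phi := fst) (fun z Pz => Pz.1) uU.
have := @unif_Ck_comp R _ _ n p.+1 _ A K (fun ab => fnum m ab.1 ab.2 0 k) snd
  (fun z y => u z.1 y) oA cK KA (Ck_coord k fk).
apply => //; first by move=> z [].
by move=> z x [/andP[/ltW z0 /ltW zT] _]; apply: smooth_solution_in; rewrite z0.
Qed.

Context (H : set R) (Dh : R -> discretization R d).
Hypotheses (H0 : H `<=` [set h : R | 0 < h]) (sbp : sbp_family L p H Dh).

(** For a fixed node the sum over [j] is the mass times the SBP derivative of [g], the flux with its
    first argument frozen at that node. By [derive_flux_comp] twice the derivative of [g] there is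
    the exact one, and the norm of [g] is bounded independently of node, time and mesh. *)
Lemma truncation_error : exists2 c : R, 0 <= c &
  forall h, H h -> forall t, 0 < t < T -> forall m (i : 'I_(nnodes (Dh h))) k,
    `|(2 *: \sum_j sbpQ (Dh h) m i j *: fnum m (u t (node i)) (u t (node j))) 0 k -
      mass (Dh h) 0 i * 'D_(e_ R m) (fun y => f m (u t y)) (node i) 0 k|
    <= mass (Dh h) 0 i * (c * h ^+ p).
Proof.
have [cM [CM [cN [CN [CD [/andP[cM0 cMCM] _ CD0 sbpP]]]]]] := sbp.
have [||c c0 Hc] := @fin_bound R ('I_d * 'I_n)%type (fun mk c =>
    forall z : R * 'rV[R]_n, 0 < z.1 < T /\ K z.2 ->
    Ck_norm p.+1 (fun y => fnum mk.1 z.2 (u z.1 y) 0 mk.2) <= c).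
- by move=> mk c c' cc' Hc z /Hc /le_trans; apply.
- move=> [m k]; have [c _ Hc] := unif_Ck_norm (flux_along_solution_smooth m k).
  by exists c => z /Hc.
exists (2 * (CD * c)); first by rewrite !mulr_ge0// ltW.
move=> h Hh t tT m i k.
have h0 : 0 < h by exact: H0.
have [Hm _ _ _ HD] := sbpP h Hh.
have m0 j : 0 < mass (Dh h) 0 j.
  by have /andP[+ _] := Hm j; apply: lt_le_trans; rewrite mulr_gt0// exprn_gt0.
have tT' : 0 <= t <= T by case/andP: tT => /ltW -> /ltW ->.
have [uL _ uk _] := uS.
pose a := u t (node i); have Ka : K a by exact: smooth_solution_in.
pose g y := fnum m a (u t y) 0 k.
have gk : Ck p.+1 setT g.
  exact: (unif_Ck_Ck (z := (t, a)) (flux_along_solution_smooth m k)).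
have gL : torus_periodic L g.
  by move=> l y; rewrite /g uL// in_itv.
have := HD g gL gk m i.
have -> : 'D_(e_ R m) (fun y => f m (u t y)) (node i) 0 k = 2 * 'D_(e_ R m) g (node i).
  have du : differentiable (u t) (node i).
    have dU : differentiable (fun tx => u tx.1 tx.2) (t, node i).
      by apply: uk.2.1; exact: slab_interior.
    exact: (differentiable_joint_r dU).
  rewrite (derive_flux_comp oA f1 ec m _ (KA Ka) du) mxE; congr (_ * _).
  rewrite /g (@derive_coord _ _ _ (fun y => fnum m a (u t y)))//.
  apply: diff_derivable; apply: (@differentiable_comp R _ _ _ (u t) (fnum m a)) => //.
  exact: (differentiable_joint_r (differentiable_flux2 oA ec m (KA Ka) (KA Ka))).
have -> : (2 *: \sum_j sbpQ (Dh h) m i j *: fnum m (u t (node i)) (u t (node j))) 0 k =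
    2 * (mass (Dh h) 0 i * (sbpD (Dh h) m *m grid (Dh h) g) i 0).
  rewrite mass_sbpD// mxE summxE; congr (_ * _).
  by apply: eq_bigr => j _; rewrite !mxE.
set x := (_ *m _) i 0; set y := 'D_(e_ R m) g (node i) => Hxy.
have -> : 2 * (mass (Dh h) 0 i * x) - mass (Dh h) 0 i * (2 * y) =
    mass (Dh h) 0 i * (2 * (x - y)) by ring.
rewrite normrM (gtr0_norm (m0 i)) ler_pM2l// normrM ger0_norm// -!mulrA ler_pM2l//.
apply: le_trans Hxy _; rewrite -mulrA ler_pM2l// mulrC ler_wpM2r//; last exact: (Hc (m, k) (t, a)).
by rewrite exprn_ge0// ltW.
Qed.

End Constants.

(** * Rate of change of the relative entropy *)

Section EntropyRate.
Context (R : realType) (d n p : nat) (A : set 'rV[R]_n).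
Context (f : 'I_d -> 'rV[R]_n -> 'rV[R]_n).
Context (U : 'rV[R]_n -> R) (F : 'I_d -> 'rV[R]_n -> R).
Context (fnum : 'I_d -> 'rV[R]_n -> 'rV[R]_n -> 'rV[R]_n).
Hypotheses (oA : open A) (f1 : forall m, Ck 1 A (f m)).
Hypotheses (UF : entropy_pair A f U F) (ec : entropy_conservative p A f U F fnum).

Let U2 : Ck 2 A U. Proof. by case: UF. Qed.

(** Pure algebra: the left-hand side is the time derivative of the relative entropy, with [da] and
    [dv] eliminated through the balance law and the scheme. The right-hand side separates source,
    truncation error and quadratic flux remainder. *)
Lemma entropy_rate_identity (N : nat) (Q : 'I_d -> 'M[R]_N) (mu : 'I_N -> R)
    (a v da dv src : 'I_N -> 'rV[R]_n) (g : 'I_d -> 'I_N -> 'rV[R]_n) :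
  (forall m, Q m + (Q m)^T = 0) ->
  (forall m, Q m *m (const_mx 1 : 'cV[R]_N) = 0) ->
  (forall i, A (a i)) -> (forall i, A (v i)) ->
  (forall i, mu i *: dv i + \sum_(m < d) 2 *: \sum_j Q m i j *: fnum m (v i) (v j) =
    mu i *: src i) ->
  (forall i, da i + \sum_(m < d) g m i = src i) ->
  \sum_i mu i * (dot (grad U (v i)) (dv i) - dot (grad U (a i)) (da i) -
    (dot (da i *m hess U (a i)) (v i - a i) + dot (grad U (a i)) (dv i - da i))) =
  \sum_i mu i * dot (grad U (v i) - grad U (a i) - (v i - a i) *m hess U (a i)) (src i)
  - \sum_(m < d) \sum_i dot ((v i - a i) *m hess U (a i))
      (2 *: \sum_j Q m i j *: fnum m (a i) (a j) - mu i *: g m i)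
  + \sum_(m < d) \sum_i \sum_j dot (grad U (a i) - grad U (a j))
      (Q m i j *: taylor_remainder fnum m (a i) (a j) (v i) (v j)).
Proof.
move=> Qskew Q1 Aa Av Hv Ha.
pose G m i (w : 'I_N -> 'rV[R]_n) := 2 *: \sum_j Q m i j *: fnum m (w i) (w j).
pose e i := v i - a i; pose k i := e i *m hess U (a i).
have termE i : mu i * (dot (grad U (v i)) (dv i) - dot (grad U (a i)) (da i) -
    (dot (da i *m hess U (a i)) (v i - a i) + dot (grad U (a i)) (dv i - da i))) =
    mu i * dot (grad U (v i) - grad U (a i) - k i) (src i) -
    \sum_(m < d) dot (grad U (v i)) (G m i v) +
    (\sum_(m < d) dot (grad U (a i)) (G m i v) +
     \sum_(m < d) dot (k i) (mu i *: g m i)).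
  have muv : mu i *: dv i = mu i *: src i - \sum_(m < d) G m i v by rewrite -Hv addrK.
  have dvE w : mu i * dot w (dv i) = mu i * dot w (src i) - \sum_(m < d) dot w (G m i v).
    by rewrite -dotZr muv dotBr dotZr dot_sumr.
  have daE w : dot w (da i) = dot w (src i) - \sum_(m < d) dot w (g m i).
    by rewrite -Ha -dot_sumr -dotBr addrK.
  have -> : \sum_(m < d) dot (k i) (mu i *: g m i) = mu i * \sum_(m < d) dot (k i) (g m i).
    by rewrite mulr_sumr; apply: eq_bigr => m _; rewrite dotZr.
  (* The two terms [dot (grad U (a i)) (da i)] cancel, so after this exchange [da i] is tested with
     [k i] only, and the source contributions combine into one test vector. *)
  rewrite (hess_sym oA U2 _ _ (Aa i)) -/(e i) -/(k i) (daE (k i)) dotBr !dotBl.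
  have := dvE (grad U (v i)); have := dvE (grad U (a i)) => E1 E2.
  move: E1 E2; lra.
rewrite (eq_bigr _ (fun i _ => termE i)) !big_split/= sumrN.
rewrite exchange_big/= [X in _ - X]big1 ?subr0; last first.
  by move=> m _; exact: (discrete_entropy_conservation ec (Qskew m) (Q1 m) m Av).
rewrite -addrA; congr (_ + _).
rewrite exchange_big/= [X in _ + X]exchange_big/= -big_split -sumrN -big_split/=.
apply: eq_bigr => m _.
rewrite /G (discrete_flux_expansion oA f1 UF ec (Qskew m) (Q1 m) m Aa Av).
have -> : \sum_i dot (k i) (2 *: \sum_j Q m i j *: fnum m (a i) (a j) - mu i *: g m i) =
   \sum_i dot (k i) (2 *: \sum_j Q m i j *: fnum m (a i) (a j)) -
   \sum_i dot (k i) (mu i *: g m i).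
  by rewrite -sumrB; apply: eq_bigr => i _; rewrite dotBr.
by rewrite -/(e _) -/(k _); ring.
Qed.

Lemma is_derive_rel_entropy (D : discretization R d) (u : R -> 'rV[R]_d -> 'rV[R]_n)
    (v : R -> 'I_(nnodes D) -> 'rV[R]_n) (t : R) (da dv : 'I_(nnodes D) -> 'rV[R]_n) :
  (forall i : 'I_(nnodes D), A (u t (node i))) -> (forall i, A (v t i)) ->
  (forall i : 'I_(nnodes D), is_derive t (1 : R) (fun t => u t (node i)) (da i)) ->
  (forall i, is_derive t (1 : R) (v^~ i) (dv i)) ->
  is_derive t (1 : R) (fun t => rel_entropy U (u t) (v t))
   (\sum_i mass D 0 i * (dot (grad U (v t i)) (dv i) - dot (grad U (u t (node i))) (da i) -
    (dot (da i *m hess U (u t (node i))) (v t i - u t (node i)) +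
     dot (grad U (u t (node i))) (dv i - da i)))).
Proof.
move=> Aa Av Da Dv.
have D1 i : is_derive t (1 : R) (fun t => U (v t i)) (dot (grad U (v t i)) (dv i)).
  rewrite -derive_grad_dot; last exact: differentiable_entropy oA U2 _ (Av i).
  apply: (@is_derive_comp_curve R _ _ U (v^~ i)) => //.
  exact: differentiable_entropy oA U2 _ (Av i).
have D2 (i : 'I_(nnodes D)) : is_derive t (1 : R) (fun t => U (u t (node i)))
    (dot (grad U (u t (node i))) (da i)).
  rewrite -derive_grad_dot; last exact: differentiable_entropy oA U2 _ (Aa i).
  apply: (@is_derive_comp_curve R _ _ U (fun t => u t (node i))) => //.
  exact: differentiable_entropy oA U2 _ (Aa i).
have D3 (i : 'I_(nnodes D)) : is_derive t (1 : R) (fun t => grad U (u t (node i)))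
    (da i *m hess U (u t (node i))).
  rewrite -(derive_grad oA U2 _ (Aa i)).
  apply: (@is_derive_comp_curve R _ _ (grad U) (fun t => u t (node i))) => //.
  exact: differentiable_grad oA U2 _ (Aa i).
have D4 (i : 'I_(nnodes D)) : is_derive t (1 : R) (fun t => v t i - u t (node i)) (dv i - da i).
  by have ? := Da i; have ? := Dv i; exact: is_deriveB.
have D5 i := is_derive_dot (D3 i) (D4 i).
have D6 i := @is_deriveB R R R _ _ t 1 _ _ (@is_deriveB R R R _ _ t 1 _ _ (D1 i) (D2 i)) (D5 i).
have D7 i := @is_deriveZ R R R _ (mass D 0 i) t 1 _ (D6 i).
have -> : (fun t => rel_entropy U (u t) (v t)) =
  \sum_(i < nnodes D) (mass D 0 i \*: ((fun t => U (v t i)) - (fun t => U (u t (node i))) -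
    (fun t => dot (grad U (u t (node i))) (v t i - u t (node i))))).
  apply/funext => x; rewrite /rel_entropy.
  by elim/big_rec2 : _ => // i y z _ ->.
exact: is_derive_sum.
Qed.

End EntropyRate.

(** * Continuity of the discrete quantities and uniqueness for Lipschitz systems *)

Lemma continuous_rV (R : realType) (S : topologicalType) (n : nat)
    (c : S -> 'rV[R]_n) (x : S) :
  (forall k, {for x, continuous (fun y => c y 0 k : R)}) -> {for x, continuous c}.
Proof.
move=> cc; apply/cvgrPdist_le => e e0.
have nk k : \forall y \near x, `|c x 0 k - c y 0 k| <= e.
  by have /cvgrPdist_le := cc k; exact.
have : \forall y \near x, forall k, `|c x 0 k - c y 0 k| <= e by exact: filter_forall nk.
apply: filterS => y Hy; apply: rV_norm_le; first exact: ltW.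
by move=> k; rewrite !mxE.
Qed.

Lemma continuous_bigsum (R : realType) (S : topologicalType) (W : normedModType R)
    (I : Type) (r : seq I) (g : I -> S -> W) :
  (forall i, continuous (g i)) -> continuous (fun y => \sum_(i <- r) g i y).
Proof.
move=> cg; elim: r => [|i r IH] x.
  have -> : (fun y => \sum_(i <- [::]) g i y) = cst 0 by apply/funext => y; rewrite big_nil.
  exact: cvg_cst.
have -> : (fun y => \sum_(j <- i :: r) g j y) = g i + (fun y => \sum_(j <- r) g j y).
  by apply/funext => y; rewrite big_cons.
by apply: cvgD; [exact: cg | exact: IH].
Qed.

Lemma is_derive_bigsum (R : realType) (V W : normedModType R) (I : Type) (r : seq I)
    (g : I -> V -> W) (dg : I -> W) (x v : V) :
  (forall i, is_derive x v (g i) (dg i)) ->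
  is_derive x v (fun y => \sum_(i <- r) g i y) (\sum_(i <- r) dg i).
Proof.
move=> Dg; elim: r => [|i r IH].
  have -> : (fun y => \sum_(i <- [::]) g i y) = cst 0 by apply/funext => y; rewrite big_nil.
  by rewrite big_nil; exact: is_derive_cst.
have -> : (fun y => \sum_(j <- i :: r) g j y) = g i + (fun y => \sum_(j <- r) g j y).
  by apply/funext => y; rewrite big_cons.
by rewrite big_cons; have ? := Dg i; exact: is_deriveD.
Qed.

(** Gronwall for the sum of squared differences [D], which is differentiable and starts from zero.
    Each coordinate difference is at most the square root of [D]; inserting this into the Lipschitz
    condition gives the rate [2 * C * #|I|]. *)
Lemma lipschitz_ode_unique (R : realType) (I : finType) (T C : R)
    (rhs : R -> (I -> R) -> I -> R) (x y : R -> I -> R) :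
  0 <= C ->
  (forall t x y (e : R) i, (forall j, `|x j - y j| <= e) ->
    `|rhs t x i - rhs t y i| <= C * e) ->
  (forall i, {within `[0, T], continuous (x^~ i)}) ->
  (forall i, {within `[0, T], continuous (y^~ i)}) ->
  (forall t i, 0 < t < T -> is_derive t (1 : R) (x^~ i) (rhs t (x t) i)) ->
  (forall t i, 0 < t < T -> is_derive t (1 : R) (y^~ i) (rhs t (y t) i)) ->
  (forall i, x 0 i = y 0 i) ->
  forall t i, 0 <= t <= T -> x t i = y t i.
Proof.
move=> C0 lip cx cy Dx Dy xy0 t i /andP[t0 tT].
pose D (t : R) := \sum_i (x t i - y t i) ^+ 2.
have D_ge0 s : 0 <= D s by apply: sumr_ge0 => j _; exact: sqr_ge0.
have leD s j : (x s j - y s j) ^+ 2 <= D s.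
  by rewrite /D (bigD1 j)//= lerDl sumr_ge0// => l _; exact: sqr_ge0.
have sub : `[0, t]%classic `<=` `[0, T]%classic by apply: subset_itvl; rewrite bnd_simp.
pose dD s := \sum_i 2 * (x s i - y s i) * (rhs s (x s) i - rhs s (y s) i).
have Dsum (s : R) : 0 < s < T -> is_derive s (1 : R) D (dD s).
  move=> sT; pose g j s := (x s j - y s j) ^+ 2.
  have Dg j : is_derive s (1 : R) (g j)
      (2 * (x s j - y s j) * (rhs s (x s) j - rhs s (y s) j)).
    have ? := Dx s j sT; have ? := Dy s j sT.
    have Dxy : is_derive s (1 : R) (x^~ j - y^~ j) (rhs s (x s) j - rhs s (y s) j).
      exact: is_deriveB.
    have := @is_deriveM R R _ _ s 1 _ _ Dxy Dxy.
    rewrite (_ : (x^~ j - y^~ j) * (x^~ j - y^~ j) = g j); last first.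
      by apply/funext => z; rewrite /g expr2.
    congr (is_derive _ _ _ _).
    rewrite -[LHS]/((x s j - y s j) * _ + (x s j - y s j) * _); ring.
  exact: (is_derive_bigsum _ Dg).
have cD : {within `[0, t], continuous D}.
  apply: (continuous_subspaceW sub); apply: continuous_bigsum => j s.
  have cxy : {within `[0, T], continuous (x^~ j - y^~ j)} by exact: within_continuousB.
  have := cvgM (cxy s) (cxy s).
  exact.
have := @gronwall R D dD (2 * C * #|I|%:R) 0 t t0 _ _ cD.
have D0 : D 0 = 0 by rewrite /D big1// => j _; rewrite xy0 subrr expr0n.
rewrite D0 mul0r addr0 mul0r => G.
have {G} : D t <= 0.
  apply: G => //; first by rewrite !mulr_ge0.
  - by move=> s /andP[s0 st]; apply: Dsum; rewrite s0 (lt_le_trans st).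
  - move=> s _; rewrite addr0 /dD.
    apply: le_trans (_ : \sum_(i : I) 2 * C * D s <= _); last first.
      by rewrite sumr_const [leRHS]mulrAC -[leLHS]mulr_natr.
    apply: ler_sum => j _.
    have sq l : `|x s l - y s l| <= Num.sqrt (D s).
      by rewrite -sqrtr_sqr ler_sqrt.
    rewrite (le_trans (ler_norm _))// !normrM ger0_norm// -!mulrA ler_pM2l//.
    have := lip s (x s) (y s) (Num.sqrt (D s)) j sq => Hlip.
    rewrite -[in leRHS](sqr_sqrtr (D_ge0 s)) expr2 mulrA (mulrC C).
    rewrite -mulrA ler_pM//.
move=> Dt; apply/eqP; rewrite -subr_eq0 -sqrf_eq0 eq_le sqr_ge0 andbT.
exact: le_trans (leD t i) Dt.
Qed.

Lemma within_slab_slice (R : realType) (d : nat) (T : R) (W : topologicalType)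
    (g : R -> 'rV[R]_d -> W) (x : 'rV[R]_d) :
  {within @slab R d T, continuous (fun tx => g tx.1 tx.2)} ->
  {within `[0, T], continuous (fun t => g t x)}.
Proof.
move=> cg; apply/subspace_continuousP => t tT.
have St : slab T (t, x) by split.
have /(subspace_continuousP _ _)/(_ _ St) cgt := cg.
move=> B /cgt HB.
have HB' : \forall y \near (t, x), slab T y -> B (g y.1 y.2) by exact: HB.
have cp : {for t, continuous (fun t : R => (t, x))}.
  exact: (cvg_pair (@cvg_id _ (nbhs t)) (cvg_cst x)).
have : \forall y \near t, slab T (y, x) -> B (g y x) by exact: (cp _ HB').
by apply: filterS => y Hy yT; apply: Hy; split.
Qed.

Lemma continuous_dot (R : realType) (S : topologicalType) (n : nat)
    (a b : S -> 'rV[R]_n) :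
  continuous a -> continuous b -> continuous (fun x => dot (a x) (b x)).
Proof.
move=> ca cb.
have -> : (fun x => dot (a x) (b x)) = fun x => \sum_k a x 0 k * b x 0 k.
  by apply/funext => x; rewrite dotE.
apply: continuous_bigsum => k x.
have cc (c : S -> 'rV[R]_n) : continuous c -> {for x, continuous (fun y => c y 0 k : R)}.
  move=> cc; apply: (@continuous_comp _ _ _ c (fun y : 'rV[R]_n => y 0 k) x (cc x)).
  exact: coord_continuous.
exact: (cvgM (cc a ca) (cc b cb)).
Qed.

Lemma within_continuous_rel_entropy (R : realType) (d n : nat) (A : set 'rV[R]_n)
    (U : 'rV[R]_n -> R) (D : discretization R d) (S : set R)
    (u : R -> 'rV[R]_d -> 'rV[R]_n) (v : R -> 'I_(nnodes D) -> 'rV[R]_n) :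
  open A -> Ck 2 A U ->
  (forall (i : 'I_(nnodes D)) t, S t -> A (u t (node i)) /\ A (v t i)) ->
  (forall i : 'I_(nnodes D), {within S, continuous (fun t => u t (node i))}) ->
  (forall i, {within S, continuous (v^~ i)}) ->
  {within S, continuous (fun t => rel_entropy U (u t) (v t))}.
Proof.
move=> oA U2 Auv cu cv; rewrite /rel_entropy.
apply: (@continuous_bigsum R (subspace S) R^o) => i.
have comp (W : topologicalType) (c : R -> 'rV[R]_n) (g : 'rV[R]_n -> W) :
    (forall x, A x -> {for x, continuous g}) -> (forall t, S t -> A (c t)) ->
    {within S, continuous c} -> {within S, continuous (fun t => g (c t))}.
  move=> cg Ac; apply: (@within_continuous_comp _ _ _ _ c g).
  by move=> _ /set_mem[t St <-]; apply: cg; exact: Ac.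
have Av t : S t -> A (v t i) by move=> /(Auv i)[].
have Au t : S t -> A (u t (node i)) by move=> /(Auv i)[].
have cUA x : A x -> {for x, continuous U} by exact: Ck_continuous oA U2.
have cUv := comp _ _ _ cUA Av (cv i).
have cUu := comp _ _ _ cUA Au (cu i).
have cgu := comp _ _ _ (fun x => @continuous_grad _ _ _ _ oA U2 x) Au (cu i).
have ce : {within S, continuous (fun t => v t i - u t (node i))}.
  by move=> t; exact: (cvgB (cv i t) (cu i t)).
have cd := continuous_dot cgu ce.
by move=> t; apply: cvgM (cvg_cst _) (cvgB (cvgB (cUv t) (cUu t)) (cd t)).
Qed.

(** * Bootstrap and convergence *)

Section Convergence.
Context (R : realType) (d n p : nat) (L T : R) (A K : set 'rV[R]_n).
Context (f : 'I_d -> 'rV[R]_n -> 'rV[R]_n) (s u : R -> 'rV[R]_d -> 'rV[R]_n).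
Context (U : 'rV[R]_n -> R) (F : 'I_d -> 'rV[R]_n -> R).
Context (fnum : 'I_d -> 'rV[R]_n -> 'rV[R]_n -> 'rV[R]_n).
Context (H : set R) (Dh : R -> discretization R d).
Hypotheses (L0 : 0 < L) (T0 : 0 < T) (oA : open A).
Hypotheses (f1 : forall m, Ck 1 A (f m)) (UF : entropy_pair A f U F).
Hypotheses (uS : smooth_solution L T p A f s u).
Hypotheses (adm : admissible_states T A U s u K).
Hypotheses (sB : bounded_continuous_source L T s).
Hypotheses (ec : entropy_conservative p A f U F fnum).
Hypotheses (H0 : H `<=` [set h : R | 0 < h]) (sbp : sbp_family L p H Dh).
Hypothesis srb : structural_remainder_bound T U fnum K u H Dh.

Let U2 : Ck 2 A U. Proof. by case: UF. Qed.
Let cK : compact K. Proof. by case: adm. Qed.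
Let vK : convex_set K. Proof. by case: adm. Qed.
Let KA : K `<=` A. Proof. by case: adm. Qed.
Let Ku t x : 0 <= t <= T -> K (u t x).
Proof. exact: (smooth_solution_in adm). Qed.

Definition in_tube (r : R) (D : discretization R d) (t : R)
    (v : 'I_(nnodes D) -> 'rV[R]_n) :=
  forall i k, `|v i 0 k - u t (node i) 0 k| <= r.

Definition sbp_equation (D : discretization R d) (t : R)
    (v : 'I_(nnodes D) -> 'rV[R]_n) i (dv : 'rV[R]_n) :=
  mass D 0 i *: dv
  + \sum_(m < d) 2 *: \sum_j sbpQ D m i j *: fnum m (v i) (v j)
  = mass D 0 i *: s t (node i).

Definition sqr_error (D : discretization R d) (t : R)
    (v : 'I_(nnodes D) -> 'rV[R]_n) : R :=
  \sum_i mass D 0 i * dot (v i - u t (node i)) (v i - u t (node i)).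

(** The number of nodes is of order [h^-d], so the total mass stays bounded and nodal errors of size
    [h^(2p)] sum up to the same order. *)
Lemma mass_bounds : exists c C : R, [/\ 0 < c, 0 <= C & forall h, H h ->
  (forall i, c * h ^+ d <= mass (Dh h) 0 i) /\ \sum_i mass (Dh h) 0 i <= C].
Proof.
have [cM [CM [cN [CN [CD [/andP[cM0 cMCM] _ _ sbpP]]]]]] := sbp.
have CM0 : 0 <= CM by rewrite (le_trans (ltW cM0)).
exists cM, (CM * `|CN|); split=> // [|h Hh]; first by rewrite mulr_ge0.
have [Hm /andP[_ HN] _ _ _] := sbpP h Hh.
split=> [i|]; first by have /andP[] := Hm i.
apply: le_trans (_ : \sum_(i < nnodes (Dh h)) CM * h ^+ d <= _).
  by apply: ler_sum => i _; have /andP[] := Hm i.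
rewrite sumr_const card_ord -[leLHS]mulr_natr -mulrA ler_wpM2l// mulrC.
by rewrite (le_trans HN)// ler_norm.
Qed.

Lemma mass_gt0 h i : H h -> 0 < mass (Dh h) 0 i.
Proof.
move=> Hh; have [c [C [c0 _ /(_ h Hh)[Hm _]]]] := mass_bounds.
by apply: lt_le_trans (Hm i); rewrite mulr_gt0// exprn_gt0//; exact: H0.
Qed.

Lemma sqr_error_ge0 h t v : H h -> 0 <= @sqr_error (Dh h) t v.
Proof.
move=> Hh; apply: sumr_ge0 => i _.
by rewrite mulr_ge0 ?dot_ge0// ltW// mass_gt0.
Qed.

Lemma rel_entropy_lower_bound : exists2 c : R, 0 < c &
  forall h, H h -> forall t (v : 'I_(nnodes (Dh h)) -> 'rV[R]_n), 0 <= t <= T ->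
  (forall i, K (v i)) -> c * sqr_error t v <= rel_entropy U (u t) v.
Proof.
have [_ _ _ _ [[cU [CU [cU0 _ HU]]] _]] := adm.
exists (cU / 2); first by rewrite divr_gt0.
move=> h Hh t v tT Kv; rewrite /sqr_error mulr_sumr; apply: ler_sum => i _.
rewrite mulrCA ler_pM2l ?mass_gt0//.
apply: (entropy_lower_bound oA U2 vK KA) => //; last exact: Ku.
by move=> x Kx w; have /andP[] := HU x Kx w.
Qed.

Lemma rel_entropy_rate (r : R) : 0 < r ->
  (forall t x (b : 'rV[R]_n), 0 <= t <= T ->
     (forall k, `|b 0 k - u t x 0 k| <= r) -> K° b) ->
  exists C1 C2 : R, [/\ 0 <= C1, 0 <= C2 &
  forall h, H h -> forall (v : R -> 'I_(nnodes (Dh h)) -> 'rV[R]_n) t, 0 < t < T ->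
  in_tube r t (v t) ->
  (forall i, exists2 dv, is_derive t (1 : R) (v^~ i) dv & sbp_equation t (v t) i dv) ->
  exists2 dE, is_derive t (1 : R) (fun t => rel_entropy U (u t) (v t)) dE &
    dE <= C1 * rel_entropy U (u t) (v t) + C2 * h ^+ p ^+ 2].
Proof.
move=> r0 tube.
have [c [C [c0 C0 Hmass]]] := mass_bounds.
have [cE cE0 HE] := rel_entropy_lower_bound.
have [Ct Ct0 Htau] := truncation_error L0 oA f1 uS adm ec H0 sbp.
have [Cs Cs0 Hs] := source_taylor_bound oA UF adm sB r0 tube.
have [CH CH0 HH] := hess_bound oA UF adm.
have [CR CR0 HR] := srb.
(* [CH] bounds the Hessian and [Ct] the truncation error; one factor [n] sums the components of the
   truncation error, the other comes from [sum_norm_mul]. *)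
pose q := CH * (n%:R * (n%:R * Ct)).
have q0 : 0 <= q by rewrite !mulr_ge0.
have dq0 : 0 <= d%:R * q by rewrite mulr_ge0.
(* The factor [d] sums the directions, division by [cE] passes from the squared error to the
   relative entropy, and [C] bounds the total mass. *)
exists ((Cs + d%:R * q) / cE + CR), (d%:R * q * C); split.
- by rewrite addr_ge0// divr_ge0 ?addr_ge0// ltW.
- by rewrite mulr_ge0.
move=> h Hh v t t0T vt Hv.
have /boolp.choice[dv Hdv] i : exists dv : 'rV[R]_n,
    is_derive t (1 : R) (v^~ i) dv /\ sbp_equation t (v t) i dv.
  by have [dv ? ?] := Hv i; exists dv.
have tT : 0 <= t <= T by case/andP: t0T => /ltW -> /ltW ->.
have tI : t \in `[0, T] by rewrite in_itv.
have m0 i : 0 < mass (Dh h) 0 i by exact: mass_gt0.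
have Kv i : K (v t i) by apply: interior_subset; apply: (tube t (node i)).
pose a (i : 'I_(nnodes (Dh h))) := u t (node i).
have Ka i : K (a i) by exact: Ku.
have /boolp.choice[da Hda] (i : 'I_(nnodes (Dh h))) : exists da : 'rV[R]_n,
    is_derive t (1 : R) (fun t => u t (node i)) da /\
    da + \sum_(m < d) 'D_(e_ R m) (fun y => f m (u t y)) (node i) = s t (node i).
  have [_ _ _ bal] := uS; have [ut Dut utE] := bal t (node i) tI.
  by exists ut; split=> //; exact: has_deriv_in_is_derive Dut.
have [cM [CM [cN [CN [CD [_ _ _ sbpP]]]]]] := sbp.
have [_ _ Qskew Q1 _] := sbpP h Hh.
pose e i := v t i - a i.
pose g m (i : 'I_(nnodes (Dh h))) := 'D_(e_ R m) (fun y => f m (u t y)) (node i).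
have Dent := is_derive_rel_entropy oA UF (fun i => KA (Ka i)) (fun i => KA (Kv i))
  (fun i => (Hda i).1) (fun i => (Hdv i).1).
rewrite (entropy_rate_identity oA f1 UF ec Qskew Q1 (fun i => KA (Ka i))
  (fun i => KA (Kv i)) (fun i => (Hdv i).2) (fun i => (Hda i).2)) in Dent.
apply: (ex_intro2 _ _ _ Dent).
have SE := HE h Hh t (v t) tT Kv.
set S := sqr_error t (v t) in SE; set E := rel_entropy U (u t) (v t) in SE *.
pose X := h ^+ p.
have X0 : 0 <= X by rewrite exprn_ge0// ltW//; exact: H0.
have B1 : \sum_i mass (Dh h) 0 i * dot (grad U (v t i) - grad U (a i) -
    (v t i - a i) *m hess U (a i)) (s t (node i)) <= Cs * S.
  rewrite /S /sqr_error mulr_sumr; apply: ler_sum => i _; rewrite mulrCA ler_pM2l//.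
  by apply: le_trans (ler_norm _) _; apply: Hs => // k; exact: vt.
have B2 m : - (\sum_i dot ((v t i - a i) *m hess U (a i))
    (2 *: \sum_j sbpQ (Dh h) m i j *: fnum m (a i) (a j) - mass (Dh h) 0 i *: g m i)) <=
    q * (S + C * X ^+ 2).
  apply: le_trans (_ : \sum_i mass (Dh h) 0 i * (q * (dot (e i) (e i) + X ^+ 2)) <= _).
    rewrite -sumrN; apply: ler_sum => i _; apply: le_trans (ler_norm _) _; rewrite normrN.
    apply: le_trans (bilinear_bound _ _ CH0 (HH _ (Ka i))) _.
    have Htl : \sum_l `|(2 *: \sum_j sbpQ (Dh h) m i j *: fnum m (a i) (a j) -
        mass (Dh h) 0 i *: g m i) 0 l| <= n%:R * (mass (Dh h) 0 i * (Ct * X)).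
      apply: ler_sum_const => l; have := Htau h Hh t t0T m i l.
      by congr (`|_| <= _); rewrite [RHS]mxE; congr (_ + _); rewrite [RHS]mxE [in RHS]mxE.
    have ve := sum_norm_mul (e i) X.
    have sum0 : 0 <= \sum_k `|(e i) 0 k| by apply: sumr_ge0.
    have := ler_wpM2l sum0 Htl => H1.
    apply: le_trans (ler_wpM2l CH0 H1) _.
    have k0 : 0 <= CH * (n%:R * (mass (Dh h) 0 i * Ct)).
      by rewrite mulr_ge0// mulr_ge0// mulr_ge0// ltW.
    have := ler_wpM2l k0 ve.
    rewrite /q -/(e i); set y := \sum_k _; set z := dot _ _ + _.
    have -> : CH * (y * (n%:R * (mass (Dh h) 0 i * (Ct * X)))) =
              CH * (n%:R * (mass (Dh h) 0 i * Ct)) * (y * X) by ring.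
    move=> /le_trans; apply; rewrite le_eqVlt; apply/orP; left; apply/eqP; ring.
  have -> : \sum_i mass (Dh h) 0 i * (q * (dot (e i) (e i) + X ^+ 2)) =
      q * (S + (\sum_i mass (Dh h) 0 i) * X ^+ 2).
    rewrite /S /sqr_error mulr_suml -big_split mulr_sumr; apply: eq_bigr => i _.
    by rewrite /= -/(e i); ring.
  rewrite ler_wpM2l// lerD2l ler_wpM2r ?sqr_ge0//.
  by have [] := Hmass h Hh.
have B3 := HR h Hh t tI (v t) Kv.
have B2' : - (\sum_(m < d) \sum_i dot ((v t i - a i) *m hess U (a i))
    (2 *: \sum_j sbpQ (Dh h) m i j *: fnum m (a i) (a j) - mass (Dh h) 0 i *: g m i)) <=
    d%:R * (q * (S + C * X ^+ 2)).
  by rewrite -sumrN; apply: ler_sum_const => m; exact: B2.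
have SE' : S <= E / cE by rewrite ler_pdivlMr// mulrC.
have B3' := le_trans (ler_norm _) B3.
have S0 : 0 <= S by exact: sqr_error_ge0.
apply: le_trans (lerD (lerD B1 B2') B3') _.
rewrite -/E -/X; have := ler_wpM2l (addr_ge0 Cs0 dq0) SE'.
by rewrite mulrDl; lra.
Qed.


Lemma within_continuous_coord (S : set R) (c : R -> 'rV[R]_n) k :
  {within S, continuous c} -> {within S, continuous (fun t => c t 0 k : R)}.
Proof.
move=> cc; apply: (@within_continuous_comp _ _ _ _ c (fun y : 'rV[R]_n => y 0 k)) cc.
by move=> y _; exact: coord_continuous.
Qed.

Context (v0 : forall h : R, 'I_(nnodes (Dh h)) -> 'rV[R]_n) (C0 : R).
Hypotheses (pd : d%:R / 2 < p%:R :> R) (C0_ge0 : 0 <= C0).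
Hypothesis init : forall h, H h -> (forall i, K (@v0 h i)) /\
  Num.sqrt (rel_entropy U (u 0) (@v0 h)) <= C0 * h ^+ p.

(* The masses are of order [h^d], whereas [h^(2p) <= h^d * h] because [2p > d]. *)
Lemma sqr_coord_error_bound : exists2 c : R, 0 < c & forall h, H h -> h <= 1 ->
  forall (C : R) t (v : 'I_(nnodes (Dh h)) -> 'rV[R]_n), 0 <= C -> 0 <= t <= T ->
  (forall i, K (v i)) -> rel_entropy U (u t) v <= C * h ^+ p ^+ 2 ->
  forall i k, c * (v i 0 k - u t (node i) 0 k) ^+ 2 <= C * h.
Proof.
have [cM [CM [cM0 _ Hmass]]] := mass_bounds.
have [c c0 HE] := rel_entropy_lower_bound.
exists (c * cM); first by rewrite mulr_gt0.
move=> h Hh h1 C t v C_ge0 tT Kv Ev i k.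
have h0 : 0 < h by exact: H0.
have hd : 0 < h ^+ d by rewrite exprn_gt0.
have dp : (d.+1 <= p * 2)%N.
  by rewrite -(ltr_nat R) natrM -ltr_pdivrMr.
have := HE h Hh t v tT Kv; rewrite /sqr_error => HS.
have : mass (Dh h) 0 i * dot (v i - u t (node i)) (v i - u t (node i)) <=
    sqr_error t v.
  rewrite /sqr_error (bigD1 i)//= lerDl; apply: sumr_ge0 => j _.
  by rewrite mulr_ge0 ?dot_ge0// ltW// mass_gt0.
have ek := sqr_coord_le_dot (v i - u t (node i)) k; rewrite !mxE in ek.
set x := v i 0 k - _ in ek *; set y := dot _ _ in ek *.
have [/(_ i) Hm _] := Hmass h Hh => Hy.
have hp : h ^+ p ^+ 2 <= h ^+ d * h.
  by rewrite -exprM -exprSr ler_wiXn2l// ltW.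
have x0 : 0 <= x ^+ 2 by exact: sqr_ge0.
have H1 : cM * h ^+ d * x ^+ 2 <= sqr_error t v.
  apply: le_trans Hy; apply: ler_pM => //.
  by rewrite mulr_ge0// ltW.
have H2 := ler_wpM2l (ltW c0) H1.
have H3 := ler_wpM2l C_ge0 hp.
have H4 := le_trans (le_trans (le_trans H2 HS) Ev) H3.
rewrite -(ler_pM2r hd); move: H4.
have <- : c * cM * x ^+ 2 * h ^+ d = c * (cM * h ^+ d * x ^+ 2) by ring.
by have <- : C * h * h ^+ d = C * (h ^+ d * h) by ring.
Qed.

(* The estimate that closes the argument also yields the strict inequality that
   keeps the states off the boundary of the tube. *)
Lemma stays_in_tube (r : R) : 0 < r ->
  (forall t x (b : 'rV[R]_n), 0 <= t <= T ->
     (forall k, `|b 0 k - u t x 0 k| <= r) -> K° b) ->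
  exists h0 C : R, [/\ 0 < h0, 0 <= C &
  forall h, H h -> h < h0 -> forall v : R -> 'I_(nnodes (Dh h)) -> 'rV[R]_n,
  (forall i, {within `[0, T], continuous (v^~ i)}) ->
  (forall i, v 0 i = @v0 h i) ->
  (forall t, 0 < t < T -> in_tube r t (v t) -> forall i, exists2 dv,
     is_derive t (1 : R) (v^~ i) dv & sbp_equation t (v t) i dv) ->
  forall t, 0 <= t <= T -> (forall i k, `|v t i 0 k - u t (node i) 0 k| < r) /\
    rel_entropy U (u t) (v t) <= C * h ^+ p ^+ 2].
Proof.
move=> r0 tube.
have [C1 [C2 [C1_ge0 C2_ge0 rate]]] := rel_entropy_rate r0 tube.
have [c c0 Hc] := sqr_coord_error_bound.
have [cE cE0 HE] := rel_entropy_lower_bound.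
(* The Gronwall bound at time [T] for initial entropy [C0 ^+ 2 * h ^+ p ^+ 2] and inhomogeneity
   [C2 * h ^+ p ^+ 2], with the common power of [h] taken out. *)
pose C := (C0 ^+ 2 + C2 * T) * expR (C1 * T).
have C_ge0 : 0 <= C by rewrite mulr_ge0 ?expR_ge0// addr_ge0 ?sqr_ge0// mulr_ge0// ltW.
(* The bound 1 allows powers of [h] to be compared; the other one yields [C * h < c * r ^+ 2], which
   keeps each coordinate error strictly below [r]. The shift [C + 1] avoids a zero denominator. *)
exists (Num.min 1 (c * r ^+ 2 / (C + 1))), C; split=> //.
  by rewrite lt_min ltr01 divr_gt0 ?mulr_gt0 ?exprn_gt0// ltr_wpDl.
move=> h Hh; rewrite lt_min => /andP[h1 hr] v cv v00 Hv.
have h0 : 0 < h by exact: H0.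
have Chr : C * h < c * r ^+ 2.
  rewrite ltr_pdivlMr ?ltr_wpDl// in hr; apply: le_lt_trans hr.
  by rewrite mulrDr mulr1 mulrC lerDl ltW.
have close t (w : 'I_(nnodes (Dh h)) -> 'rV[R]_n) : 0 <= t <= T -> (forall i, K (w i)) ->
    rel_entropy U (u t) w <= C * h ^+ p ^+ 2 ->
    forall i k, `|w i 0 k - u t (node i) 0 k| < r.
  move=> tT Kw Ew i k; have := Hc h Hh (ltW h1) C t w C_ge0 tT Kw Ew i k.
  move=> /le_lt_trans/(_ Chr); rewrite ltr_pM2l// -sqrtr_sqr -ltr_sqrt ?exprn_gt0//.
  by rewrite (sqrtr_sqr r) gtr0_norm.
have E_ge0 t (w : 'I_(nnodes (Dh h)) -> 'rV[R]_n) : 0 <= t <= T ->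
    (forall i, K (w i)) -> 0 <= rel_entropy U (u t) w.
  move=> tT Kw; apply: le_trans (HE h Hh t w tT Kw).
  by rewrite mulr_ge0 ?(ltW cE0)//; exact: sqr_error_ge0.
have [Kv0 Ev0] := init Hh.
have Kv00 i : K (v 0 i) by rewrite v00.
have tT0 : 0 <= (0 : R) <= T by rewrite lexx ltW.
have E0 : rel_entropy U (u 0) (v 0) <= C0 ^+ 2 * h ^+ p ^+ 2.
  have -> : v 0 = @v0 h by apply/funext.
  have E0 := E_ge0 0 _ tT0 Kv0.
  rewrite -exprMn -[leLHS]sqr_sqrtr// ler_pXn2r ?nnegrE ?sqrtr_ge0//.
  by rewrite mulr_ge0// exprn_ge0// ltW.
pose X := h ^+ p ^+ 2.
have X0 : 0 <= X by exact: sqr_ge0.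
have exp_ge1 t : 0 <= t -> 1 <= expR (C1 * t).
  by move=> t0; rewrite -expR0 ler_expR mulr_ge0.
have cu (i : 'I_(nnodes (Dh h))) : {within `[0, T], continuous (fun t => u t (node i))}.
  by apply: within_slab_slice; have [_ _ /Ck_continuous_within] := uS.
have step t : 0 <= t <= T -> (forall tau, 0 <= tau <= t -> in_tube r tau (v tau)) ->
    rel_entropy U (u t) (v t) <= C * X.
  move=> /andP[t0 tT] vt.
  have sub tau : 0 <= tau <= t -> 0 <= tau <= T.
    by move=> /andP[-> /le_trans]; apply.
  have subo tau : 0 < tau < t -> [/\ 0 < tau < T, 0 <= tau <= t & 0 <= tau <= T].
    move=> /andP[tau0 taut]; have tauT := lt_le_trans taut tT.
    by rewrite tau0 tauT !ltW.
  have sub' : `[0, t]%classic `<=` `[0, T]%classic by apply: subset_itvl; rewrite bnd_simp.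
  have Kv tau i : 0 <= tau <= t -> K (v tau i).
    move=> taut; apply: interior_subset; apply: (tube tau (node i)); first exact: sub.
    by move=> k; exact: vt.
  have /boolp.choice[dE HdE] tau : exists dE : R, 0 < tau < t ->
      is_derive tau (1 : R) (fun t => rel_entropy U (u t) (v t)) dE /\
      dE <= C1 * rel_entropy U (u tau) (v tau) + C2 * X.
    have [taut|nst] := boolP (0 < tau < t); last by exists 0.
    have [tauT taut' _] := subo tau taut.
    have [dE D1 D2] := rate h Hh v tau tauT (vt tau taut') (Hv tau tauT (vt tau taut')).
    by exists dE.
  have contE : {within `[0, t], continuous (fun t => rel_entropy U (u t) (v t))}.
    apply: (within_continuous_rel_entropy oA U2) => [i tau|i|i].
    - rewrite /= in_itv/= => taut; split; apply: KA; first exact/Ku/sub.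
      exact: Kv.
    - exact: continuous_subspaceW sub' (cu i).
    - exact: continuous_subspaceW sub' (cv i).
  have := gronwall t0 C1_ge0 (mulr_ge0 C2_ge0 X0) contE (fun tau taut => (HdE tau taut).1)
    (fun tau taut => (HdE tau taut).2).
  move=> /le_trans; apply; rewrite /C.
  have -> : (C0 ^+ 2 + C2 * T) * expR (C1 * T) * X =
      (C0 ^+ 2 * X + C2 * X * T) * expR (C1 * T) by ring.
  apply: ler_pM.
  - exact: (addr_ge0 (E_ge0 0 _ tT0 Kv00) (mulr_ge0 (mulr_ge0 C2_ge0 X0) t0)).
  - exact: expR_ge0.
  - by apply: lerD => //; rewrite ler_wpM2l// mulr_ge0.
  - by rewrite ler_expR ler_wpM2l.
pose phi (j : 'I_(nnodes (Dh h)) * 'I_n) t : R :=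
  `|v t j.1 0 j.2 - u t (node j.1) 0 j.2|.
have cphi j : {within `[0, T], continuous (phi j)}.
  have cvj := within_continuous_coord (k := j.2) (cv j.1).
  have cuj := within_continuous_coord (k := j.2) (cu j.1).
  by move=> t; exact: (cvg_norm (cvgB (cvj t) (cuj t))).
have Kt t : 0 <= t <= T -> in_tube r t (v t) -> forall i, K (v t i).
  by move=> tT vt i; apply: interior_subset; exact: (tube t (node i)).
have inside t : 0 <= t <= T -> (forall tau, 0 <= tau <= t -> in_tube r tau (v tau)) ->
    forall i k, `|v t i 0 k - u t (node i) 0 k| < r.
  move=> tT vt; apply: close => //; last exact: step.
  by apply: Kt => //; apply: vt; case/andP: tT => -> _; rewrite lexx.
(* The initial entropy bound already implies the final one, because [C0 ^+ 2 <= C]; this places the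
   initial states in the tube. *)
have phi0 j : phi j 0 <= r.
  apply: ltW; apply: close => //; apply: le_trans E0 _; rewrite ler_wpM2r//.
  have C2T : 0 <= C2 * T by rewrite mulr_ge0// ltW.
  apply: le_trans (ler_peMr _ (exp_ge1 T (ltW T0))); first by rewrite lerDl.
  by rewrite addr_ge0 ?sqr_ge0.
have tubeT := barrier (ltW T0) cphi phi0 (fun t tT Hs =>
  fun j => inside t tT (fun tau taut i k => Hs tau (i, k) taut) j.1 j.2).
move=> t tT; split=> [i k|]; first exact: (tubeT t (i, k)).
apply: step => // tau /andP[tau0 taut] i k; apply: ltW; apply: (tubeT tau (i, k)).
by case/andP: tT => _ /(le_trans taut) ->; rewrite tau0.
Qed.

(** The tube is a coordinate box around [u], so clamping each coordinate maps into it and does not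
    increase sup distances. The argument is flattened to pairs of node and component, the format of
    [picard_existence]. *)
Definition tube_projection (r : R) (D : discretization R d) (t : R)
    (x : 'I_(nnodes D) * 'I_n -> R) (i : 'I_(nnodes D)) : 'rV[R]_n :=
  \row_k clamp (u t (node i) 0 k - r) (u t (node i) 0 k + r) (x (i, k)).

(* The semidiscrete right-hand side, with the states projected to the tube
   around [u] and the time projected to [0, T]: this extension is globally
   Lipschitz in [x]. *)
Definition truncated_rhs (r : R) (D : discretization R d) (t : R)
    (x : 'I_(nnodes D) * 'I_n -> R) (ik : 'I_(nnodes D) * 'I_n) : R :=
  s (clamp 0 T t) (node ik.1) 0 ik.2 - (mass D 0 ik.1)^-1 *
    \sum_(m < d) 2 * \sum_j sbpQ D m ik.1 j *
      fnum m (tube_projection r (clamp 0 T t) x ik.1)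
             (tube_projection r (clamp 0 T t) x j) 0 ik.2.

Lemma tube_projection_id r D t (v : 'I_(nnodes D) -> 'rV[R]_n) i :
  in_tube r t v -> tube_projection r t (fun ik => v ik.1 0 ik.2) i = v i.
Proof.
move=> vt; apply/rowP => k; rewrite mxE clamp_id//=.
by have := vt i k; rewrite ler_norml => /andP[? ?]; apply/andP; split; lra.
Qed.

(** Inside the tube the projection is the identity, and the positive mass can be divided out. *)
Lemma truncated_rhsE r D t (v : 'I_(nnodes D) -> 'rV[R]_n) i (dv : 'rV[R]_n) :
  0 < mass D 0 i -> 0 <= t <= T -> in_tube r t v ->
  sbp_equation t v i dv <->
  (forall k, dv 0 k = truncated_rhs r t (fun ik => v ik.1 0 ik.2) (i, k)).
Proof.
move=> m0 tT vt; have mN0 : mass D 0 i != 0 by rewrite gt_eqF.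
have E k : truncated_rhs r t (fun ik => v ik.1 0 ik.2) (i, k) = s t (node i) 0 k -
    (mass D 0 i)^-1 * (\sum_(m < d) 2 *: \sum_j sbpQ D m i j *: fnum m (v i) (v j)) 0 k.
  rewrite /truncated_rhs clamp_id//=; congr (_ - _ * _).
  rewrite summxE; apply: eq_bigr => m _; rewrite mxE summxE; congr (_ * _).
  by apply: eq_bigr => j _; rewrite mxE !tube_projection_id.
rewrite /sbp_equation; split=> [dvE k|dvE].
  rewrite E; have := congr1 (fun b : 'rV[R]_n => b 0 k) dvE.
  rewrite mxE [in X in X + _ = _]mxE [in RHS]mxE.
  move=> qE; apply: (mulfI mN0); rewrite mulrBr mulrA mulfV// mul1r -qE addrK//.
apply/rowP => k; rewrite mxE [in X in X + _ = _]mxE [in RHS]mxE dvE E.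
by rewrite mulrBr mulrA mulfV// mul1r subrK.
Qed.

Let tubeK (r : R) := forall t x (b : 'rV[R]_n), 0 <= t <= T ->
  (forall k, `|b 0 k - u t x 0 k| <= r) -> K° b.

Lemma tube_projection_in r D t x i : 0 <= r -> tubeK r -> 0 <= t <= T ->
  K (@tube_projection r D t x i).
Proof.
move=> r0 tube tT; apply: interior_subset; apply: (tube t (node i)) => // k.
rewrite mxE ler_norml.
have lohi : u t (node i) 0 k - r <= u t (node i) 0 k + r by lra.
have /andP[] := clamp_itv (x (i, k)) lohi.
by move=> ? ?; apply/andP; split; lra.
Qed.

Let T_ge0 : 0 <= T. Proof. exact: ltW. Qed.

(** The constant depends on the discretization through the masses and [sbpQ]. This is harmless: it
    serves existence and uniqueness for a fixed member, never the error estimate. *)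
Lemma truncated_rhs_lipschitz r D : 0 <= r -> tubeK r -> exists2 C : R, 0 <= C &
  forall t x y (e : R) ik, (forall jl, `|x jl - y jl| <= e) ->
    `|@truncated_rhs r D t x ik - truncated_rhs r t y ik| <= C * e.
Proof.
move=> r0 tube.
have [|[m k]|C C_ge0 HC] := @fin_bound R ('I_d * 'I_n)%type (fun mk C =>
    forall a b a' b' (e : R), K a -> K b -> K a' -> K b' ->
    (forall k, `|a 0 k - a' 0 k| <= e) -> (forall k, `|b 0 k - b' 0 k| <= e) ->
    0 <= e -> `|fnum mk.1 a b 0 mk.2 - fnum mk.1 a' b' 0 mk.2| <= C * e).
- move=> mk c c' cc' Hc a b a' b' e Ka Kb Ka' Kb' aa' bb' e0.
  by apply: le_trans (Hc a b a' b' e Ka Kb Ka' Kb' aa' bb' e0) _; rewrite ler_wpM2r.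
- have [fm _ _ _] := ec m.
  have [C _ HC] := C1_lipschitz_prod oA (Ck_coord k (Ck_le (isT : 1 <= p.+1)%N fm)) cK vK KA.
  by exists C => a b a' b' e *; exact: HC.
pose B := \sum_i `|(mass D 0 i)^-1| * \sum_(m < d) 2 * \sum_j `|sbpQ D m i j|.
have B_ge0 i : 0 <= `|(mass D 0 i)^-1| * \sum_(m < d) 2 * \sum_j `|sbpQ D m i j|.
  by rewrite mulr_ge0// sumr_ge0// => m _; rewrite mulr_ge0// sumr_ge0.
exists (B * C); first by rewrite mulr_ge0// sumr_ge0.
move=> t x y e [i k] xy.
have e0 : 0 <= e := le_trans (normr_ge0 _) (xy (i, k)).
have projD j l : `|tube_projection r (clamp 0 T t) x j 0 l -
                   tube_projection r (clamp 0 T t) y j 0 l| <= e.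
  by rewrite !mxE; apply: clamp_lipschitz; rewrite ?subrr ?normr0.
have projK z j : K (tube_projection r (clamp 0 T t) z j).
  by apply: tube_projection_in => //; exact: clamp_itv.
rewrite /truncated_rhs/= opprD addrACA subrr add0r -opprD normrN -mulrBr normrM.
apply: le_trans (_ : `|(mass D 0 i)^-1| *
  ((\sum_(m < d) 2 * \sum_j `|sbpQ D m i j|) * (C * e)) <= _); last first.
  rewrite mulrA -[leRHS]mulrA ler_wpM2r ?mulr_ge0//.
  by rewrite /B (bigD1 i)//= lerDl sumr_ge0.
rewrite ler_wpM2l// -sumrB mulr_suml; apply: le_trans (ler_norm_sum _ _ _) _.
apply: ler_sum => m _; rewrite -mulrBr normrM gtr0_norm// -mulrA ler_wpM2l//.
rewrite -sumrB mulr_suml; apply: le_trans (ler_norm_sum _ _ _) _.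
apply: ler_sum => j _; rewrite -mulrBr normrM ler_wpM2l//.
exact: (HC (m, k)).
Qed.

Lemma continuous_truncated_rhs r D (x : R -> 'I_(nnodes D) * 'I_n -> R) ik :
  0 <= r -> tubeK r -> (forall jl, continuous (x^~ jl)) ->
  continuous (fun t => truncated_rhs r t (x t) ik).
Proof.
move=> r0 tube cx; case: ik => i k.
have coord (c : R -> 'rV[R]_n) l : continuous c -> continuous (fun t => c t 0 l : R).
  move=> cc t; apply: (@continuous_comp _ _ _ c (fun y : 'rV[R]_n => y 0 l) t (cc t)).
  exact: coord_continuous.
have cu y l : continuous (fun t => u (clamp 0 T t) y 0 l : R).
  apply: coord; apply: (within_continuous_clamp (c := fun t => u t y)) => //.
  by apply: within_slab_slice; have [_ _ /Ck_continuous_within] := uS.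
have cs y l : continuous (fun t => s (clamp 0 T t) y 0 l : R).
  apply: coord; apply: (within_continuous_clamp (c := fun t => s t y)) => //.
  by apply: within_slab_slice; have [] := sB.
have cproj j : continuous (fun t => tube_projection r (clamp 0 T t) (x t) j).
  move=> t; apply: continuous_rV => l.
  have -> : (fun t => tube_projection r (clamp 0 T t) (x t) j 0 l) =
      (fun t => clamp (u (clamp 0 T t) (node j) 0 l - r) (u (clamp 0 T t) (node j) 0 l + r)
                  (x t (j, l))) by apply/funext => z; rewrite mxE.
  have lo : continuous (fun t => u (clamp 0 T t) (node j) 0 l - r).
    by move=> z; exact: (cvgB (cu _ _ z) (cvg_cst r)).
  have hi : continuous (fun t => u (clamp 0 T t) (node j) 0 l + r).
    by move=> z; exact: (cvgD (cu _ _ z) (cvg_cst r)).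
  exact: (continuous_clamp lo hi (cx (j, l))).
have cfnum m j : continuous (fun t => fnum m (tube_projection r (clamp 0 T t) (x t) i)
    (tube_projection r (clamp 0 T t) (x t) j) 0 k : R).
  apply: coord => t; have [fm _ _ _] := ec m.
  have projA (z : 'I_(nnodes D) * 'I_n -> R) l : A (tube_projection r (clamp 0 T t) z l).
    by apply: KA; apply: tube_projection_in => //; exact: clamp_itv.
  have cf := Ck_continuous (open_setX oA oA) fm
    (conj (projA (x t) i) (projA (x t) j) : (A `*` A) (_, _)).
  exact: (continuous_comp (cvg_pair (cproj i t) (cproj j t)) cf).
have cM (g : R -> R) c : continuous g -> continuous (fun t => c * g t).
  by move=> cg t; exact: (cvgM (cvg_cst c) (cg t)).
move=> t; apply: (cvgB (cs (node i) k t)); apply: (cM _).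
apply: continuous_bigsum => m; apply: (cM _).
by apply: continuous_bigsum => j; apply: (cM _); exact: cfnum.
Qed.

Lemma truncated_solution r D (v0D : 'I_(nnodes D) -> 'rV[R]_n) : 0 <= r -> tubeK r ->
  exists v : R -> 'I_(nnodes D) -> 'rV[R]_n, (forall i, v 0 i = v0D i) /\
  forall t i, 0 <= t <= T -> is_derive t (1 : R) (v^~ i)
    (\row_k truncated_rhs r t (fun ik => v t ik.1 0 ik.2) (i, k)).
Proof.
move=> r0 tube; have [C C_ge0 lip] := truncated_rhs_lipschitz D r0 tube.
(* [picard_existence] asks for a strictly positive Lipschitz constant. *)
have C1 : 0 < C + 1 by rewrite ltr_wpDl.
have lip1 t (x y : 'I_(nnodes D) * 'I_n -> R) (e : R) ik : (forall jl, `|x jl - y jl| <= e) ->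
    `|truncated_rhs r t x ik - truncated_rhs r t y ik| <= (C + 1) * e.
  move=> xy; apply: le_trans (lip t x y e ik xy) _; rewrite ler_wpM2r ?lerDl//.
  exact: le_trans (normr_ge0 _) (xy ik).
have [x [x0 Dx]] := picard_existence (fun ik => v0D ik.1 0 ik.2) T_ge0 C1
  (fun x ik => @continuous_truncated_rhs r D x ik r0 tube) lip1.
exists (fun t i => \row_k x t (i, k)); split=> [i|t i tT].
  by apply/rowP => k; rewrite mxE x0.
apply/is_derive_coordP => k; rewrite mxE.
have -> : (fun t => (\row_k x t (i, k)) 0 k) = x^~ (i, k) by apply/funext => z; rewrite mxE.
have -> : (fun ik => (\row_l x t (ik.1, l)) 0 ik.2) = x t.
  by apply/funext => -[j l]; rewrite mxE.
exact: Dx.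
Qed.

(** [stays_in_tube] asks for the scheme only while the states are in the tube, so it applies twice.
    For the truncated solution it shows that the truncation is never active; for any competitor with
    values in [A] it shows confinement to the tube, where both curves solve the same Lipschitz
    system. *)
Lemma semidiscrete_convergence : exists2 h0 : R, 0 < h0 & exists CT : R,
  forall h, H h -> h < h0 ->
  exists v : R -> 'I_(nnodes (Dh h)) -> 'rV[R]_n,
  [/\ semidiscrete_solution T A fnum s (@v0 h) v,
      forall v' : R -> 'I_(nnodes (Dh h)) -> 'rV[R]_n,
        semidiscrete_solution T A fnum s (@v0 h) v' ->
        forall (t : R) i, t \in `[0, T] -> v' t i = v t i,
      forall (t : R) i, t \in `[0, T] -> K (v t i)
    & forall t : R, t \in `[0, T] ->
        normM (fun i => v t i - u t (node i)) <= CT * h ^+ p].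
Proof.
have [r r0 tube] := tube_radius L0 uS adm.
have [h0 [C [h0_gt0 C_ge0 stay]]] := stays_in_tube r0 tube.
have [c c0 HE] := rel_entropy_lower_bound.
(* Coercivity and the entropy bound give [c] times the squared error at most [C * h ^+ p ^+ 2]. *)
exists h0 => //; exists (Num.sqrt (C / c)) => h Hh hh0.
have m0 i := mass_gt0 i Hh.
have [v [v0E Dv]] := truncated_solution (@v0 h) (ltW r0) tube.
have cv i : {within `[0, T], continuous (v^~ i)}.
  apply: has_deriv_in_continuous => t; rewrite /= in_itv/= => tT.
  by have D := Dv t i tT; eexists; exact: is_derive_has_deriv_in D.
have Dsbp t i : 0 <= t <= T -> in_tube r t (v t) ->
    exists2 dv, is_derive t (1 : R) (v^~ i) dv & sbp_equation t (v t) i dv.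
  move=> tT vt; have D := Dv t i tT; apply: (ex_intro2 _ _ _ D).
  by apply/(truncated_rhsE _ (m0 i) tT vt) => k; rewrite mxE.
have ooW t : 0 < t < T -> 0 <= t <= T by move=> /andP[? ?]; rewrite !ltW.
have Sv := stay h Hh hh0 v cv v0E (fun t tT vt i => Dsbp t i (ooW t tT) vt).
have in_tubeW t (w : 'I_(nnodes (Dh h)) -> 'rV[R]_n) :
    (forall i k, `|w i 0 k - u t (node i) 0 k| < r) -> in_tube r t w.
  by move=> wt i k; exact/ltW.
have vt t : 0 <= t <= T -> in_tube r t (v t) by move=> tT; apply: in_tubeW; case: (Sv t tT).
have Kv t i : 0 <= t <= T -> K (v t i).
  by move=> tT; apply: interior_subset; apply: (tube t (node i)) => // k; exact: vt.
exists v; split=> [|w|t i|t].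
- split=> // t i; rewrite in_itv/= => tT; first exact/KA/Kv.
  have [dv D Edv] := Dsbp t i tT (vt t tT); exists dv => //.
  exact: is_derive_has_deriv_in.
- move=> [w0E _ Dw] t i; rewrite in_itv/= => tT.
  have cw j : {within `[0, T], continuous (w^~ j)}.
    apply: has_deriv_in_continuous => z; rewrite /= => zT.
    by have [dw D _] := Dw z j zT; exists dw.
  have Dwsbp z j : 0 < z < T ->
      exists2 dw, is_derive z (1 : R) (w^~ j) dw & sbp_equation z (w z) j dw.
    move=> zT; have zI : z \in `[0, T] by rewrite in_itv/= ooW.
    have [dw D Edw] := Dw z j zI; exists dw => //.
    exact: has_deriv_in_is_derive zT D.
  have Sw := stay h Hh hh0 w cw w0E (fun z zT _ j => Dwsbp z j zT).
  have wt z : 0 <= z <= T -> in_tube r z (w z) by move=> zT; apply: in_tubeW; case: (Sw z zT).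
  have [C' C'_ge0 lip] := truncated_rhs_lipschitz (Dh h) (ltW r0) tube.
  apply/rowP => k.
  apply: (lipschitz_ode_unique C'_ge0 lip (x := fun t ik => w t ik.1 0 ik.2)
    (y := fun t ik => v t ik.1 0 ik.2) _ _ _ _ _ (i, k) tT).
  + by move=> jl; exact: within_continuous_coord (cw jl.1).
  + by move=> jl; exact: within_continuous_coord (cv jl.1).
  + move=> z [j l] zT; have [dw D Edw] := Dwsbp z j zT.
    have /(truncated_rhsE _ (m0 j) (ooW z zT) (wt z (ooW z zT)))/(_ l) <- := Edw.
    by have /is_derive_coordP := D; exact.
  + move=> z [j l] zT; have /is_derive_coordP/(_ l) := Dv z j (ooW z zT).
    by rewrite mxE.
  + by move=> [j l]; rewrite /= w0E v0E.
- by rewrite in_itv/=; exact: Kv.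
- rewrite in_itv/= => tT; have [_ Ev] := Sv t tT.
  have hp : 0 <= h ^+ p by rewrite exprn_ge0// ltW//; exact: H0.
  rewrite -[leRHS]ger0_norm ?mulr_ge0// -sqrtr_sqr exprMn sqr_sqrtr; last first.
    by rewrite divr_ge0// ltW.
  apply: ler_wsqrtr; rewrite mulrAC ler_pdivlMr// mulrC.
  exact: le_trans (HE h Hh t (v t) tT (fun i => Kv t i tT)) Ev.
Qed.

End Convergence.

Theorem theorem3p1 (R : realType) (d n p : nat) (L T : R)
    (A K : set 'rV[R]_n)
    (f : 'I_d -> 'rV[R]_n -> 'rV[R]_n)
    (s u : R -> 'rV[R]_d -> 'rV[R]_n)
    (U : 'rV[R]_n -> R) (F : 'I_d -> 'rV[R]_n -> R)
    (fnum : 'I_d -> 'rV[R]_n -> 'rV[R]_n -> 'rV[R]_n)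
    (H : set R) (Dh : R -> discretization R d)
    (v0 : forall h : R, 'I_(nnodes (Dh h)) -> 'rV[R]_n) (C0 : R) :
  (1 <= p)%N -> (1 <= d)%N -> d%:R / 2 < p%:R :> R ->
  0 < L -> 0 < T ->
  open A -> convex_set A ->
  (forall m, Ck 1 A (f m)) ->
  entropy_pair A f U F ->
  smooth_solution L T p A f s u ->
  admissible_states T A U s u K ->
  bounded_continuous_source L T s ->
  entropy_conservative p A f U F fnum ->
  H `<=` [set h : R | 0 < h] ->
  sbp_family L p H Dh ->
  structural_remainder_bound T U fnum K u H Dh ->
  0 <= C0 ->
  (forall h, H h ->
    (forall i, K (v0 h i)) /\
    Num.sqrt (rel_entropy U (u 0) (v0 h)) <= C0 * h ^+ p) ->
  exists2 h0 : R, 0 < h0 & exists CT : R,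
    forall h, H h -> h < h0 ->
    exists v : R -> 'I_(nnodes (Dh h)) -> 'rV[R]_n,
    [/\ semidiscrete_solution T A fnum s (v0 h) v,
        forall v' : R -> 'I_(nnodes (Dh h)) -> 'rV[R]_n,
          semidiscrete_solution T A fnum s (v0 h) v' ->
          forall (t : R) i, t \in `[0, T] -> v' t i = v t i,
        forall (t : R) i, t \in `[0, T] -> K (v t i)
      & forall t : R, t \in `[0, T] ->
          normM (fun i => v t i - u t (node i)) <= CT * h ^+ p].
Proof.
move=> _ _ pd L0 T0 oA _ f1 UF uS adm sB ec H0 sbp srb C0_ge0 init.
exact: (semidiscrete_convergence L0 T0 oA f1 UF uS adm sB ec H0 sbp srb pd C0_ge0 init).
Qed.
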